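(* There exists an algorithm that, given an undirected weighted graph $G$ with $n$ vertices and two vertices $s,t$, for all edges $d_1,d_2,d_3\in\pi_G(s,t)$, outputs $|\pi_{G-\{d_1,d_2,d_3\}}(s,t)|$, in total time $\tilde{O}(n^3)$.
   Context: $\pi_{G'}(u,v)$ denotes the (unique) shortest $u$-$v$ path in a graph $G'$, $|P|$ the length of a path $P$, and $G-F$ the graph with the edges in $F$ removed. $\tilde{O}(\cdot)$ hides polylogarithmic factors in $n$. *)

(* Defs.v *)
From HB Require Import structures.
From mathcomp Require Import all_boot all_order all_algebra.

Set Implicit Arguments.
Unset Strict Implicit.
Unset Printing Implicit Defensive.

Import Order.TTheory GRing.Theory Num.Theory.

Local Open Scope ring_scope.

(* Undirected weighted graphs on the vertex set 'I_n.  An edge is a two-element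
   set of vertices; only the values of [weight] on [edges] are meaningful.
   Taking the weights in a realDomainType covers integer, rational and real
   weights at once. *)
Record wgraph (R : realDomainType) (n : nat) := WGraph {
  edges : {set {set 'I_n}};
  weight : {set 'I_n} -> R;
  edge_card : forall e, e \in edges -> #|e| = 2%N;
  weight_ge0 : forall e, e \in edges -> 0 <= weight e
}.

Section Graphs.
Variables (R : realDomainType) (n : nat).
Implicit Types (G : wgraph R n) (F : {set {set 'I_n}}) (u v : 'I_n).

Lemma del_edge_card G F e : e \in edges G :\: F -> #|e| = 2%N.
Proof. by case/setDP => /edge_card. Qed.

Lemma del_weight_ge0 G F e : e \in edges G :\: F -> 0 <= weight G e.
Proof. by case/setDP => /weight_ge0. Qed.

(* G - F *)
Definition del G F : wgraph R n :=
  WGraph (@del_edge_card G F) (@del_weight_ge0 G F).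

Definition adj G : rel 'I_n := fun u v => [set u; v] \in edges G.

(* As in path.v, a path is given by its first vertex u and the sequence p of
   the vertices that follow. *)
Definition is_path G u v (p : seq 'I_n) : bool :=
  [&& path (adj G) u p, last u p == v & uniq (u :: p)].

Definition path_edges u (p : seq 'I_n) : seq {set 'I_n} :=
  pairmap (fun x y => [set x; y]) u p.

Definition path_length G u (p : seq 'I_n) : R :=
  \sum_(e <- path_edges u p) weight G e.

Definition shortest_path G u v (p : seq 'I_n) : Prop :=
  is_path G u v p /\
  forall q, is_path G u v q -> path_length G u p <= path_length G u q.

(* The standing assumption under which "the" shortest path from u to v is
   meaningful in G and in all the graphs obtained from G by edge removals. *)
Definition unique_shortest_paths G : Prop :=
  forall F u v p q,
    shortest_path (del G F) u v p -> shortest_path (del G F) u v q -> p = q.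

(* [x] is the length of the shortest path from u to v in G, with [None]
   standing for +oo, the length when v is not reachable from u. *)
Definition shortest_length G u v (x : option R) : Prop :=
  if x is Some l then
    exists2 p, shortest_path G u v p & path_length G u p = l
  else forall p, ~~ is_path G u v p.

End Graphs.

Local Open Scope nat_scope.

(* Machine model: a uniform random access machine with two kinds of cells.
   - Word cells hold integers modulo 2 ^ w, where w is the word size, and
     support word arithmetic, comparison and indirect addressing (word RAM).
   - Weight cells hold edge weights or +oo, which can only be copied, added and
     compared, each at unit cost (comparison-addition model).
   The memory is presented as a family of arrays [a], [a] being fixed in the
   program text, so that a program uses finitely many of them; a scalar
   variable is an array used at a fixed index.  Programs do not mention the
   weight domain. *)
Inductive wop := WAdd | WSub | WMul | WDiv | WMod.

Inductive wexp :=
  | WConst of nat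
  | WLoad of nat & wexp
  | WOp of wop & wexp & wexp.

Inductive vexp :=
  | VZero
  | VInf
  | VLoad of nat & wexp
  | VAdd of vexp & vexp.

Inductive bexp :=
  | BEqW of wexp & wexp
  | BLeW of wexp & wexp
  | BLeV of vexp & vexp
  | BNot of bexp
  | BAnd of bexp & bexp.

Inductive cmd :=
  | Skip
  | StoreW of nat & wexp & wexp
  | StoreV of nat & wexp & vexp
  | Seq of cmd & cmd
  | If of bexp & cmd & cmd
  | While of bexp & cmd.

Section Semantics.
Variables (R : realDomainType) (w : nat).

Record state := State {
  wmem : nat -> nat -> nat;
  vmem : nat -> nat -> option R
}.

Definition upd (T : Type) (m : nat -> nat -> T) (a i : nat) (x : T) :=
  fun b j => if (b == a) && (j == i) then x else m b j.

Definition wop_fun (o : wop) : nat -> nat -> nat :=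
  match o with
  | WAdd => addn | WSub => subn | WMul => muln | WDiv => divn | WMod => modn
  end.

Fixpoint weval (st : state) (e : wexp) : nat :=
  match e with
  | WConst k => k %% 2 ^ w
  | WLoad a e1 => wmem st a (weval st e1)
  | WOp o e1 e2 => wop_fun o (weval st e1) (weval st e2) %% 2 ^ w
  end.

Definition wt_add (x y : option R) : option R :=
  if x is Some a then if y is Some b then Some (a + b)%R else None else None.

Definition wt_le (x y : option R) : bool :=
  if y is Some b then if x is Some a then (a <= b)%R else false else true.

Fixpoint veval (st : state) (e : vexp) : option R :=
  match e with
  | VZero => Some 0%R
  | VInf => None
  | VLoad a e1 => vmem st a (weval st e1)
  | VAdd e1 e2 => wt_add (veval st e1) (veval st e2)
  end.

Fixpoint beval (st : state) (b : bexp) : bool :=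
  match b with
  | BEqW e1 e2 => weval st e1 == weval st e2
  | BLeW e1 e2 => weval st e1 <= weval st e2
  | BLeV e1 e2 => wt_le (veval st e1) (veval st e2)
  | BNot b1 => ~~ beval st b1
  | BAnd b1 b2 => beval st b1 && beval st b2
  end.

(* [exec c st tau st']: started in st, c halts in st' after tau steps.  Each
   assignment and each test is one step: the size of the expressions in a
   fixed program is bounded by a constant. *)
Inductive exec : cmd -> state -> nat -> state -> Prop :=
  | ExecSkip st : exec Skip st 0 st
  | ExecStoreW a i e st :
      exec (StoreW a i e) st 1
        (State (upd (wmem st) a (weval st i) (weval st e)) (vmem st))
  | ExecStoreV a i e st :
      exec (StoreV a i e) st 1
        (State (wmem st) (upd (vmem st) a (weval st i) (veval st e)))
  | ExecSeq c1 c2 st1 st2 st3 tau1 tau2 :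
      exec c1 st1 tau1 st2 -> exec c2 st2 tau2 st3 ->
      exec (Seq c1 c2) st1 (tau1 + tau2) st3
  | ExecIf b c1 c2 st st' tau :
      exec (if beval st b then c1 else c2) st tau st' ->
      exec (If b c1 c2) st tau.+1 st'
  | ExecWhileF b c st : ~~ beval st b -> exec (While b c) st 1 st
  | ExecWhileT b c st1 st2 st3 tau1 tau2 :
      beval st1 b -> exec c st1 tau1 st2 -> exec (While b c) st2 tau2 st3 ->
      exec (While b c) st1 (tau1 + tau2).+1 st3.

End Semantics.

(* Words of O(log n) bits; the constant c is chosen with the program. *)
Definition word_size (c n : nat) : nat := c * (trunc_log 2 n).+1.

Section Input.
Variables (R : realDomainType) (n : nat).
Implicit Types (G : wgraph R n) (s t : 'I_n).

(* Entry u * n + v of the adjacency matrix, +oo for a non-edge. *)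
Definition input_weight G (i : nat) : option R :=
  if (insub (i %/ n) : option 'I_n, insub (i %% n) : option 'I_n)
       is (Some u, Some v)
  then if adj G u v then Some (weight G [set u; v]) else None
  else None.

(* Word array 0 holds n, s, t and weight array 0 the adjacency matrix; all the
   other cells are blank. *)
Definition input_state G s t : state R :=
  State (fun a i => if a == 0 then nth 0 [:: n; nat_of_ord s; nat_of_ord t] i
                    else 0)
        (fun a i => if a == 0 then input_weight G i else None).

(* An s-t path has fewer than n edges, so that the triples of its edges are
   injectively numbered by their positions along the path. *)
Definition triple_index s (p : seq 'I_n) (d1 d2 d3 : {set 'I_n}) : nat :=
  let pos d := index d (path_edges s p) in
  (pos d1 * n + pos d2) * n + pos d3.

(* The answers are read in weight array 1. *)
Definition answer (st : state R) s (p : seq 'I_n) (d1 d2 d3 : {set 'I_n})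
    : option R :=
  vmem st 1 (triple_index s p d1 d2 d3).

End Input.

(* f is in O(g(n) polylog(n)) *)
Definition soft_O (f g : nat -> nat) : Prop :=
  exists C k n0 : nat,
    forall n, n0 <= n -> f n <= C * (g n * trunc_log 2 n ^ k).

(* Main.v *)
Require Import Defs.
From mathcomp Require Import all_boot all_order all_algebra.
From mathcomp Require Import zify ring lra.

Set Implicit Arguments.
Unset Strict Implicit.
Unset Printing Implicit Defensive.
Import Order.TTheory GRing.Theory Num.Theory.

(* Let P = v_0 ... v_L be the shortest s-t path, |x - y| the distance of v_x and
   v_y along P, and H(x, y) their distance without the edges of P.  The failures
   i <= j <= k cut P into four intervals A, B, C, D.  As subpaths of P are
   shortest, a replacement path may be assumed to visit each interval at most
   once, along a subpath of P, and to jump from one to the next at cost H: it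
   follows one of the patterns AD, ABD, ACD, ABCD, ACBD.  Let f_i(v) and g_k(v)
   be the least costs of going from s to v by one jump out of A, and from v to t
   by one jump into D.  The patterns AD, ABD, ACD are minima accumulated one
   index at a time.  The other two have the form

     min a(y) + |y - y'| + H(y', w) + |w - w'| + b(w'),  y, y' in B, w, w' in C,

   with (a, b) = (f_i, g_k) or (g_k, f_i).  For each of O(log n) scales 2^lam,
   let [l, e) be the block of size 2^lam of the dyadic lattice that contains j.
   For some lam, either y' >= l and w >= e, or the mirror image of this holds.
   In the first case w does not interact with j: if w' >= e, the minimum over w
   and w' depends on (lam, c, y', k) alone, where b is indexed by c; if w' < e,
   the path from w to w' passes through e, which separates w from w'.  Either
   way, the minima over y and y' are then accumulated as j moves through the
   block, at cost O(1) for each (lam, i, j, k).  The mirror image is dealt with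
   by running the same computation on the reversed path. *)

Definition tmin (R : realDomainType) (x y : option R) :=
  if wt_le x y then x else y.

Section Evaluation.
Variable R : realDomainType.
Implicit Types (wm : nat -> nat -> nat) (vm : nat -> nat -> option R).

Fixpoint neval wm (e : wexp) : nat :=
  match e with
  | WConst k => k
  | WLoad a e1 => wm a (neval wm e1)
  | WOp o e1 e2 => wop_fun o (neval wm e1) (neval wm e2)
  end.

Fixpoint nveval wm vm (e : vexp) : option R :=
  match e with
  | VZero => Some 0%R
  | VInf => None
  | VLoad a e1 => vm a (neval wm e1)
  | VAdd e1 e2 => wt_add (nveval wm vm e1) (nveval wm vm e2)
  end.

Fixpoint nbeval wm vm (b : bexp) : bool :=
  match b with
  | BEqW e1 e2 => neval wm e1 == neval wm e2
  | BLeW e1 e2 => neval wm e1 <= neval wm e2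
  | BLeV e1 e2 => wt_le (nveval wm vm e1) (nveval wm vm e2)
  | BNot b1 => ~~ nbeval wm vm b1
  | BAnd b1 b2 => nbeval wm vm b1 && nbeval wm vm b2
  end.

Definition cval_from wm vm (x : option R) (cs : seq (bexp * vexp)) :=
  foldl (fun acc c =>
    if nbeval wm vm c.1 then tmin acc (nveval wm vm c.2) else acc) x cs.

Definition cval wm vm cs := cval_from wm vm None cs.

Fixpoint wreads (P : pred nat) (e : wexp) : bool :=
  match e with
  | WConst _ => true
  | WLoad a e1 => P a && wreads P e1
  | WOp _ e1 e2 => wreads P e1 && wreads P e2
  end.

Fixpoint vreads (P Q : pred nat) (e : vexp) : bool :=
  match e with
  | VZero => true
  | VInf => true
  | VLoad a e1 => Q a && wreads P e1
  | VAdd e1 e2 => vreads P Q e1 && vreads P Q e2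
  end.

Fixpoint breads (P Q : pred nat) (b : bexp) : bool :=
  match b with
  | BEqW e1 e2 => wreads P e1 && wreads P e2
  | BLeW e1 e2 => wreads P e1 && wreads P e2
  | BLeV e1 e2 => vreads P Q e1 && vreads P Q e2
  | BNot b1 => breads P Q b1
  | BAnd b1 b2 => breads P Q b1 && breads P Q b2
  end.

Definition agree (T : Type) (P : pred nat) (m1 m2 : nat -> nat -> T) :=
  forall a, P a -> m1 a =1 m2 a.

Lemma eq_neval P wm1 wm2 e :
  agree P wm1 wm2 -> wreads P e -> neval wm1 e = neval wm2 e.
Proof.
move=> H; elim: e => //= [a e IH /andP[/H Ha /IH ->]|o e1 IH1 e2 IH2] //.
by case/andP=> /IH1 -> /IH2 ->.
Qed.

Lemma eq_nveval P Q wm1 wm2 vm1 vm2 e :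
  agree P wm1 wm2 -> agree Q vm1 vm2 -> vreads P Q e ->
  nveval wm1 vm1 e = nveval wm2 vm2 e.
Proof.
move=> H HQ; elim: e => //= [a e /andP[/HQ Ha /(eq_neval H) ->]|e1 IH1 e2 IH2] //.
by case/andP=> /IH1 -> /IH2 ->.
Qed.

Lemma eq_nbeval P Q wm1 wm2 vm1 vm2 b :
  agree P wm1 wm2 -> agree Q vm1 vm2 -> breads P Q b ->
  nbeval wm1 vm1 b = nbeval wm2 vm2 b.
Proof.
move=> H HQ; elim: b => //=.
- by move=> e1 e2 /andP[/(eq_neval H) -> /(eq_neval H) ->].
- by move=> e1 e2 /andP[/(eq_neval H) -> /(eq_neval H) ->].
- by move=> e1 e2 /andP[/(eq_nveval H HQ) -> /(eq_nveval H HQ) ->].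
- by move=> b IH /IH ->.
- by move=> b1 IH1 b2 IH2 /andP[/IH1 -> /IH2 ->].
Qed.

Lemma eq_cval P Q wm1 wm2 vm1 vm2 cs :
  agree P wm1 wm2 -> agree Q vm1 vm2 ->
  all (fun c => breads P Q c.1 && vreads P Q c.2) cs ->
  cval wm1 vm1 cs = cval wm2 vm2 cs.
Proof.
move=> H HQ; rewrite /cval; elim: cs None => //= -[b e] cs IH x /andP[/=].
by case/andP=> /(eq_nbeval H HQ) -> /(eq_nveval H HQ) -> /IH; apply.
Qed.

(* Word array a only holds values up to X ^ array_degree a, where X = n + 1;
   array 1 holds the loop variable, all the arrays other than 0 and 1 are
   written modulo 2 * n + 2. *)
Definition array_degree a := if a == 0 then 1 else if a == 1 then 6 else 2.

Fixpoint wdegree (e : wexp) : nat :=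
  match e with
  | WConst k => k
  | WLoad a _ => array_degree a
  | WOp WAdd e1 e2 => (maxn (wdegree e1) (wdegree e2)).+1
  | WOp WMul e1 e2 => wdegree e1 + wdegree e2
  | WOp _ e1 _ => wdegree e1
  end.

Fixpoint wbounded (c : nat) (e : wexp) : bool :=
  match e with
  | WConst k => k < c
  | WLoad _ e1 => wbounded c e1
  | WOp o e1 e2 => [&& wbounded c e1, wbounded c e2 & wdegree (WOp o e1 e2) < c]
  end.

Fixpoint vbounded c (e : vexp) : bool :=
  match e with
  | VZero => true
  | VInf => true
  | VLoad a e1 => wbounded c e1
  | VAdd e1 e2 => vbounded c e1 && vbounded c e2
  end.

Fixpoint bbounded c (b : bexp) : bool :=
  match b with
  | BEqW e1 e2 => wbounded c e1 && wbounded c e2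
  | BLeW e1 e2 => wbounded c e1 && wbounded c e2
  | BLeV e1 e2 => vbounded c e1 && vbounded c e2
  | BNot b1 => bbounded c b1
  | BAnd b1 b2 => bbounded c b1 && bbounded c b2
  end.

Definition mem_bounded (X : nat) wm := forall a i, wm a i <= X ^ array_degree a.

Variables (X w c : nat).
Hypotheses (X_gt1 : 1 < X) (Xw : X ^ c <= 2 ^ w).

Lemma neval_bound wm e : mem_bounded X wm -> neval wm e <= X ^ wdegree e.
Proof.
have X0 : 0 < X by apply: ltnW.
move=> Hwm; elim: e => [k|a e IH|o e1 IH1 e2 IH2] /=.
- by apply: ltnW; apply: ltn_expl.
- exact: Hwm.
case: o => /=.
- rewrite expnS; apply: (@leq_trans (2 * X ^ maxn (wdegree e1) (wdegree e2))).
    rewrite mul2n -addnn; apply: leq_add.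
      by apply: leq_trans IH1 _; rewrite leq_pexp2l // leq_maxl.
    by apply: leq_trans IH2 _; rewrite leq_pexp2l // leq_maxr.
  by rewrite leq_mul2r X_gt1 orbT.
- by apply: leq_trans IH1; apply: leq_subr.
- by rewrite expnD; apply: leq_mul.
- by apply: leq_trans IH1; apply: leq_div.
- by apply: leq_trans IH1; apply: leq_mod.
Qed.

Lemma weval_neval (st : state R) e :
  mem_bounded X (wmem st) -> wbounded c e -> weval w st e = neval (wmem st) e.
Proof.
move=> Hst; have small e' : wdegree e' < c -> neval (wmem st) e' < 2 ^ w.
  move=> d; apply: leq_trans Xw; apply: leq_ltn_trans (neval_bound e' Hst) _.
  by rewrite ltn_exp2l.
elim: e => [k kc|a e IH /= /IH -> //|o e1 IH1 e2 IH2] /=.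
  by rewrite modn_small //; apply: (@small (WConst k)).
case/and3P=> b1 b2 lt; rewrite (IH1 b1) (IH2 b2) modn_small //.
exact: (@small (WOp o e1 e2)).
Qed.

Lemma veval_nveval (st : state R) e :
  mem_bounded X (wmem st) -> vbounded c e ->
  veval w st e = nveval (wmem st) (vmem st) e.
Proof.
move=> Hst; elim: e => //= [a e /(weval_neval Hst) -> //|e1 IH1 e2 IH2].
by case/andP=> /IH1 -> /IH2 ->.
Qed.

Lemma beval_nbeval (st : state R) b :
  mem_bounded X (wmem st) -> bbounded c b ->
  beval w st b = nbeval (wmem st) (vmem st) b.
Proof.
move=> Hst; elim: b => //=.
- by move=> e1 e2 /andP[/(weval_neval Hst) -> /(weval_neval Hst) ->].
- by move=> e1 e2 /andP[/(weval_neval Hst) -> /(weval_neval Hst) ->].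
- by move=> e1 e2 /andP[/(veval_nveval Hst) -> /(veval_nveval Hst) ->].
- by move=> b IH /IH ->.
- by move=> b1 IH1 b2 IH2 /andP[/IH1 -> /IH2 ->].
Qed.

End Evaluation.

(* A phase fills one array cell by cell, the loop variable (cell 0 of word array
   1) being the index of the cell.  Weight array 2 cell 0 accumulates the minimum
   of the candidates.  Words are stored modulo 2 * n + 2, which bounds them
   whatever the program computes. *)
Inductive phase :=
  | PW of nat & wexp & bexp & wexp & wexp
  | PV of nat & wexp & seq (bexp * vexp).

Notation wone := (WConst 1).
Notation "x +w y" := (WOp WAdd x y) (at level 50, left associativity).
Notation "x -w y" := (WOp WSub x y) (at level 50, left associativity).
Notation "x *w y" := (WOp WMul x y) (at level 40, left associativity).
Notation "x /w y" := (WOp WDiv x y) (at level 40, left associativity).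
Notation "x %w y" := (WOp WMod x y) (at level 40, left associativity).

Definition lv := WLoad 1 (WConst 0).
Definition nn := WLoad 0 (WConst 0).
Definition wclip e := e %w (WConst 2 *w nn +w WConst 2).
Definition tmp := VLoad 2 (WConst 0).

Fixpoint relax_all (cs : seq (bexp * vexp)) : cmd :=
  if cs is (b, e) :: cs' then
    Seq (If b (If (BLeV tmp e) Skip (StoreV 2 (WConst 0) e)) Skip) (relax_all cs')
  else Skip.

Definition phase_body (ph : phase) : cmd :=
  match ph with
  | PW a _ b e1 e2 => If b (StoreW a lv (wclip e1)) (StoreW a lv (wclip e2))
  | PV a _ cs => Seq (StoreV 2 (WConst 0) VInf)
                   (Seq (relax_all cs) (StoreV a lv tmp))
  end.

Definition phase_size (ph : phase) : wexp :=
  match ph with PW _ N _ _ _ => N | PV _ N _ => N end.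

Definition phase_cost (ph : phase) : nat :=
  match ph with PW _ _ _ _ _ => 4 | PV _ _ cs => 3 * size cs + 4 end.

Definition phase_cmd (ph : phase) : cmd :=
  Seq (StoreW 1 (WConst 0) (WConst 0))
      (While (BNot (BLeW (phase_size ph) lv))
         (Seq (phase_body ph) (StoreW 1 (WConst 0) (lv +w wone)))).

Definition phases_cmd (phs : seq phase) : cmd := foldr (fun ph => Seq (phase_cmd ph)) Skip phs.

(* dw and dv list the word and weight arrays a phase may read. *)
Definition phase_wf c (dw dv : seq nat) (ph : phase) : bool :=
  match ph with
  | PW a N b e1 e2 =>
    let P := [pred x | x \in a :: 1 :: dw] in let Q := [pred x | x \in dv] in
    [&& a \notin 0 :: 1 :: dw, wreads [pred x | x \in dw] N,
        breads P Q b, wreads P e1 & wreads P e2] &&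
    [&& wbounded c N, wdegree N < 6, bbounded c b,
        wbounded c (wclip e1) & wbounded c (wclip e2)]
  | PV a N cs =>
    let P := [pred x | x \in 1 :: dw] in let Q := [pred x | x \in a :: dv] in
    [&& a \notin 0 :: 2 :: dv, wreads [pred x | x \in dw] N,
        all (fun x => breads P Q x.1 && vreads P Q x.2) cs,
        wbounded c N, wdegree N < 6 &
        all (fun x => bbounded c x.1 && vbounded c x.2) cs]
  end.

Fixpoint phases_wf c dw dv (phs : seq phase) : bool :=
  if phs is ph :: phs' then
    phase_wf c dw dv ph &&
    match ph with
    | PW a _ _ _ _ => phases_wf c (a :: dw) dv phs'
    | PV a _ _ => phases_wf c dw (a :: dv) phs'
    end
  else true.

Section Phases.
Variable R : realDomainType.
Implicit Types (wm : nat -> nat -> nat) (vm : nat -> nat -> option R).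

Definition with_lv wm (q : nat) : nat -> nat -> nat :=
  fun a i => if (a == 1) && (i == 0) then q else wm a i.

(* Hides the cells of array a that are not filled yet when cell q is computed. *)
Definition mask (T : Type) (x : T) (m : nat -> nat -> T) (a q : nat) : nat -> nat -> T :=
  fun b i => if (b == a) && (q <= i) then x else m b i.

Definition phase_eqn (ph : phase) wm vm : Prop :=
  match ph with
  | PW a N b e1 e2 =>
    forall q, q < neval wm N ->
      wm a q = neval (mask 0 (with_lv wm q) a q)
                 (wclip (if nbeval (mask 0 (with_lv wm q) a q) vm b then e1 else e2))
  | PV a N cs =>
    forall q, q < neval wm N ->
      vm a q = cval (with_lv wm q) (mask None vm a q) cs
  end.

Fixpoint phases_eqn (phs : seq phase) wm vm : Prop :=
  if phs is ph :: phs' then phase_eqn ph wm vm /\ phases_eqn phs' wm vm else True.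

Definition phases_time (phs : seq phase) wm : nat :=
  \sum_(ph <- phs) (phase_cost ph * neval wm (phase_size ph) + 2).

Variables (n w c : nat).
Hypotheses (n_gt0 : 0 < n) (nw : n.+1 ^ c <= 2 ^ w) (c_gt9 : 9 < c).

Let X_gt1 : 1 < n.+1. Proof. by []. Qed.
Let bound := mem_bounded n.+1.

Lemma wop_mod_bound wm e : wm 0 0 = n -> neval wm (wclip e) <= n.+1 ^ 2.
Proof.
move=> Hn /=; rewrite Hn; apply: ltnW; apply: (@leq_trans (2 * n + 2)).
  by rewrite ltn_mod addn2.
by rewrite expnS expn1; nia.
Qed.

Lemma relax_all_exec (P Q : pred nat) cs (st : state R) :
  ~~ Q 2 -> bound (wmem st) ->
  all (fun x => breads P Q x.1 && vreads P Q x.2) cs ->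
  all (fun x => bbounded c x.1 && vbounded c x.2) cs ->
  exists tau vm',
    [/\ exec w (relax_all cs) st tau (State (wmem st) vm'), tau <= 3 * size cs,
        (forall a i, a != 2 -> vm' a i = vmem st a i) &
        vm' 2 0 = cval_from (wmem st) (vmem st) (vmem st 2 0) cs].
Proof.
move=> Q2 bst; elim: cs st bst => [|[b e] cs IH] st bst /=.
  by move=> _ _; exists 0, (vmem st); split=> //; case: st bst => *; apply: ExecSkip.
case/andP=> /andP[rb re] rcs /andP[/andP[bb be] bcs].
set x := if nbeval (wmem st) (vmem st) b then
           tmin (vmem st 2 0) (nveval (wmem st) (vmem st) e) else vmem st 2 0.
set st1 := State (wmem st) (if nbeval (wmem st) (vmem st) b &&
   ~~ wt_le (vmem st 2 0) (nveval (wmem st) (vmem st) e)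
   then upd (vmem st) 2 0 (nveval (wmem st) (vmem st) e) else vmem st).
have [t1 e1 le1] : exists2 t, exec w (If b (If (BLeV tmp e) Skip
    (StoreV 2 (WConst 0) e)) Skip) st t st1 & t <= 3.
  have bE := beval_nbeval X_gt1 nw bst bb.
  have eE := veval_nveval X_gt1 nw bst be.
  case Eb: (nbeval (wmem st) (vmem st) b); last first.
    exists 1 => //; apply: ExecIf; rewrite bE Eb /st1 Eb /=.
    by case: st {bst IH x st1 bE eE Eb} => *; apply: ExecSkip.
  case Ele: (wt_le (vmem st 2 0) (nveval (wmem st) (vmem st) e)).
    exists 2 => //; apply: ExecIf; rewrite bE Eb; apply: ExecIf => /=.
    rewrite mod0n eE Ele /st1 Ele andbF.
    by case: st {bst IH x st1 bE eE Eb Ele} => *; apply: ExecSkip.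
  exists 3 => //; apply: ExecIf; rewrite bE Eb; apply: ExecIf => /=.
  rewrite mod0n eE Ele /st1 Eb Ele /=.
  have := ExecStoreV w 2 (WConst 0) e st; by rewrite /= mod0n eE.
have vm1 a i : a != 2 -> vmem st1 a i = vmem st a i.
  by move=> a2; rewrite /st1 /=; case: ifP => //; rewrite /upd (negPf a2).
have vm12 : vmem st1 2 0 = x.
  rewrite /st1 /x /= /tmin; case: nbeval => //=; case: wt_le => //=.
have agP : agree P (wmem st1) (wmem st) by [].
have agQ : agree Q (vmem st1) (vmem st).
  by move=> a Qa i; apply: vm1; apply: contraNneq Q2 => <-.
have [//|t2 [vm2 [e2 le2 vm2a vm22]]] := IH st1 _ rcs bcs.
exists (t1 + t2), vm2; split.
- exact: ExecSeq e1 e2.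
- by rewrite mulnS leq_add.
- by move=> a i a2; rewrite vm2a // vm1.
rewrite vm22 vm12 /x -/(cval_from _ _ _ _).
move: rcs; clear - agP agQ; rewrite /cval_from; elim: cs (if _ then _ else _) => //= -[b' e'] cs IH y.
case/andP=> /andP[/= rb re] rcs.
by rewrite (eq_nbeval agP agQ rb) (eq_nveval agP agQ re) IH.
Qed.

Lemma phase_body_PW (a : nat) N b e1 e2 (st : state R) q :
  bound (wmem st) -> wmem st 0 0 = n -> wmem st 1 0 = q -> a != 1 ->
  [&& bbounded c b, wbounded c (wclip e1) & wbounded c (wclip e2)] ->
  exec w (phase_body (PW a N b e1 e2)) st 2
    (State (upd (wmem st) a q (neval (wmem st)
       (wclip (if nbeval (wmem st) (vmem st) b then e1 else e2)))) (vmem st)).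
Proof.
move=> bst stn stq a1 /and3P[bb b1 b2] /=; apply: ExecIf.
rewrite (beval_nbeval X_gt1 nw bst bb); case: nbeval.
- have := ExecStoreW w a lv (wclip e1) st.
  by rewrite (weval_neval X_gt1 nw bst b1) /= mod0n stq.
- have := ExecStoreW w a lv (wclip e2) st.
  by rewrite (weval_neval X_gt1 nw bst b2) /= mod0n stq.
Qed.

Lemma phase_body_PV (a : nat) N cs dw dv (st : state R) q :
  bound (wmem st) -> wmem st 1 0 = q -> 2 \notin dv ->
  phase_wf c dw dv (PV a N cs) ->
  exists tau vm',
  [/\ exec w (phase_body (PV a N cs)) st tau (State (wmem st) vm'),
      tau <= 3 * size cs + 2,
      vm' a q = cval (wmem st) (vmem st) cs &
      forall b i, b != 2 -> (b != a) || (i != q) -> vm' b i = vmem st b i].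
Proof.
move=> bst stq dv2 /and5P[]; rewrite !inE !negb_or => /and3P[a0 a2 adv] _ rcs _.
case/andP=> _ bcs.
set st1 := State (wmem st) (upd (vmem st) 2 0 None).
have e1 : exec w (StoreV 2 (WConst 0) VInf) st 1 st1.
  by have := ExecStoreV w 2 (WConst 0) VInf st; rewrite /= mod0n.
have Q2 : ~~ (2 \in a :: dv) by rewrite inE negb_or eq_sym a2.
have [|t2 [vm2 [e2 le2 vm2a vm22]]] := relax_all_exec (st := st1) Q2 _ rcs bcs.
  exact: bst.
have vm22' : vm2 2 0 = cval (wmem st) (vmem st) cs.
  rewrite vm22 [vmem st1 2 0]/= /upd /=; apply: (@eq_cval _ _ _ _ _ _ _ _ _ _ rcs) => //.
  by move=> b Qb i /=; rewrite /upd; case: eqP => // b2; case/negP: Q2; rewrite -b2.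
exists (1 + (t2 + 1)), (upd vm2 a q (vm2 2 0)); split.
- apply: ExecSeq e1 _; apply: ExecSeq e2 _.
  by have := ExecStoreV w a lv tmp (State (wmem st1) vm2); rewrite /= mod0n stq.
- by lia.
- by rewrite /upd !eqxx.
- move=> b i b2; rewrite /upd; case: eqP => //= _; last by rewrite vm2a //= /upd (negPf b2).
  by case: eqP => //= _; rewrite vm2a //= /upd (negPf b2).
Qed.

Definition written (ph : phase) := match ph with PW a _ _ _ _ => a | PV a _ _ => a end.
Definition is_word (ph : phase) := if ph is PW _ _ _ _ _ then true else false.

Definition preserves ph (st st' : state R) :=
  (forall b i, (b != 1) || (i != 0) -> ~~ (is_word ph && (b == written ph)) ->
     wmem st' b i = wmem st b i) /\
  (forall b i, b != 2 -> ~~ (~~ is_word ph && (b == written ph)) ->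
     vmem st' b i = vmem st b i).

Lemma while_lt_exec N body k (Inv : nat -> state R -> Prop) M st :
  wbounded c N ->
  (forall m st, Inv m st -> [/\ bound (wmem st), wmem st 1 0 = m & neval (wmem st) N = M]) ->
  (forall m st, m < M -> Inv m st -> exists st' tau,
      [/\ exec w body st tau st', tau <= k & Inv m.+1 st']) ->
  Inv 0 st ->
  exists st' tau,
    [/\ exec w (While (BNot (BLeW N lv)) body) st tau st', tau <= k.+1 * M + 1 & Inv M st'].
Proof.
move=> bN I1 step.
have test m st1 : Inv m st1 -> beval w st1 (BNot (BLeW N lv)) = (m < M).
  case/I1=> b1 stm stN; rewrite /= (weval_neval X_gt1 nw b1 bN) stN mod0n stm.
  by rewrite ltnNge.
suff main d m st1 : m + d = M -> Inv m st1 -> exists st' tau,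
    [/\ exec w (While (BNot (BLeW N lv)) body) st1 tau st', tau <= k.+1 * d + 1 & Inv M st'].
  by move=> I0; apply: (main M 0).
elim: d m st1 => [|d IH] m st1 mM I.
  rewrite addn0 in mM; rewrite -mM.
  exists st1, 1; split=> //; first by apply: ExecWhileF; rewrite (test _ _ I) -mM ltnn.
  by rewrite muln0.
have lt : m < M by lia.
have [st2 [t2 [e2 le2 I2]]] := step _ _ lt I.
have [|st3 [t3 [e3 le3 I3]]] := IH m.+1 st2 _ I2; first by lia.
exists st3, (t2 + t3).+1; split=> //; last by rewrite mulnS; lia.
by apply: ExecWhileT e2 e3; rewrite (test _ _ I).
Qed.

Lemma neq_of_lt_le i q m : i < q -> q <= m -> i != m.
Proof. by move=> iq qm; rewrite ltn_eqF // (leq_trans iq). Qed.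

Lemma lv_incr_exec (st : state R) q :
  bound (wmem st) -> wmem st 1 0 = q ->
  exec w (StoreW 1 (WConst 0) (lv +w wone)) st 1
    (State (upd (wmem st) 1 0 q.+1) (vmem st)).
Proof.
move=> bst stq; have := ExecStoreW w 1 (WConst 0) (lv +w wone) st.
have bl : wbounded c (lv +w wone) by rewrite /= /array_degree /=; move: c_gt9; lia.
by rewrite (weval_neval X_gt1 nw bst bl) /= mod0n stq addn1.
Qed.

Lemma lv_init_exec (st : state R) :
  exec w (StoreW 1 (WConst 0) (WConst 0)) st 1 (State (upd (wmem st) 1 0 0) (vmem st)).
Proof. by have := ExecStoreW w 1 (WConst 0) (WConst 0) st; rewrite /= mod0n. Qed.

Lemma bound_upd_lv wm q : bound wm -> q <= n.+1 ^ 6 -> bound (upd wm 1 0 q).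
Proof. by move=> b qle a i; rewrite /upd; case: ifP => // /andP[/eqP-> _]. Qed.

Lemma phase_exec ph dw dv (st : state R) :
  bound (wmem st) -> wmem st 0 0 = n -> 0 \in dw -> 1 \notin dw -> 2 \notin dv ->
  (forall b i, b \notin 1 :: dw -> wmem st b i = 0) ->
  (forall b i, b \notin 2 :: dv -> vmem st b i = None) ->
  phase_wf c dw dv ph ->
  exists st' tau,
  [/\ exec w (phase_cmd ph) st tau st',
      tau <= phase_cost ph * neval (wmem st) (phase_size ph) + 2,
      bound (wmem st'), preserves ph st st' & phase_eqn ph (wmem st') (vmem st')].
Proof.
move=> bst stn dw0 dw1 dv2 blw blv wf.
have NN : [/\ wbounded c (phase_size ph), wdegree (phase_size ph) < 6 &
           wreads [pred x | x \in dw] (phase_size ph)].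
  case: ph wf => [a N b e1 e2|a N cs] /=.
    by case/andP=> /and5P[_ ? _ _ _] /and5P[? ? _ _ _].
  by case/and5P=> _ ? _ ? /andP[? _].
case: NN => bN dN rN; set M := neval (wmem st) (phase_size ph).
have Mle : M <= n.+1 ^ 5.
  by apply: leq_trans (neval_bound X_gt1 _ bst) _; rewrite leq_pexp2l.
have agN st1 : preserves ph st st1 -> written ph \notin dw \/ ~~ is_word ph ->
    neval (wmem st1) (phase_size ph) = M.
  move=> [p1 _] h; apply: (@eq_neval _ _ _ _ _ rN) => b /= bdw i; apply: p1.
    by rewrite (_ : b != 1) //; apply: contraNneq dw1 => <-.
  by case: h => [h|/negPf-> //]; rewrite negb_and orbC; apply/orP; left; apply: contraNneq h => <-.
have wdw : written ph \notin dw \/ ~~ is_word ph.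
  case: ph wf {bN dN rN M Mle agN} => [a N b e1 e2|a N cs] /=; last by right.
  by case/andP=> /and5P[]; rewrite !inE !negb_or => /and3P[_ _ ?]; left.
pose Inv m (st1 : state R) := [/\ bound (wmem st1), wmem st1 1 0 = m, preserves ph st st1,
   m <= M &
   match ph with
   | PW a N b e1 e2 => (forall q, m <= q -> wmem st1 a q = 0) /\
      forall q, q < m ->
      wmem st1 a q = neval (mask 0 (with_lv (wmem st1) q) a q)
                 (wclip (if nbeval (mask 0 (with_lv (wmem st1) q) a q) (vmem st1) b then e1 else e2))
   | PV a N cs => (forall q, m <= q -> vmem st1 a q = None) /\
      forall q, q < m ->
      vmem st1 a q = cval (with_lv (wmem st1) q) (mask None (vmem st1) a q) cs
   end].
pose k := phase_cost ph - 1.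
have kS : k.+1 = phase_cost ph by rewrite /k; case: (ph) => /= *; lia.
have [| | |st' [tau [e le I]]] := @while_lt_exec (phase_size ph)
   (Seq (phase_body ph) (StoreW 1 (WConst 0) (lv +w wone))) k Inv M
   (State (upd (wmem st) 1 0 0) (vmem st)) bN.
- by move=> m st1 [b1 e1 p1 _ _]; split=> //; apply: agN.
- move=> m st1 mM [b1 l1 p1 _ I1].
  have st1n : wmem st1 0 0 = n.
    rewrite (proj1 p1) //; case: (wdw) => [h|/negPf-> //].
    by rewrite negb_and orbC; apply/orP; left; apply: contraNneq h => <-.
  have mle6 : m.+1 <= n.+1 ^ 6.
    by apply: leq_trans mM _; apply: leq_trans Mle _; rewrite leq_pexp2l.
  case: ph wf @M @k p1 I1 rN {bN dN} Mle agN wdw mM @Inv kS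
    => [a N b e1 e2|a N cs] wf M k p1 I1 rN Mle agN wdw mM Inv kS.
  + move: (wf) => /=; case/andP=> /and5P[]; rewrite !inE !negb_or => /and3P[a0 a1 adw] _ rb r1 r2.
    case/and5P=> _ _ bb bc1 bc2.
    have h : [&& bbounded c b, wbounded c (wclip e1) & wbounded c (wclip e2)].
      by apply/and3P.
    have {h} := @phase_body_PW a N b e1 e2 st1 m b1 st1n l1 a1 h.
    set x := neval _ _; set st2 := State _ _ => e.
    have xle : x <= n.+1 ^ 2 by apply: wop_mod_bound.
    have b2 : bound (wmem st2).
      move=> d i; rewrite /= /upd; case: ifP => // /andP[/eqP-> _].
      by rewrite /array_degree (negPf a0) (negPf a1).
    have l2 : wmem st2 1 0 = m by rewrite /= /upd eq_sym (negPf a1).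
    have e3 := lv_incr_exec b2 l2; set st3 := State _ _ in e3.
    exists st3, (2 + 1); split; [exact: ExecSeq e e3 | by [] |].
    have old d i : (d != 1) || (i != 0) -> (d != a) || (i != m) -> wmem st3 d i = wmem st1 d i.
      by rewrite -!negb_and => /negPf h1 /negPf h2; rewrite /= /upd h1 h2.
    have am : wmem st3 a m = x by rewrite /= /upd (negPf a1) !eqxx.
    have l3 : wmem st3 1 0 = m.+1 by [].
    have v3 : vmem st3 = vmem st1 by [].
    have b3 : bound (wmem st3) by exact: bound_upd_lv.
    clearbody st3; clear st2 e b2 l2 e3.
    have ag q : q <= m -> agree [pred x | x \in a :: 1 :: dw] (mask 0 (with_lv (wmem st1) q) a q)
        (mask 0 (with_lv (wmem st3) q) a q).
      move=> qm d _ i; rewrite /mask /with_lv; case: (altP (d =P a)) => [->|da] /=.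
        case: leqP => // iq; rewrite (negPf a1) /=.
        by rewrite old ?a1 // (neq_of_lt_le iq qm) ?orbT.
      by case: ifP => // /negbT h; rewrite old ?da // -negb_and.
    split=> //.
    * split=> [d i h1 /= h2|d i h1 h2]; last by rewrite v3 -(proj2 p1).
      by rewrite -(proj1 p1) // old // h2.
    * case: I1 => I0 I1; split=> q qm.
        by rewrite old ?a1 ?I0 ?(ltnW qm) // (gtn_eqF qm) ?orbT //.
      have agv : agree [pred x | x \in dv] (vmem st1) (vmem st3) by rewrite v3.
      rewrite ltnS in qm.
      have ext : neval (mask 0 (with_lv (wmem st1) q) a q)
                 (wclip (if nbeval (mask 0 (with_lv (wmem st1) q) a q) (vmem st1) b then e1 else e2))
              = neval (mask 0 (with_lv (wmem st3) q) a q)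
                 (wclip (if nbeval (mask 0 (with_lv (wmem st3) q) a q) (vmem st3) b then e1 else e2)).
        rewrite (eq_nbeval (ag q qm) agv rb); apply: (eq_neval (ag q qm)).
        by case: ifP => _; rewrite /= ?r1 ?r2 !inE dw0 !orbT.
      case: (ltngtP q m) qm => // qm _.
        by rewrite old ?a1 ?I1 // (ltn_eqF qm) ?orbT //.
      rewrite -ext qm am.
      rewrite /x; have ag0 : agree [pred x | x \in a :: 1 :: dw] (wmem st1)
          (mask 0 (with_lv (wmem st1) m) a m).
        move=> d _ i; rewrite /mask /with_lv; case: (altP (d =P a)) => [->|da] /=.
          by case: leqP => iq; [rewrite I0 | rewrite (negPf a1)].
        by case: ifP => // /andP[/eqP-> /eqP->].
      have agv0 : agree [pred x | x \in dv] (vmem st1) (vmem st1) by [].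
      rewrite (eq_nbeval ag0 agv0 rb); apply: (eq_neval ag0).
      by case: ifP => _; rewrite /= ?r1 ?r2 !inE dw0 !orbT.
  + move: (wf) => /= /and5P[]; rewrite !inE !negb_or => /and3P[a0 a2 adv] _ rcs _ _.
    have [t [vm' [e le vq vo]]] := phase_body_PV b1 l1 dv2 wf.
    have e3 := lv_incr_exec (st := State (wmem st1) vm') b1 l1; set st3 := (X in exec _ _ _ _ X) in e3.
    exists st3, (t + 1); split; [exact: ExecSeq e e3 | by rewrite -ltnS kS addn1 /= addn4 !ltnS; rewrite addn2 in le |].
    have ag q : agree [pred x | x \in 1 :: dw] (with_lv (wmem st1) q) (with_lv (wmem st3) q).
      by move=> d _ i; rewrite /with_lv /= /upd; case: ifP.
    have agv q : q <= m -> agree [pred x | x \in a :: dv] (mask None (vmem st1) a q)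
        (mask None (vmem st3) a q).
      move=> qm d dd i; rewrite /mask; case: (altP (d =P a)) => [->|da] /=.
        by case: leqP => // iq; rewrite vo // (neq_of_lt_le iq qm) ?orbT.
      rewrite vo ?da //; apply: contraTneq dd => ->.
      by rewrite !inE negb_or eq_sym a2.
    split=> //.
    * exact: bound_upd_lv.
    * split=> [d i h1 /= h2|d i h1 /= h2].
        by have := h1; rewrite -negb_and => /negPf h1'; rewrite /upd h1' (proj1 p1).
      by rewrite -(proj2 p1) // vo // h2.
    * case: I1 => I0 I1; split=> q qm.
        by rewrite /= vo // ?I0 ?(ltnW qm) // (gtn_eqF qm) ?orbT //.
      rewrite ltnS in qm; rewrite -(eq_cval (ag q) (agv q qm) rcs).
      case: (ltngtP q m) qm => // qm _.
        by rewrite /= vo // ?I1 // (ltn_eqF qm) ?orbT //.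
      rewrite qm /= vq; apply: (@eq_cval _ _ _ _ _ _ _ _ _ _ rcs).
        by move=> d _ i; rewrite /with_lv; case: ifP => // /andP[/eqP-> /eqP->].
      move=> d _ i; rewrite /mask; case: (altP (d =P a)) => [->|//] /=.
      by case: leqP => iq //; rewrite I0.
- split=> //.
  + exact: bound_upd_lv.
  + by split=> // b i h _; rewrite /= /upd -negb_and in h *; rewrite (negPf h).
  + case: ph wf {bN dN rN M Mle agN wdw Inv k kS} => [a N b e1 e2|a N cs] /=.
      case/andP=> /and5P[]; rewrite !inE !negb_or => /and3P[a0 a1 adw] _ _ _ _ _.
      by split=> // q _; rewrite /upd (negPf a1) blw // inE negb_or a1.
    case/and5P; rewrite !inE !negb_or => /and3P[a0 a2 adv] _ _ _ _.
    by split=> // q _; rewrite blv // inE negb_or a2.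
case: I => b' _ p' _ I; exists st', (1 + tau); split=> //.
- by apply: ExecSeq e; apply: lv_init_exec.
- by rewrite -kS add1n addn2 ltnS; rewrite addn1 in le.
- have := agN _ p' wdw; case: (ph) I => [a N b e1 e2|a N cs] /= [_ I] E q; rewrite E; exact: I.
Qed.

Lemma phase_eqn_ext ph dw dv wm1 wm2 vm1 vm2 :
  phase_wf c dw dv ph -> 0 \in dw ->
  (forall b i, b != 1 -> (b \in dw) || (is_word ph && (b == written ph)) -> wm2 b i = wm1 b i) ->
  (forall i, i != 0 -> wm2 1 i = wm1 1 i) ->
  (forall b i, (b \in dv) || (~~ is_word ph && (b == written ph)) -> vm2 b i = vm1 b i) ->
  1 \notin dw ->
  phase_eqn ph wm1 vm1 -> phase_eqn ph wm2 vm2.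
Proof.
move=> wf dw0 Hw H1 Hv dw1; have agdw : agree [pred x | x \in dw] wm2 wm1.
  by move=> b /= bdw i; apply: Hw; rewrite ?bdw //; apply: contraNneq dw1 => <-.
have lvE q b i : (b \in 1 :: dw) || (is_word ph && (b == written ph)) -> with_lv wm2 q b i = with_lv wm1 q b i.
  rewrite inE -orbA => /orP[/eqP->|h]; rewrite /with_lv.
    by case: (altP (i =P 0)) => //= i0; rewrite H1.
  case: (altP (b =P 1)) => /= [->|b1]; last by rewrite Hw.
  by case: (altP (i =P 0)) => //= i0; rewrite H1.
case: ph wf Hw Hv lvE => [a N b e1 e2|a N cs] /=.
- case/andP=> /and5P[]; rewrite !inE !negb_or => /and3P[_ a1 _] rN rb r1 r2 _ Hw Hv lvE E q; rewrite (eq_neval agdw rN) => qN.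
  have ag : agree [pred x | x \in a :: 1 :: dw] (mask 0 (with_lv wm2 q) a q) (mask 0 (with_lv wm1 q) a q).
    move=> d dd i; rewrite /mask lvE //; move: dd; rewrite !inE.
    by case: (d == a); rewrite ?orbT ?orbF.
  have agv : agree [pred x | x \in dv] vm2 vm1.
    by move=> d dd i; apply: Hv; rewrite /= in dd; rewrite dd.
  have -> : wm2 a q = wm1 a q.
    by rewrite Hw ?eqxx ?orbT.
  rewrite (E _ qN) (eq_nbeval ag agv rb); apply/esym.
  apply: (eq_neval (e := wclip (if nbeval (mask 0 (with_lv wm1 q) a q) vm1 b then e1 else e2)) ag).
  by case: ifP => _; rewrite /= ?r1 ?r2 !inE dw0 !orbT.
- case/and5P=> _ rN rcs _ _ Hw Hv lvE E q; rewrite (eq_neval agdw rN) => qN.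
  have ag : agree [pred x | x \in 1 :: dw] (with_lv wm2 q) (with_lv wm1 q).
    by move=> d dd i; apply: lvE; rewrite orbF.
  have agv : agree [pred x | x \in a :: dv] (mask None vm2 a q) (mask None vm1 a q).
    by move=> d dd i; rewrite /mask Hv //; move: dd; rewrite /= inE orbC.
  by rewrite Hv ?eqxx ?orbT // (E _ qN) (eq_cval ag agv rcs).
Qed.

Lemma phases_exec phs dw dv (st : state R) :
  bound (wmem st) -> wmem st 0 0 = n -> 0 \in dw -> 1 \notin dw -> 2 \notin dv ->
  (forall b i, b \notin 1 :: dw -> wmem st b i = 0) ->
  (forall b i, b \notin 2 :: dv -> vmem st b i = None) ->
  phases_wf c dw dv phs ->
  exists st' tau,
  [/\ exec w (phases_cmd phs) st tau st', tau <= phases_time phs (wmem st'),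
      phases_eqn phs (wmem st') (vmem st') &
   [/\ (forall b i, b \in dw -> wmem st' b i = wmem st b i),
      (forall i, i != 0 -> wmem st' 1 i = wmem st 1 i) &
      (forall b i, b \in dv -> vmem st' b i = vmem st b i)]].
Proof.
elim: phs dw dv st => [|ph phs IH] dw dv st bst stn dw0 dw1 dv2 blw blv /=.
  by move=> _; exists st, 0; split=> //; apply: ExecSkip.
case/andP=> wf wfs.
have [st1 [t1 [e1 le1 b1 [p1 p2] q1]]] := phase_exec bst stn dw0 dw1 dv2 blw blv wf.
pose dw' := if is_word ph then written ph :: dw else dw.
pose dv' := if is_word ph then dv else written ph :: dv.
have {}wfs : phases_wf c dw' dv' phs by rewrite /dw' /dv'; case: (ph) wfs.
have sdw b : b \in dw -> b \in dw' by rewrite /dw'; case: ifP => // _; rewrite inE orbC => ->.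
have sdv b : b \in dv -> b \in dv' by rewrite /dv'; case: ifP => // _; rewrite inE orbC => ->.
have ndw b : b \in dw -> ~~ (is_word ph && (b == written ph)).
  move=> bdw; apply/negP; move: wf; case: (ph) => //= a N b' e e'.
  by case/andP=> /and5P[]; rewrite !inE !negb_or => /and3P[_ _ /negP h] _ _ _ _ _ /eqP ba; apply: h; rewrite -ba.
have ndv b : b \in dv -> ~~ (~~ is_word ph && (b == written ph)).
  move=> bdw; apply/negP; move: wf; case: (ph) => //= a N cs.
  by case/and5P; rewrite !inE !negb_or => /and3P[_ _ /negP h] _ _ _ _ /eqP ba; apply: h; rewrite -ba.
have wn1 : is_word ph -> written ph != 1.
  move: wf; case: (ph) => //= a N b' e e'.
  by case/andP=> /and5P[]; rewrite !inE !negb_or => /and3P[].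
have vn2 : ~~ is_word ph -> written ph != 2.
  move: wf; case: (ph) => //= a N cs.
  by case/and5P; rewrite !inE !negb_or => /and3P[].
have nd1 b : b \in dw -> b != 1 by move=> h; apply: contraNneq dw1 => <-.
have nd2 b : b \in dv -> b != 2 by move=> h; apply: contraNneq dv2 => <-.
have [|||||||st2 [t2 [e2 le2 q2 [r1 r2 r3]]]] := IH dw' dv' st1 _ _ _ _ _ _ _ wfs.
- exact: b1.
- by rewrite p1 ?ndw.
- exact: sdw.
- rewrite /dw'; case: ifP => // /wn1 h; by rewrite inE negb_or eq_sym h.
- rewrite /dv'; case: ifP => // /negbT /vn2 h; by rewrite inE negb_or eq_sym h.
- move=> b i; rewrite inE negb_or => /andP[b1' bdw]; rewrite p1 ?b1' //.
    apply: blw; rewrite inE negb_or b1'; apply: contra bdw; exact: sdw.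
  by apply: contra bdw => /andP[h /eqP->]; rewrite /dw' h mem_head.
- move=> b i; rewrite inE negb_or => /andP[b1' bdw]; rewrite p2 ?b1' //.
    apply: blv; rewrite inE negb_or b1'; apply: contra bdw; exact: sdv.
  by apply: contra bdw => /andP[/negPf h /eqP->]; rewrite /dv' h mem_head.
have NE : neval (wmem st2) (phase_size ph) = neval (wmem st) (phase_size ph).
  have rN : wreads [pred x | x \in dw] (phase_size ph).
    by case: (ph) wf => [a N b e e'|a N cs] /=; [case/andP=> /and5P[] | case/and5P].
  apply: (eq_neval _ rN) => b /= bdw i.
  by rewrite r1 ?sdw // p1 ?ndw ?nd1.
exists st2, (t1 + t2); split.
- exact: ExecSeq e1 e2.
- by rewrite /phases_time big_cons NE leq_add.
- split=> //; apply: (phase_eqn_ext wf) q1 => //.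
    move=> b i b1'; case/orP=> [h|/andP[h /eqP->]]; rewrite r1 //; first exact: sdw.
    by rewrite /dw' h mem_head.
  move=> b i; case/orP=> [h|/andP[/negPf h /eqP->]]; rewrite r3 //; first exact: sdv.
  by rewrite /dv' h mem_head.
- split=> [b i bdw|i i0|b i bdv].
  + by rewrite r1 ?sdw // p1 ?ndw ?nd1.
  + rewrite r2 // p1 ?i0 ?orbT //; apply/negP => /andP[/wn1 /eqP h /eqP h2].
    by apply: h.
  + by rewrite r3 ?sdv // p2 ?ndv ?nd2.
Qed.

End Phases.

(** * Min-plus recurrences *)

Section UpperBounds.
Variable R : realDomainType.
Implicit Types (x y : option R) (l : R).

(* Min-plus values are handled through the sets of their upper bounds. *)
Definition ub x l : bool := wt_le x (Some l).

Lemma ub_le x l l' : ub x l -> (l <= l')%R -> ub x l'.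
Proof. by case: x => //= a; apply: le_trans. Qed.

Lemma ub_add x y l :
  ub (wt_add x y) l <-> exists l1 l2, [/\ ub x l1, ub y l2 & (l1 + l2 <= l)%R].
Proof.
split; case: x y => [a|] [b|] //=.
- by move=> h; exists a, b; rewrite /ub /= !lexx.
- by case=> l1 [l2 [h1 h2 h]]; apply: le_trans h; rewrite lerD.
- by case=> l1 [l2 []].
- by case=> l1 [l2 []].
- by case=> l1 [l2 []].
Qed.

Lemma ub_tmin x y l : ub (tmin x y) l = ub x l || ub y l.
Proof.
rewrite /tmin; case: x y => [a|] [b|] //=; last by rewrite orbF.
case: leP => [ab|/ltW ba]; rewrite /ub /=; first by rewrite orb_idr //; apply: le_trans.
by rewrite orb_idl //; apply: le_trans.
Qed.

Definition cmin (cs : seq (bool * option R)) : option R :=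
  foldl (fun acc c => if c.1 then tmin acc c.2 else acc) None cs.

Lemma ub_cmin cs l : ub (cmin cs) l = has (fun c => c.1 && ub c.2 l) cs.
Proof.
rewrite /cmin -[RHS]/(false || _) -[false]/(ub None l).
elim: cs None => [|[[] y] cs IH] x /=; rewrite ?orbF ?IH //.
by rewrite ub_tmin orbA.
Qed.

Lemma cval_cmin wm vm cs :
  cval wm vm cs = cmin [seq (nbeval wm vm c.1, @nveval R wm vm c.2) | c <- cs].
Proof. by rewrite /cval /cval_from /cmin; elim: cs None => //= c cs IH x; rewrite IH. Qed.

Lemma running_min (T : nat -> option R) cs N r l :
  (forall q, q < N -> T q = cmin ((0 < q, T q.-1) :: cs q)) -> r < N ->
  ub (T r) l <-> exists2 q, q <= r & ub (cmin (cs q)) l.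
Proof.
move=> TE; elim: r => [|r IH] rN; rewrite TE // ub_cmin /= -ub_cmin.
  by split=> [h|[q]]; [exists 0 | rewrite leqn0 => /eqP->].
split=> [/orP[/(IH (ltnW rN))[q qr h]|h]|[q]]; [|by exists r.+1|].
  by exists q => //; apply: ltnW.
rewrite leq_eqVlt ltnS => /predU1P[->->|qr h]; rewrite ?orbT //.
by apply/orP; left; apply/(IH (ltnW rN)); exists q.
Qed.

Lemma absR_le (a b : R) : (a <= b)%R -> (`|a - b| = b - a)%R.
Proof. by move=> ab; rewrite distrC ger0_norm // subr_ge0. Qed.

Lemma absR_ge (a b : R) : (b <= a)%R -> (`|a - b| = a - b)%R.
Proof. by move=> ab; rewrite ger0_norm // subr_ge0. Qed.

End UpperBounds.

(* The end of the block [l, l + 2 ^ lam) that contains y, where l + off is a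
   multiple of 2 ^ lam. *)
Definition block_end (off lam y : nat) := ((y + off) %/ 2 ^ lam).+1 * 2 ^ lam - off.

Definition same_block (off lam y j : nat) :=
  forall q, y < q -> q <= j -> (q + off) %% 2 ^ lam != 0.

Lemma block_end_gt off lam y : y < block_end off lam y.
Proof.
rewrite /block_end ltn_subRL addnC; have := divn_eq (y + off) (2 ^ lam).
have := ltn_pmod (y + off) (expn_gt0 2 lam : 0 < 2 ^ lam) .
rewrite mulSn; lia.
Qed.

Lemma same_block_divn off lam y j : y <= j ->
  (y + off) %/ 2 ^ lam = (j + off) %/ 2 ^ lam -> same_block off lam y j.
Proof.
move=> yj E q yq qj; apply/negP => /eqP q0.
have P : 0 < 2 ^ lam by rewrite expn_gt0.
have Eq : (q + off) %/ 2 ^ lam = (y + off) %/ 2 ^ lam.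
  apply/eqP; rewrite eqn_leq {1}E !leq_div2r //; lia.
have := divn_eq (q + off) (2 ^ lam); rewrite q0 Eq addn0.
have := divn_eq (y + off) (2 ^ lam); lia.
Qed.

Lemma block_end_same off lam y j : y <= j -> same_block off lam y j ->
  block_end off lam y = block_end off lam j.
Proof.
move=> yj sb; rewrite /block_end; congr (_.+1 * _ - _).
have P : 0 < 2 ^ lam by rewrite expn_gt0.
elim: j yj sb => [|j IH]; first by rewrite leqn0 => /eqP->.
rewrite leq_eqVlt => /predU1P[->//|yj] sb; rewrite IH //; last first.
  by move=> q yq qj; apply: sb => //; apply: ltnW.
have nz := sb j.+1 yj (leqnn _).
have := divn_eq (j.+1 + off) (2 ^ lam); have := divn_eq (j + off) (2 ^ lam).
have m1 := ltn_pmod (j + off) P; have m2 := ltn_pmod (j.+1 + off) P.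
move: nz m1 m2; set a := _ %/ _; set b := _ %% _; set a' := _ %/ _; set b' := _ %% _.
rewrite -lt0n; nia.
Qed.

(* A point m of (y, w] divisible by the largest power of two is the end of the
   block of j, or the start of the block of j + 1, according to its position
   relative to j. *)
Lemma lattice_split N y j w : y <= j -> j < w -> w < 2 ^ N ->
  exists2 lam, lam < N &
    (same_block 0 lam y j /\ block_end 0 lam j <= w) \/
    (y < (j.+1 %/ 2 ^ lam) * 2 ^ lam /\ j.+1 %/ 2 ^ lam = w %/ 2 ^ lam).
Proof.
move=> yj jw wN.
have exl : exists lam, [exists m : 'I_w.+1, (y < m) && (2 ^ lam %| m)].
  by exists 0; apply/existsP; exists (inord j.+1); rewrite inordK ?dvd1n // ltnS yj.
have bnd lam : [exists m : 'I_w.+1, (y < m) && (2 ^ lam %| m)] -> lam <= N.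
  case/existsP=> m /andP[ym /dvdn_leq dm]; rewrite -(@leq_exp2l 2) //.
  by apply: leq_trans (dm _) _; [lia | have := ltn_ord m; lia].
case: (ex_maxnP exl bnd) => lam /existsP[m /andP[ym dm]] maxl.
have mw : m <= w by rewrite -ltnS.
have P : 0 < 2 ^ lam by rewrite expn_gt0.
have nomult c : 2 ^ lam.+1 %| c -> y < c -> c <= w -> False.
  move=> dc yc cw; have := maxl lam.+1; rewrite ltnn => /(_ _) h.
  suff : false by []. apply: h; apply/existsP; exists (inord c).
  by rewrite inordK ?ltnS // yc.
case/dvdnP: dm => a mE.
have ylow : (a.-1) * 2 ^ lam <= y.
  case: (leqP (a.-1 * 2 ^ lam) y) => // yl; exfalso.
  case: (boolP (odd a)) => oa.
    apply: (nomult (a.-1 * 2 ^ lam)) => //.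
    - rewrite expnS dvdn_pmul2r // dvdn2; move: oa; by case: (a) => //= a' ; rewrite negbK.
    - apply: leq_trans mw; rewrite mE leq_pmul2r //; exact: leq_pred.
  apply: (nomult (a * 2 ^ lam)) => //; last by rewrite -mE.
  - by rewrite expnS dvdn_pmul2r // dvdn2.
  - by rewrite -mE.
have wup : w < a.+1 * 2 ^ lam.
  case: (leqP (a.+1 * 2 ^ lam) w) => // yl; exfalso.
  case: (boolP (odd a)) => oa.
    apply: (nomult (a.+1 * 2 ^ lam)) => //.
    - by rewrite expnS dvdn_pmul2r // dvdn2 /= negbK.
    - by apply: ltn_trans ym _; rewrite mE ltn_pmul2r.
  apply: (nomult (a * 2 ^ lam)) => //; last by rewrite -mE.
  - by rewrite expnS dvdn_pmul2r // dvdn2.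
  - by rewrite -mE.
have a0 : 0 < a by case: (a) mE ym => // ->; lia.
have lamN : lam < N.
  rewrite -(@ltn_exp2l 2) //; apply: leq_ltn_trans wN; apply: leq_trans mw.
  by rewrite mE leq_pmull.
exists lam => //; case: (ltnP j m) => jm; [left | right].
- have dj : j %/ 2 ^ lam = a.-1.
    apply/eqP; rewrite eqn_leq leq_divRL // (leq_trans ylow yj) andbT.
    by rewrite -ltnS prednK // ltn_divLR // -mE.
  have dy : y %/ 2 ^ lam = a.-1.
    by apply/eqP; rewrite eqn_leq leq_divRL // ylow andbT -dj leq_div2r.
  split; first by apply: same_block_divn; rewrite // !addn0 dy dj.
  by rewrite /block_end addn0 subn0 dj prednK // -mE.
- have dj : j.+1 %/ 2 ^ lam = a.
    apply/eqP; rewrite eqn_leq leq_divRL // -mE (leq_trans jm) // andbT.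
    by rewrite -ltnS ltn_divLR // (leq_ltn_trans jw).
  have dw : w %/ 2 ^ lam = a.
    by apply/eqP; rewrite eqn_leq leq_divRL // -mE mw andbT -ltnS ltn_divLR.
  by rewrite dj dw -mE.
Qed.

Section Tables.
Variables (R : realDomainType) (n L N off : nat) (sig : nat -> R).
Variables (H DD : nat -> nat -> option R).
Hypothesis L_n : L < n.
Hypothesis sig_mono : forall p q, p <= q -> q <= L -> (sig p <= sig q)%R.
Hypothesis DDE : forall p q, p <= q -> q <= L -> DD p q = Some (sig q - sig p)%R.

Local Notation gap p q := (`|sig p - sig q|)%R.
Local Notation e_ lam y := (block_end off lam y).

Lemma gap_le p q : p <= q -> q <= L -> gap p q = (sig q - sig p)%R.
Proof. by move=> pq qL; rewrite absR_le // sig_mono. Qed.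

Lemma gap_ge p q : q <= p -> p <= L -> gap p q = (sig p - sig q)%R.
Proof. by move=> pq qL; rewrite absR_ge // sig_mono. Qed.

Lemma ub_DD p q l : p <= q -> q <= L -> ub (DD p q) l = (sig q - sig p <= l)%R.
Proof. by move=> pq qL; rewrite DDE. Qed.

Lemma window_ub (b : nat -> nat -> option R) B c u e l :
  (forall c u r, c < n -> u < n -> r < n -> B c u r = cmin [:: (0 < r, B c u r.-1);
     (n.-1 - r <= u, wt_add (b c (n.-1 - r)) (DD (n.-1 - r) u))]) ->
  c < n -> u <= L -> e < n ->
  ub (B c u (n.-1 - e)) l <->
  exists w x, [/\ e <= w, w <= u, ub (b c w) x & (x + (sig u - sig w) <= l)%R].
Proof.
move=> BE cn uL en; have un : u < n by lia.
have TE q : q < n -> B c u q = cmin ((0 < q, B c u q.-1) ::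
     [:: (n.-1 - q <= u, wt_add (b c (n.-1 - q)) (DD (n.-1 - q) u))]).
  exact: BE.
rewrite (running_min l TE); last lia; split.
- case=> q qe; rewrite ub_cmin /= orbF => /andP[qu /ub_add[x [y [h1 h2 h3]]]].
  exists (n.-1 - q), x; split=> //; first lia.
  by rewrite ub_DD // in h2; apply: le_trans h3; rewrite lerD2l.
- case=> w [x [ew wu bx le]]; exists (n.-1 - w); first lia.
  have E : n.-1 - (n.-1 - w) = w by lia.
  rewrite ub_cmin /= orbF E wu; apply/ub_add; exists x, (sig u - sig w)%R.
  by split=> //; rewrite ub_DD.
Qed.

Section Blocks.
Variables (b : nat -> nat -> option R) (B HX : nat -> nat -> nat -> option R).
Variables (RHO : nat -> nat -> nat -> option R) (PHI : nat -> nat -> nat -> nat -> option R).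
Hypothesis BE : forall c u r, c < n -> u < n -> r < n -> B c u r = cmin [:: (0 < r, B c u r.-1);
     (n.-1 - r <= u, wt_add (b c (n.-1 - r)) (DD (n.-1 - r) u))].
Hypothesis HXE : forall c u r, c < n -> u < n -> r < n -> HX c u r = cmin [:: (0 < r, HX c u r.-1);
     (n.-1 - r <= u, wt_add (H c (n.-1 - r)) (DD (n.-1 - r) u))].
Hypothesis RHOE : forall lam y k, lam < N -> y < n -> k < n ->
  RHO lam y k = cmin [:: (0 < k, RHO lam y k.-1);
     (e_ lam y <= k, wt_add (DD (e_ lam y) k) (H y k))].
Hypothesis PHIE : forall lam c y u, lam < N -> c < n -> y < n -> u < n ->
  PHI lam c y u = cmin [:: (0 < u, PHI lam c y u.-1);
     (e_ lam y <= u, wt_add (B c u (n.-1 - e_ lam y)) (H y u));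
     (e_ lam y <= u, wt_add (HX y u (n.-1 - e_ lam y)) (b c u))].

Lemma RHO_ub lam y k l : lam < N -> y <= L -> k <= L ->
  ub (RHO lam y k) l <-> exists w x, [/\ e_ lam y <= w, w <= k, ub (H y w) x &
    ((sig w - sig (e_ lam y)) + x <= l)%R].
Proof.
move=> lamN yL kL.
have TE q : q < L.+1 -> RHO lam y q = cmin ((0 < q, RHO lam y q.-1) ::
     [:: (e_ lam y <= q, wt_add (DD (e_ lam y) q) (H y q))]).
  by move=> qL; apply: RHOE => //; lia.
rewrite (running_min l TE) //; split.
- case=> w wk; rewrite ub_cmin /= orbF => /andP[ew /ub_add[x [x' [h1 h2 h3]]]].
  exists w, x'; split=> //; rewrite ub_DD // in h1; last lia.
  by apply: le_trans h3; rewrite lerD2r.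
- case=> w [x [ew wk hx le]]; exists w => //.
  rewrite ub_cmin /= orbF ew; apply/ub_add; exists (sig w - sig (e_ lam y))%R, x.
  by split=> //; rewrite ub_DD //; lia.
Qed.

Lemma PHI_ub lam c y u l : lam < N -> c < n -> y <= L -> u <= L ->
  ub (PHI lam c y u) l <-> exists w w' x x', [/\ [/\ e_ lam y <= w, w <= u,
    e_ lam y <= w' & w' <= u], ub (H y w) x, ub (b c w') x' & (x + gap w w' + x' <= l)%R].
Proof.
move=> lamN cn yL uL.
have TE q : q < L.+1 -> PHI lam c y q = cmin ((0 < q, PHI lam c y q.-1) ::
     [:: (e_ lam y <= q, wt_add (B c q (n.-1 - e_ lam y)) (H y q));
     (e_ lam y <= q, wt_add (HX y q (n.-1 - e_ lam y)) (b c q))]).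
  by move=> qL; apply: PHIE => //; lia.
rewrite (running_min l TE) //; split.
- case=> q qu; rewrite ub_cmin /= orbF -andb_orr => /andP[eq].
  have [en qL] : e_ lam y < n /\ q <= L by lia.
  case/orP=> /ub_add[x [x' [h1 h2 h3]]].
    case/(window_ub _ BE cn qL en): h1 => w' [x1 [ew wq bx le]].
    exists q, w', x', x1; split=> //; first by split=> //; lia.
    by rewrite gap_ge //; lra.
  case/(window_ub _ HXE (leq_ltn_trans yL L_n) qL en): h1 => w [x1 [ew wq bx le]].
  exists w, q, x1, x'; split=> //; first by split=> //; lia.
  by rewrite gap_le //; lra.
- case=> w [w' [x [x' [[ew wu ew' wu'] hx bx le]]]].
  have en : e_ lam y < n by lia.
  case: (leqP w w') => ww.
    exists w' => //; rewrite ub_cmin /= orbF -andb_orr ew' /=; apply/orP; right.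
    have wL : w' <= L by lia.
    apply/ub_add; exists (x + (sig w' - sig w))%R, x'; split=> //.
      by apply/(window_ub _ HXE (leq_ltn_trans yL L_n) wL en); exists w, x.
    by move: le; rewrite gap_le // addrA.
  exists w => //; rewrite ub_cmin /= orbF -andb_orr ew /=; apply/orP; left.
  have wL : w <= L by lia.
  apply/ub_add; exists (x' + (sig w - sig w'))%R, x; split=> //.
    by apply/(window_ub _ BE cn wL en); exists w', x'; split=> //; lia.
  by move: le; rewrite gap_ge; [lra | lia | lia].
Qed.

End Blocks.

Section Leaky.
Variables (i lam : nat) (X V K a A : nat -> option R).
Hypothesis XE : forall j, j <= L -> X j = cmin
  [:: ((i < j) && ((j + off) %% 2 ^ lam != 0), wt_add (X j.-1) (DD j.-1 j)); (i < j, K j)].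
Hypothesis VE : forall j, j <= L -> V j = cmin
  [:: ((i < j) && ((j + off) %% 2 ^ lam != 0), V j.-1);
      (i < j, wt_add (A j) (K j)); (i < j, wt_add (a j) (X j))].
Hypothesis AE : forall j l, i < j -> j <= L -> ub (A j) l <->
  exists y x, [/\ i < y, y <= j, ub (a y) x & (x + (sig j - sig y) <= l)%R].

Lemma same_block_refl j : same_block off lam j j.
Proof. by move=> q h1 h2; lia. Qed.

Lemma same_blockS y j : y < j -> same_block off lam y j <->
  (j + off) %% 2 ^ lam != 0 /\ same_block off lam y j.-1.
Proof.
move=> yj; split=> [sb|[nz sb] q yq qj].
  by split=> [|q yq qj]; apply: sb => //; lia.
case: (ltngtP q j) qj => // [qj _|->//]; apply: sb => //; lia.
Qed.

Lemma X_ub j l : j <= L -> ub (X j) l <-> exists y x,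
  [/\ i < y <= j, same_block off lam y j, ub (K y) x & (x + (sig j - sig y) <= l)%R].
Proof.
elim: j l => [|j IH] l jL; rewrite XE // ub_cmin /= ?orbF.
  by split=> // -[y [x [h]]]; lia.
split.
- case/orP=> [/andP[/andP[ij nz] /ub_add[x [x' [/(IH _ (ltnW jL)) [y [x0 [iy sb Kx le]]] h2 h3]]]]|/andP[ij Kx]].
    rewrite ub_DD // in h2; exists y, x0; split=> //.
    - lia.
    - by apply/same_blockS => //; lia.
    - by lra.
  exists j.+1, l; split=> //; [lia | exact: same_block_refl | lra].
- case=> y [x [/andP[iy]]]; rewrite leq_eqVlt => /predU1P[E|yj] sb Kx le; [subst y|].
    rewrite [i < _](_ : _ = true) /=; last lia.
    by rewrite (ub_le Kx) ?orbT //; lra.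
  have [nz sb'] : (j.+1 + off) %% 2 ^ lam != 0 /\ same_block off lam y j.
    by apply/same_blockS.
  rewrite nz [i < _](_ : _ = true) /=; last lia.
  apply/orP; left; apply/ub_add; exists (x + (sig j - sig y))%R, (sig j.+1 - sig j)%R; split.
  - by apply/(IH _ (ltnW jL)); exists y, x; split=> //; lia.
  - by rewrite ub_DD.
  - by lra.
Qed.

Lemma V_ub j l : j <= L -> ub (V j) l <-> exists y y' x x',
  [/\ i < y <= j, i < y' <= j, same_block off lam y' j &
   [/\ ub (a y) x, ub (K y') x' & (x + gap y y' + x' <= l)%R]].
Proof.
elim: j l => [|j IH] l jL; rewrite VE // ub_cmin /= ?orbF.
  by split=> // -[y [y' [x [x' [h]]]]]; lia.
split.
- case/or3P.
  + case/andP=> /andP[ij nz] /(IH _ (ltnW jL)) [y [y' [x [x' [h1 h2 sb [ax Kx le]]]]]].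
    exists y, y', x, x'; split=> //; try lia.
    by apply/same_blockS => //; lia.
  + case/andP=> ij /ub_add[x [x' [/(AE _ ij jL) [y [x0 [iy yj ax le]]] h2 h3]]].
    exists y, j.+1, x0, x'; split=> //; try lia; first exact: same_block_refl.
    by split=> //; rewrite gap_le //; lra.
  + case/andP=> ij /ub_add[x [x' [h1 /(X_ub _ jL) [y [x0 [iy yj ax le]]] h3]]].
    exists j.+1, y, x, x0; split=> //; try lia.
    by split=> //; rewrite gap_ge; [lra | lia | lia].
- case=> y [y' [x [x' [h1 h2 sb [ax Kx le]]]]].
  have ij : i < j.+1 by lia.
  rewrite ij /=; case: (altP (y' =P j.+1)) => [E|ne].
    subst y'; apply/or3P; apply: Or32; apply/ub_add; exists (x + (sig j.+1 - sig y))%R, x'.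
    split=> //; first by apply/(AE _ ij jL); exists y, x; split=> //; lia.
    by move: le; rewrite gap_le; [lra | lia | lia].
  case: (altP (y =P j.+1)) => [E|ne'].
    subst y; apply/or3P; apply: Or33; apply/ub_add; exists x, (x' + (sig j.+1 - sig y'))%R.
    split=> //; first by apply/(X_ub _ jL); exists y', x'; split=> //; lia.
    by move: le; rewrite gap_ge; [lra | lia | lia].
  have [nz sb'] : (j.+1 + off) %% 2 ^ lam != 0 /\ same_block off lam y' j.
    by apply/same_blockS => //; lia.
  apply/or3P; apply: Or31; rewrite nz; apply/(IH _ (ltnW jL)).
  by exists y, y', x, x'; split=> //; lia.
Qed.

End Leaky.

(* The replacement paths that first visit one of the two middle intervals
   (i, j] and (j, k] and then the other one; a and b are the costs of reaching
   a vertex of the first interval from one end of the path, and a vertex of the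
   second one from the other end. *)
Definition crossing (H : nat -> nat -> option R) (a b : nat -> option R) i k j l :=
  exists y y' w w', [/\ i < y <= j, i < y' <= j, j < w <= k & j < w' <= k] /\
  exists xa xh xb, [/\ ub (a y) xa, ub (H y' w) xh, ub (b w') xb &
    (xa + gap y y' + xh + gap w w' + xb <= l)%R].

Section Crossing.
Variables (a b : nat -> nat -> option R) (A B HX RHO : nat -> nat -> nat -> option R).
Variables (PHI XP XR VP VR RES : nat -> nat -> nat -> nat -> option R).
Variables (ca cb : nat -> nat -> nat).
Hypothesis AE : forall c u r, c < n -> u < n -> r < n -> A c u r = cmin [:: (0 < r, A c u r.-1);
     (n.-1 - r <= u, wt_add (a c (n.-1 - r)) (DD (n.-1 - r) u))].
Hypothesis BE : forall c u r, c < n -> u < n -> r < n -> B c u r = cmin [:: (0 < r, B c u r.-1);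
     (n.-1 - r <= u, wt_add (b c (n.-1 - r)) (DD (n.-1 - r) u))].
Hypothesis HXE : forall c u r, c < n -> u < n -> r < n -> HX c u r = cmin [:: (0 < r, HX c u r.-1);
     (n.-1 - r <= u, wt_add (H c (n.-1 - r)) (DD (n.-1 - r) u))].
Hypothesis RHOE : forall lam y k, lam < N -> y < n -> k < n ->
  RHO lam y k = cmin [:: (0 < k, RHO lam y k.-1);
     (e_ lam y <= k, wt_add (DD (e_ lam y) k) (H y k))].
Hypothesis PHIE : forall lam c y u, lam < N -> c < n -> y < n -> u < n ->
  PHI lam c y u = cmin [:: (0 < u, PHI lam c y u.-1);
     (e_ lam y <= u, wt_add (B c u (n.-1 - e_ lam y)) (H y u));
     (e_ lam y <= u, wt_add (HX y u (n.-1 - e_ lam y)) (b c u))].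
Hypothesis XPE : forall lam i k j, lam < N -> i < n -> k < n -> j < n ->
  XP lam i k j = cmin [:: ((i < j) && ((j + off) %% 2 ^ lam != 0),
                              wt_add (XP lam i k j.-1) (DD j.-1 j));
                          (i < j, PHI lam (cb i k) j k)].
Hypothesis XRE : forall lam i k j, lam < N -> i < n -> k < n -> j < n ->
  XR lam i k j = cmin [:: ((i < j) && ((j + off) %% 2 ^ lam != 0),
                              wt_add (XR lam i k j.-1) (DD j.-1 j));
                          (i < j, RHO lam j k)].
Hypothesis VPE : forall lam i k j, lam < N -> i < n -> k < n -> j < n ->
  VP lam i k j = cmin [:: ((i < j) && ((j + off) %% 2 ^ lam != 0), VP lam i k j.-1);
      (i < j, wt_add (A (ca i k) j (n.-1 - i.+1)) (PHI lam (cb i k) j k));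
      (i < j, wt_add (a (ca i k) j) (XP lam i k j))].
Hypothesis VRE : forall lam i k j, lam < N -> i < n -> k < n -> j < n ->
  VR lam i k j = cmin [:: ((i < j) && ((j + off) %% 2 ^ lam != 0), VR lam i k j.-1);
      (i < j, wt_add (A (ca i k) j (n.-1 - i.+1)) (RHO lam j k));
      (i < j, wt_add (a (ca i k) j) (XR lam i k j))].
Hypothesis RESE : forall lam i k j, lam < N -> i < n -> k < n -> j < n ->
  RES lam i k j = cmin [:: (0 < lam, RES lam.-1 i k j); (true, VP lam i k j);
      (e_ lam j <= k, wt_add (VR lam i k j) (B (cb i k) (e_ lam j) (n.-1 - j.+1)))].
Hypothesis ca_lt : forall i k, i < n -> k < n -> ca i k < n.
Hypothesis cb_lt : forall i k, i < n -> k < n -> cb i k < n.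

Lemma VP_ub lam i k j l : lam < N -> i < n -> k <= L -> j <= L ->
  ub (VP lam i k j) l <-> exists y y' x x',
  [/\ i < y <= j, i < y' <= j, same_block off lam y' j &
   [/\ ub (a (ca i k) y) x, ub (PHI lam (cb i k) y' k) x' & (x + gap y y' + x' <= l)%R]].
Proof.
move=> lamN i_n kL jL; have k_n : k < n by lia.
apply: (@V_ub i lam (XP lam i k) (VP lam i k) (fun j => PHI lam (cb i k) j k)
  (a (ca i k)) (fun j => A (ca i k) j (n.-1 - i.+1))) => //.
- by move=> q qL; apply: XPE => //; lia.
- by move=> q qL; apply: VPE => //; lia.
- move=> q l' iq qL; rewrite (window_ub _ AE) ?ca_lt //; lia.
Qed.

Lemma VR_ub lam i k j l : lam < N -> i < n -> k <= L -> j <= L ->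
  ub (VR lam i k j) l <-> exists y y' x x',
  [/\ i < y <= j, i < y' <= j, same_block off lam y' j &
   [/\ ub (a (ca i k) y) x, ub (RHO lam y' k) x' & (x + gap y y' + x' <= l)%R]].
Proof.
move=> lamN i_n kL jL; have k_n : k < n by lia.
apply: (@V_ub i lam (XR lam i k) (VR lam i k) (fun j => RHO lam j k)
  (a (ca i k)) (fun j => A (ca i k) j (n.-1 - i.+1))) => //.
- by move=> q qL; apply: XRE => //; lia.
- by move=> q qL; apply: VRE => //; lia.
- move=> q l' iq qL; rewrite (window_ub _ AE) ?ca_lt //; lia.
Qed.

Lemma RES_step lam i k j l : lam < N -> i < n -> k < n -> j < n ->
  ub (RES lam i k j) l <-> exists2 q, q <= lam &
    ub (VP q i k j) l \/ (e_ q j <= k /\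
      ub (wt_add (VR q i k j) (B (cb i k) (e_ q j) (n.-1 - j.+1))) l).
Proof.
move=> lamN i_n k_n j_n.
have TE q : q < N -> RES q i k j = cmin ((0 < q, RES q.-1 i k j) :: [:: (true, VP q i k j);
      (e_ q j <= k, wt_add (VR q i k j) (B (cb i k) (e_ q j) (n.-1 - j.+1)))]).
  by move=> qN; apply: RESE.
rewrite (running_min l TE lamN); split=> -[q ql h]; exists q => //.
  by move: h; rewrite ub_cmin /= orbF => /orP[->|/andP[-> ->]]; [left | right].
by rewrite ub_cmin /= orbF; case: h => [->|[-> ->]]; rewrite ?orbT.
Qed.

Lemma RES_sound lam i k j l : lam < N -> i < n -> k <= L -> j <= k ->
  ub (RES lam i k j) l -> crossing H (a (ca i k)) (b (cb i k)) i k j l.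
Proof.
move=> lamN i_n kL jk; have [k_n j_n jL] : [/\ k < n, j < n & j <= L] by split; lia.
case/(RES_step _ lamN i_n k_n j_n) => q ql; have qN : q < N by lia.
case=> [|[ek /ub_add[x1 [x2 [h1 h2 h3]]]]].
- case/(VP_ub _ qN i_n kL jL) => y [y' [x [x' [hy hy' sb [ax Px le]]]]].
  have y'L : y' <= L by lia.
  have y'j : y' <= j by lia.
  case/(PHI_ub BE HXE PHIE _ qN (cb_lt i_n k_n) y'L kL): Px => w [w' [xh [xb [[e1 e2 e3 e4] hx bx le']]]].
  rewrite (block_end_same y'j sb) in e1 e3; have := block_end_gt off q j => ej.
  exists y, y', w, w'; split; first by split=> //; lia.
  by exists x, xh, xb; split=> //; lra.
- case/(VR_ub _ qN i_n kL jL): h1 => y [y' [x [x' [hy hy' sb [ax Px le]]]]].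
  have y'L : y' <= L by lia.
  have y'j : y' <= j by lia.
  case/(RHO_ub RHOE _ qN y'L kL): Px => w [xh [e1 e2 hx le']].
  rewrite (block_end_same y'j sb) in e1 le'; have := block_end_gt off q j => ej.
  have [eL jn] : e_ q j <= L /\ j.+1 < n by lia.
  case/(window_ub _ BE (cb_lt i_n k_n) eL jn): h2 => w' [xb [e3 e4 bx le2]].
  exists y, y', w, w'; split; first by split=> //; lia.
  exists x, xh, xb; split=> //; rewrite [gap w w']gap_ge ?(leq_trans e4) //; last lia.
  by lra.
Qed.

Lemma RES_complete lam i k j l y y' w w' xa xh xb :
  lam < N -> i < n -> k <= L -> j < k ->
  [/\ i < y <= j, i < y' <= j, j < w <= k & j < w' <= k] ->
  same_block off lam y' j -> e_ lam j <= w ->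
  ub (a (ca i k) y) xa -> ub (H y' w) xh -> ub (b (cb i k) w') xb ->
  (xa + gap y y' + xh + gap w w' + xb <= l)%R ->
  ub (RES N.-1 i k j) l.
Proof.
move=> lamN i_n kL jk [hy hy' hw hw'] sb ew ax hx bx le.
have [k_n j_n jL] : [/\ k < n, j < n & j <= L] by split; lia.
have N1 : N.-1 < N by lia.
apply/(RES_step _ N1 i_n k_n j_n); exists lam; first lia.
have y'L : y' <= L by lia.
have y'j : y' <= j by lia.
have eE := block_end_same y'j sb.
case: (leqP (e_ lam j) w') => ew'; [left | right].
- apply/(VP_ub _ lamN i_n kL jL); exists y, y', xa, (xh + gap w w' + xb)%R; split=> //; split=> //.
    apply/(PHI_ub BE HXE PHIE _ lamN (cb_lt i_n k_n) y'L kL); exists w, w', xh, xb.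
    by rewrite eE; split=> //; split=> //; lia.
  by lra.
- have ek : e_ lam j <= k by lia.
  split=> //; apply/ub_add.
  have [eL jn] : e_ lam j <= L /\ j.+1 < n by lia.
  exists (xa + gap y y' + ((sig w - sig (e_ lam j)) + xh))%R, (xb + (sig (e_ lam j) - sig w'))%R; split.
  + apply/(VR_ub _ lamN i_n kL jL); exists y, y', xa, ((sig w - sig (e_ lam j)) + xh)%R; split=> //; split=> //.
    by apply/(RHO_ub RHOE _ lamN y'L kL); exists w, xh; rewrite eE; split=> //; lia.
  + by apply/(window_ub _ BE (cb_lt i_n k_n) eL jn); exists w', xb; split=> //; lia.
  + move: le; rewrite [gap w w']gap_ge; [lra | lia | lia].
Qed.

End Crossing.
End Tables.

Lemma divn_rev N lam x : lam <= N -> x < 2 ^ N ->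
  ((2 ^ N).-1 - x) %/ 2 ^ lam = (2 ^ (N - lam)).-1 - x %/ 2 ^ lam.
Proof.
move=> lamN xN; have P : 0 < 2 ^ lam by rewrite expn_gt0.
have E : 2 ^ N = 2 ^ (N - lam) * 2 ^ lam by rewrite -expnD subnK.
have xq : x %/ 2 ^ lam < 2 ^ (N - lam) by rewrite ltn_divLR // -E.
have m := ltn_pmod x P; have dx := divn_eq x (2 ^ lam).
set a := 2 ^ (N - lam) in E xq *; set q := _ %/ _ in xq dx *.
have -> : (2 ^ N).-1 - x = (a.-1 - q) * 2 ^ lam + (2 ^ lam - 1 - x %% 2 ^ lam).
  by rewrite E {1}dx; nia.
by rewrite divnMDl // divn_small ?addn0 //; lia.
Qed.

(* With the offset 2 ^ N - 1 - L, the lattice of the mirrored path is the mirror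
   image of the unshifted lattice, so that the second alternative of
   lattice_split becomes the first one. *)
Lemma lattice_split_mirror N L y j w lam :
  y <= j -> j < w -> w <= L -> L < 2 ^ N -> lam < N ->
  y < (j.+1 %/ 2 ^ lam) * 2 ^ lam -> j.+1 %/ 2 ^ lam = w %/ 2 ^ lam ->
  let off := (2 ^ N).-1 - L in
  same_block off lam (L - w) (L - j.+1) /\ block_end off lam (L - j.+1) <= L - y.
Proof.
move=> yj jw wL LN lamN ylt dE off.
have P : 0 < 2 ^ lam by rewrite expn_gt0.
have lamN' := ltnW lamN.
have eq1 p : p <= L -> L - p + off = (2 ^ N).-1 - p by rewrite /off; lia.
split.
  apply: same_block_divn; first by lia.
  by rewrite !eq1 ?divn_rev ?dE //; lia.
rewrite /block_end eq1; last by lia.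
rewrite divn_rev //; last by lia.
have E : 2 ^ N = 2 ^ (N - lam) * 2 ^ lam by rewrite -expnD subnK.
have q : j.+1 %/ 2 ^ lam < 2 ^ (N - lam) by rewrite ltn_divLR // -E; lia.
rewrite -(subn1 (2 ^ (N - lam))) (_ : _.+1 = 2 ^ (N - lam) - j.+1 %/ 2 ^ lam); last by lia.
rewrite mulnBl -E /off; lia.
Qed.

(** * Shape of the replacement paths *)

Section Patterns.
Variables (R : realDomainType) (L : nat) (sig : nat -> R) (H : nat -> nat -> option R).
Variables (f g : nat -> nat -> option R).
Hypothesis sig_mono : forall p q, p <= q -> q <= L -> (sig p <= sig q)%R.
Hypothesis H_sym : forall p q l, p <= L -> q <= L -> ub (H p q) l -> ub (H q p) l.
Hypothesis H_gap : forall p q l, p <= L -> q <= L -> ub (H p q) l -> (`|sig p - sig q| <= l)%R.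
Hypothesis f_ub : forall i v l, i < L -> v <= L -> ub (f i v) l <->
  exists x h, [/\ x <= i, ub (H x v) h & (sig x - sig 0 + h <= l)%R].
Hypothesis g_ub : forall k v l, k < L -> v <= L -> ub (g k v) l <->
  exists z h, [/\ k < z <= L, ub (H v z) h & (h + (sig L - sig z) <= l)%R].

Local Notation gap p q := (`|sig p - sig q|)%R.

Lemma gapD p q r : (gap p r <= gap p q + gap q r)%R.
Proof. exact: ler_distD. Qed.

Lemma gapC p q : (gap p q = gap q p)%R.
Proof. exact: distrC. Qed.

Lemma gapxx p : (gap p p = 0)%R.
Proof. by rewrite subrr normr0. Qed.

Variables (i j k : nat).
Hypotheses (ij : i <= j) (jk : j <= k) (kL : k < L).

Definition inner (b : bool) p := if b then i < p <= j else j < p <= k.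

Lemma inner_le b p : inner b p -> p <= L.
Proof. by case: b => /=; lia. Qed.

Inductive pattern (l : R) : Prop :=
  | PatternDirect z x of k < z <= L & ub (f i z) x & (x + (sig L - sig z) <= l)%R
  | PatternOne b y y' x x' of inner b y & inner b y' & ub (f i y) x & ub (g k y') x' &
      (x + gap y y' + x' <= l)%R
  | PatternCross b y y' w w' x h x' of [/\ inner b y, inner b y', inner (~~ b) w & inner (~~ b) w'] &
      ub (f i y) x & ub (H y' w) h & ub (g k w') x' &
      (x + gap y y' + h + gap w w' + x' <= l)%R.

Lemma pattern_le l l' : (l <= l')%R -> pattern l -> pattern l'.
Proof.
move=> le; case=> [z x hz hx h|b y y' x x' hy hy' hx hx' h|b y y' w w' x h' x' hy hx hh hx' h].
- by apply: (PatternDirect hz hx); apply: le_trans le.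
- by apply: (PatternOne hy hy' hx hx'); apply: le_trans le.
- by apply: (PatternCross hy hx hh hx'); apply: le_trans le.
Qed.

Lemma pattern_crossing l :
  pattern l <->
  [\/ exists z x, [/\ k < z <= L, ub (f i z) x & (x + (sig L - sig z) <= l)%R],
      exists b y y' x x', [/\ inner b y, inner b y', ub (f i y) x, ub (g k y') x' &
      (x + gap y y' + x' <= l)%R],
      crossing sig H (f i) (g k) i k j l | crossing sig H (g k) (f i) i k j l].
Proof.
split.
- case=> [z x hz hx h|b y y' x x' hy hy' hx hx' h|[] y y' w w' x h' x' [/= h1 h2 h3 h4] hx hh hx' h].
  + by apply: Or41; exists z, x.
  + by apply: Or42; exists b, y, y', x, x'.
  + by apply: Or43; exists y, y', w, w'; split=> //; exists x, h', x'.
  + apply: Or44; exists w', w, y', y; split=> //; exists x', h', x; split=> //.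
      by apply: H_sym => //; [exact: (@inner_le false) | exact: (@inner_le true)].
    by rewrite (gapC w') (gapC y'); lra.
- case.
  + by case=> z [x [h1 h2 h3]]; exact: (PatternDirect h1 h2 h3).
  + by case=> b [y [y' [x [x' [h1 h2 h3 h4 h5]]]]]; exact: (PatternOne h1 h2 h3 h4 h5).
  + case=> y [y' [w [w' [[h1 h2 h3 h4] [x [h [x' [hx hh hx' le]]]]]]]].
    by apply: (@PatternCross _ true) hx hh hx' le.
  + case=> y [y' [w [w' [[h1 h2 h3 h4] [x [h [x' [hx hh hx' le]]]]]]]].
    apply: (@PatternCross _ false w' w y' y) hx' (H_sym _ _ hh) hx _ => //.
    * exact: (@inner_le true).
    * exact: (@inner_le false).
    * by rewrite (gapC w') (gapC y'); lra.
Qed.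

Inductive reach (S : pred nat) : nat -> nat -> R -> Prop :=
  | ReachSegment p q l of p <= q & q <= L & (forall r, p <= r < q -> S r) &
      (sig q - sig p <= l)%R : reach S p q l
  | ReachJump p q l of p <= L & q <= L & ub (H p q) l : reach S p q l
  | ReachSym p q l of reach S p q l : reach S q p l
  | ReachTrans p q r l1 l2 l of reach S p q l1 & reach S q r l2 & (l1 + l2 <= l)%R :
      reach S p r l.

Definition intact := [pred r | [&& r != i, r != j & r != k]].

Lemma reach_inner b p q : inner b p -> inner b q -> reach intact p q (gap p q).
Proof.
wlog pq : p q / p <= q => [th|].
  case: (leqP p q) => [|/ltnW] h hp hq; first exact: th.
  by apply: ReachSym; rewrite gapC; apply: th.
move=> hp hq; have qL := inner_le hq.
apply: ReachSegment => //; last by rewrite absR_le // sig_mono.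
by move=> r; case: b hp hq => /=; lia.
Qed.

Lemma reach_f v l : v <= L -> ub (f i v) l -> reach intact 0 v l.
Proof.
move=> vL /f_ub[||x [h [xi hx le]]] //; first by lia.
apply: (@ReachTrans _ _ x _ (sig x - sig 0)%R h) => //.
  by apply: ReachSegment => //; try lia; move=> r /=; lia.
by apply: ReachJump => //; lia.
Qed.

Lemma reach_g v l : v <= L -> ub (g k v) l -> reach intact v L l.
Proof.
move=> vL /g_ub[||z [h [xi hx le]]] //.
apply: (@ReachTrans _ _ z _ h (sig L - sig z)%R) => //.
  by apply: ReachJump => //; lia.
by apply: ReachSegment => //; try lia; move=> r /=; lia.
Qed.

Lemma pattern_reach l : pattern l -> reach intact 0 L l.
Proof.
case=> [z x hz hx h|b y y' x x' hy hy' hx hx' h|b y y' w w' x h' x' [h1 h2 h3 h4] hx hh hx' h].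
- apply: (@ReachTrans _ _ z _ x (sig L - sig z)%R) => //.
    by apply: reach_f => //; lia.
  by apply: ReachSegment => //; try lia; move=> r /=; lia.
- apply: ReachTrans _ (reach_g (inner_le hy') hx') h.
  exact: ReachTrans (reach_f (inner_le hy) hx) (reach_inner hy hy') (lexx _).
- apply: ReachTrans _ (reach_g (inner_le h4) hx') h.
  apply: ReachTrans _ (reach_inner h3 h4) (lexx _).
  apply: ReachTrans _ (ReachJump _ (inner_le h2) (inner_le h3) hh) (lexx _).
  exact: ReachTrans (reach_f (inner_le h1) hx) (reach_inner h1 h2) (lexx _).
Qed.

(* What is known of the cost l of a prefix of a replacement path that ends at
   position p, the intervals it has left being forgotten whenever it comes back
   to a previous one: subpaths of the original path are shortest. *)
Inductive prefix_cost (p : nat) (l : R) : Prop :=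
  | PrefixFinal of pattern (l + gap p L)
  | PrefixFirst of p <= i & (sig p - sig 0 <= l)%R
  | PrefixOne b y x of inner b p & inner b y & ub (f i y) x & (x + gap y p <= l)%R
  | PrefixTwo b y y' w x h of inner (~~ b) p & inner b y & inner b y' & inner (~~ b) w &
      ub (f i y) x & ub (H y' w) h & (x + gap y y' + h + gap w p <= l)%R.

Lemma prefix_cost0 : prefix_cost 0 0.
Proof. by apply: PrefixFirst; rewrite ?subrr. Qed.

Lemma prefix_cost_end l : prefix_cost L l -> pattern l.
Proof.
case=> [|h _|b y x h _ _ _|b y y' w x h hb _ _ _ _ _ _].
- by rewrite gapxx addr0.
- by exfalso; lia.
- by exfalso; case: b h => /=; lia.
- by exfalso; case: b hb => /=; lia.
Qed.

Lemma inner_cases p : p <= L -> [\/ p <= i, exists b, inner b p | k < p].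
Proof.
move=> pL; case: (leqP p i) => h1; first exact: Or31.
case: (leqP p k) => h2; last exact: Or33.
by apply: Or32; case: (leqP p j) => h3; [exists true | exists false] => /=; lia.
Qed.

Lemma prefix_cost_jump p q l h : p <= L -> q <= L -> ub (H p q) h ->
  prefix_cost p l -> prefix_cost q (l + h).
Proof.
move=> pL qL Hh; have le := H_gap pL qL Hh; have iL : i < L by lia.
have gap0 r : r <= L -> gap 0 r = (sig r - sig 0)%R.
  by move=> rL; rewrite absR_le // sig_mono.
have tri y : (gap y q <= gap y p + h)%R by have := gapD y p q; lra.
case=> [fin|pi hl|b y x hp hy hx hl|b y y' w x h' hp hy hy' hw hx hh hl].
- apply: PrefixFinal; apply: pattern_le fin.
  by have := gapD p q L; rewrite (gapC p q) in le *; have := gapD p q L; lra.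
- have fq : ub (f i q) (l + h)%R.
    by apply/f_ub => //; exists p, h; split=> //; rewrite lerD2r.
  case: (inner_cases qL) => [qi|[b hq]|kq].
  + apply: PrefixFirst => //; have := tri 0; rewrite !absR_le ?sig_mono //; lra.
  + by apply: (PrefixOne hq hq fq); rewrite gapxx addr0.
  + apply: PrefixFinal; apply: (PatternDirect (z := q)) fq _; first by lia.
    by rewrite absR_le // sig_mono.
- case: (inner_cases qL) => [qi|[b' hq]|kq].
  + apply: PrefixFirst => //.
    have yL := inner_le hy.
    case/f_ub: hx => // x0 [h0 [x0i hx0 le0]].
    have t1 := H_gap (leq_trans x0i (ltnW iL)) yL hx0.
    have t2 := gapD 0 x0 q; have t3 := gapD x0 y q; have t4 := tri y.
    rewrite (gap0 q qL) (gap0 x0 (leq_trans x0i (ltnW iL))) in t2.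
    by lra.
  + case: (altP (b' =P b)) => [E|ne].
      by subst b'; apply: (PrefixOne hq hy hx); have := tri y; lra.
    have {ne} E : b' = ~~ b by case: (b') (b) ne => [] [].
    subst b'; apply: (PrefixTwo hq hy hp hq hx Hh).
    by rewrite gapxx addr0; lra.
  + apply: PrefixFinal; apply: (PatternOne (x' := (h + (sig L - sig q))%R) hy hp hx).
      by apply/g_ub => //; exists q, h; split=> //; rewrite kq qL.
    by rewrite [gap q L]absR_le ?sig_mono //; lra.
- have yL := inner_le hy; have y'L := inner_le hy'; have wL := inner_le hw.
  have t5 := H_gap y'L wL hh.
  case: (inner_cases qL) => [qi|[b' hq]|kq].
  + apply: PrefixFirst => //.
    case/f_ub: hx => // x0 [h0 [x0i hx0 le0]].
    have t1 := H_gap (leq_trans x0i (ltnW iL)) yL hx0.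
    have t2 := gapD 0 x0 q; have t3 := gapD x0 y q; have t4 := gapD y y' q.
    have t6 := gapD y' w q; have t7 := tri w.
    rewrite (gap0 q qL) (gap0 x0 (leq_trans x0i (ltnW iL))) in t2.
    by lra.
  + case: (altP (b' =P b)) => [E|ne].
      subst b'; apply: (PrefixOne hq hy hx).
      by have := gapD y y' q; have := gapD y' w q; have := tri w; lra.
    have {ne} E : b' = ~~ b by case: (b') (b) ne => [] [].
    subst b'; apply: (PrefixTwo hq hy hy' hw hx hh).
    by have := tri w; lra.
  + apply: PrefixFinal.
    apply: (PatternCross (b := b) (y := y) (y' := y') (w := w) (w' := p)
      (x' := (h + (sig L - sig q))%R) _ hx hh) => //.
      by apply/g_ub => //; exists q, h; split=> //; rewrite kq qL.
    by rewrite [gap q L]absR_le ?sig_mono //; lra.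
Qed.

Lemma prefix_cost_edge p q r l : r < L -> intact r ->
  (p = r /\ q = r.+1) \/ (p = r.+1 /\ q = r) ->
  prefix_cost p l -> prefix_cost q (l + (sig r.+1 - sig r)).
Proof.
move=> rL /= /and3P[ri rj rk] pq.
have sr := sig_mono (leqnSn r) rL.
have E : (gap p q = sig r.+1 - sig r)%R.
  by case: pq => -[-> ->]; [rewrite absR_le | rewrite absR_ge].
have same b : inner b p -> inner b q by case: b => /=; lia.
have tri y : (gap y q <= gap y p + (sig r.+1 - sig r))%R.
  by have := gapD y p q; rewrite E.
case=> [fin|pi hl|b y x hp hy hx hl|b y y' w x h' hp hy hy' hw hx hh hl].
- apply: PrefixFinal; apply: pattern_le fin.
  by have := gapD p q L; rewrite E; lra.
- apply: PrefixFirst; first by lia.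
  by have := tri 0; rewrite !absR_le ?sig_mono //; [lra | lia | lia].
- by apply: (PrefixOne (same _ hp) hy hx); have := tri y; lra.
- by apply: (PrefixTwo (same _ hp) hy hy' hw hx hh); have := tri w; lra.
Qed.

End Patterns.

(** * Shortest paths *)

Section Walks.
Variables (R : realDomainType) (n : nat).
Implicit Types (G : wgraph R n) (u v x : 'I_n) (p q : seq 'I_n) (l : R).

Lemma path_length_nil G u : path_length G u [::] = 0%R.
Proof. by rewrite /path_length big_nil. Qed.

Lemma path_length_cons G u x p :
  path_length G u (x :: p) = (weight G [set u; x] + path_length G x p)%R.
Proof. by rewrite /path_length /= big_cons. Qed.

Lemma path_length_cat G u p q :
  path_length G u (p ++ q) = (path_length G u p + path_length G (last u p) q)%R.
Proof. by rewrite /path_length /path_edges pairmap_cat big_cat. Qed.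

Lemma path_length_ge0 G u p : path (adj G) u p -> (0 <= path_length G u p)%R.
Proof.
elim: p u => [|x p IH] u /=; first by rewrite path_length_nil.
by case/andP=> /weight_ge0 h /IH; rewrite path_length_cons; apply: addr_ge0.
Qed.

Lemma adjC G u v : adj G u v = adj G v u.
Proof. by rewrite /adj setUC. Qed.

Lemma adj_del G F u v : adj (del G F) u v = ([set u; v] \notin F) && adj G u v.
Proof. by rewrite /adj /= inE. Qed.

Definition walk G u v l :=
  exists p, [/\ path (adj G) u p, last u p = v & (path_length G u p <= l)%R].

Lemma walk_refl G u : walk G u u 0.
Proof. by exists [::]; rewrite path_length_nil. Qed.

Lemma walk_le G u v l l' : walk G u v l -> (l <= l')%R -> walk G u v l'.
Proof. by case=> p [h1 h2 h3] le; exists p; split=> //; apply: le_trans le. Qed.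

Lemma walk_edge G u v : adj G u v -> walk G u v (weight G [set u; v]).
Proof.
by move=> a; exists [:: v]; rewrite /= a path_length_cons path_length_nil addr0.
Qed.

Lemma walk_trans G u v x l l' : walk G u v l -> walk G v x l' -> walk G u x (l + l').
Proof.
case=> p [h1 h2 h3] [q [h4 h5 h6]]; exists (p ++ q); rewrite cat_path last_cat h2 h1 h4.
by split=> //; rewrite path_length_cat h2 lerD.
Qed.

Lemma walk_sym G u v l : walk G u v l -> walk G v u l.
Proof.
case=> p [h1 <- h3]; apply: walk_le h3.
elim: p u h1 => [|x p IH] u /=; first by rewrite path_length_nil => _; apply: walk_refl.
case/andP=> a /IH h; rewrite path_length_cons addrC; apply: walk_trans h _.
by rewrite setUC; apply: walk_edge; rewrite adjC.
Qed.

Lemma walk_del G (F F' : {set {set 'I_n}}) u v l : F' \subset F -> walk (del G F) u v l -> walk (del G F') u v l.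
Proof.
move=> FF [p [h1 h2 h3]]; exists p; split=> //.
apply: sub_path h1 => x y; rewrite !adj_del => /andP[h ->]; rewrite andbT.
by apply: contra h; apply/subsetP.
Qed.

Lemma walk_del_sub G F u v l : walk (del G F) u v l -> walk G u v l.
Proof.
case=> p [h1 h2 h3]; exists p; split=> //.
by apply: sub_path h1 => x y; rewrite adj_del => /andP[].
Qed.

Lemma simple_path G u p : path (adj G) u p -> exists q,
  [/\ is_path G u (last u p) q, (path_length G u q <= path_length G u p)%R,
      size q <= size p, ~~ uniq (u :: p) -> size q < size p & uniq (u :: p) -> q = p].
Proof.
elim: p u => [|x p IH] u /=; first by exists [::]; rewrite /is_path /= eqxx.
case/andP=> a hp; have [q [/and3P[q1 /eqP q2 q3] q4 q5 q6 q7]] := IH _ hp.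
have w0 := weight_ge0 a; rewrite path_length_cons.
case: (boolP (u \in x :: q)) => uq.
  have [r r1 r2] : exists2 r, [/\ path (adj G) u r, last u r = last x p, uniq (u :: r) & size r <= size q]
      & (path_length G u r <= path_length G x q)%R.
    move: uq q1 q2 q3; rewrite inE; case/predU1P=> [->|] q1 q2 q3.
      by exists q; rewrite -?q2.
    case/splitPr: q1 q2 q3 q4 q5 q6 q7 => a1 b1; rewrite last_cat cat_path.
    move=> /and3P[h1 h2 h3] <- h4 h5 h6 h7 h8; exists b1.
      split=> //; last by rewrite size_cat /= addnS ltnW // ltnS leq_addl.
      by move: h8; rewrite -cat_cons cat_uniq => /and3P[].
    rewrite path_length_cat path_length_cons.
    by rewrite addrA lerDr addr_ge0 ?path_length_ge0 ?weight_ge0.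
  case: r1 => r1 r3 r4 r5; exists r; rewrite /is_path r1 r3 r4 eqxx; split=> //.
  - by apply: le_trans r2 _; apply: le_trans q4 _; rewrite lerDr.
  - by apply: leq_trans r5 _; apply: leqW.
  - by rewrite ltnS (leq_trans r5).
  - case/andP=> uxp /q7 E; subst q; by rewrite uq in uxp.
exists (x :: q); rewrite /is_path /= a q1 q2 eqxx path_length_cons; split=> //.
- by rewrite uq; exact: q3.
- by rewrite lerD2l.
- rewrite ltnS negb_and negbK => /orP[h|/q6 //].
  case: (boolP (uniq (x :: p))) => [/q7 E|/q6 //]; subst q; by rewrite h in uq.
- by case/andP=> _ /q7 ->.
Qed.

Lemma simple_walk G u v l : walk G u v l -> exists2 p, is_path G u v p & (path_length G u p <= l)%R.
Proof.
case=> p [/simple_path[q [h1 h2 _ _ _]] <- h]; exists q => //; exact: le_trans h.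
Qed.

Lemma path_walk G u v p : is_path G u v p -> walk G u v (path_length G u p).
Proof. by case/and3P=> h1 /eqP h2 _; exists p. Qed.

Lemma shortest_length_ub G u v (x : option R) :
  (forall l, ub x l <-> walk G u v l) -> shortest_length G u v x.
Proof.
case: x => [a|] h /=; last first.
  by move=> p; apply/negP => /path_walk /h.
have /h/simple_walk[p hp le] : ub (Some a) a by rewrite /ub /=.
have min q : is_path G u v q -> (a <= path_length G u q)%R by move/path_walk/h.
exists p; last by apply: le_anti; rewrite le min.
by split=> // q /min; apply: le_trans.
Qed.

Lemma is_path_size G u v p : is_path G u v p -> size p < n.
Proof.
case/and3P=> _ _ /card_uniqP /= h.
by have := max_card (mem (u :: p)); rewrite h card_ord.
Qed.

End Walks.

Section FloydWarshall.
Variables (R : realDomainType) (n : nat) (G : wgraph R n).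
Variables (W : nat -> nat -> option R) (D : nat -> nat -> nat -> option R).
Hypothesis WE : forall u v : 'I_n, W u v = if adj G u v then Some (weight G [set u; v]) else None.
Hypothesis DE : forall k u v, k <= n -> u < n -> v < n ->
  D k u v = cmin [:: ((k == 0) && (u == v), Some 0%R); (k == 0, W u v); (0 < k, D k.-1 u v);
     (0 < k, wt_add (D k.-1 u k.-1) (D k.-1 k.-1 v))].

Lemma floyd_warshall_sound k (u v : 'I_n) l : k <= n -> ub (D k u v) l -> walk G u v l.
Proof.
elim: k u v l => [|k IH] u v l kn; rewrite DE // ub_cmin /=.
  rewrite !orbF => /orP[/andP[/eqP/val_inj -> h]|]; first exact: walk_le (walk_refl _ _) h.
  by rewrite WE; case: ifP => // /walk_edge a h; apply: walk_le a h.
rewrite orbF => /orP[/(IH _ _ _ (ltnW kn)) //|/ub_add[l1 [l2 [h1 h2 h3]]]].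
apply: walk_le h3; apply: (@walk_trans _ _ _ _ (Ordinal kn)).
  exact: (IH u (Ordinal kn)) (ltnW kn) _.
exact: (IH (Ordinal kn) v) (ltnW kn) _.
Qed.

Lemma floyd_warshall_refl k (u : 'I_n) : k <= n -> ub (D k u u) 0.
Proof.
elim: k => [|k IH] kn; rewrite DE // ub_cmin /= ?eqxx /= ?[ub (Some _) _]lexx //.
by rewrite IH // ltnW.
Qed.

Lemma floyd_warshall_complete k (u v : 'I_n) s : k <= n ->
  path (adj G) u (rcons s v) -> uniq s -> all (fun x : 'I_n => x < k) s ->
  ub (D k u v) (path_length G u (rcons s v)).
Proof.
elim: k u v s => [|k IH] u v s kn.
  case: s => [|x s] //=; rewrite andbT => a _ _; rewrite DE // ub_cmin /= WE a.
  by rewrite path_length_cons path_length_nil addr0 /ub /= lexx !orbT.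
move=> hp us als; rewrite DE // ub_cmin /= orbF.
case: (boolP (Ordinal kn \in s)) => ks; last first.
  rewrite IH // ?(ltnW kn) //; apply/allP => x xs; have := allP als x xs.
  rewrite ltnS leq_eqVlt => /orP[/eqP E|//]; case/negP: ks.
  by rewrite (_ : Ordinal kn = x) //; apply: val_inj.
case/splitPr: ks hp us als => s1 s2 hp us als; apply/orP; right.
have sub r : {subset r <= s1 ++ Ordinal kn :: s2} -> Ordinal kn \notin r ->
    all (fun x : 'I_n => x < k) r.
  move=> rs kr; apply/allP => x xr; have := allP als x (rs x xr).
  rewrite ltnS leq_eqVlt => /orP[/eqP E|//]; case/negP: kr.
  by rewrite (_ : Ordinal kn = x) //; apply: val_inj.
move: hp us; rewrite rcons_cat rcons_cons -cat_rcons cat_path last_rcons => /andP[p1 p2].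
rewrite cat_uniq /= negb_or => /and3P[u1 /andP[k1 _] /andP[k2 u2]].
apply/ub_add; exists (path_length G u (rcons s1 (Ordinal kn))), (path_length G (Ordinal kn) (rcons s2 v)).
split.
- apply: (IH u (Ordinal kn)) => //; first exact: ltnW.
  by apply: sub => // x xs; rewrite mem_cat xs.
- apply: (IH (Ordinal kn) v) => //; first exact: ltnW.
  by apply: sub => // x xs; rewrite mem_cat inE xs !orbT.
- by rewrite path_length_cat last_rcons.
Qed.

Lemma floyd_warshall (u v : 'I_n) l : ub (D n u v) l <-> walk G u v l.
Proof.
split; first exact: floyd_warshall_sound.
case/simple_walk=> p; case/and3P=> h1 h2 h3; apply: ub_le.
case/lastP: p h1 h2 h3 => [|p x].
  by move=> _ /eqP <- _; rewrite path_length_nil; apply: floyd_warshall_refl.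
rewrite last_rcons => h1 /eqP E h3; subst x; apply: floyd_warshall_complete => //.
  by move: h3; rewrite /= rcons_uniq => /and3P[].
by apply/allP => x _; apply: ltn_ord.
Qed.

End FloydWarshall.

Lemma wt_le_trans (R : realDomainType) (x y z : option R) : wt_le x y -> wt_le y z -> wt_le x z.
Proof. by case: x y z => [a|] [b|] [c|] //=; apply: le_trans. Qed.

Lemma wt_le_total (R : realDomainType) (x y : option R) : wt_le x y || wt_le y x.
Proof. by case: x y => [a|] [b|] //=; apply: le_total. Qed.

Lemma wt_le_refl (R : realDomainType) (x : option R) : wt_le x x.
Proof. by have := wt_le_total x x; rewrite orbb. Qed.

Section Tracing.
Variables (R : realDomainType) (n : nat) (G : wgraph R n) (s t : 'I_n).
Variables (W : nat -> nat -> option R) (DX : nat -> nat -> nat -> option R).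
Variables (LH : nat -> nat) (PTR : nat -> nat -> nat -> nat) (VP : nat -> nat).
Hypothesis WE : forall u v : 'I_n, W u v = if adj G u v then Some (weight G [set u; v]) else None.
Hypothesis DXE : forall h v u, h < n -> v < n -> u < n ->
  DX h v u = cmin [:: (0 < u, DX h v u.-1); ((h == 0) && (v == t), Some 0%R);
     (0 < h, wt_add (W v u) (DX h.-1 u n.-1))].

Local Notation dx h v := (DX h v n.-1).

Hypothesis LH0 : LH 0 = 0.
Hypothesis LHS : forall h, h.+1 < n ->
  LH h.+1 = if wt_le (dx (LH h) s) (dx h.+1 s) then LH h else h.+1.
Hypothesis PTRE : forall h v u, 0 < h -> h < n -> v < n -> u < n ->
  wt_le (wt_add (W v u) (dx h.-1 u)) (dx h v) -> PTR h v u = u.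
Hypothesis PTRS : forall h v u, 0 < h -> h < n -> v < n -> u.+1 < n ->
  ~~ wt_le (wt_add (W v u.+1) (dx h.-1 u.+1)) (dx h v) -> PTR h v u.+1 = PTR h v u.
Hypothesis VP0 : VP 0 = s.
Hypothesis VPS : forall m, m.+1 < n -> m < LH n.-1 -> VP m < n -> VP m.+1 = PTR (LH n.-1 - m) (VP m) n.-1.

Let n_gt0 : 0 < n. Proof. exact: leq_ltn_trans (ltn_ord s). Qed.

Lemma DX_ub h (v : 'I_n) l : h < n ->
  ub (dx h v) l <-> exists p, [/\ size p = h, path (adj G) v p, last v p = t &
     (path_length G v p <= l)%R].
Proof.
elim: h v l => [|h IH] v l hn.
  have TE q : q < n -> DX 0 v q = cmin ((0 < q, DX 0 v q.-1) ::
     [:: (true && (v == t :> nat), Some 0%R); (false, wt_add (W v q) (dx 0 q))]).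
    by move=> qn; apply: DXE.
  rewrite (running_min l TE); last by rewrite prednK.
  split=> [[q _]|[[|u p] [h1 _ E le]] //].
    rewrite ub_cmin /= orbF => /andP[/eqP/val_inj E le]; exists [::].
    by rewrite path_length_nil.
  exists 0 => //; rewrite ub_cmin /= orbF; rewrite /= in E; rewrite E eqxx.
  by rewrite path_length_nil in le.
have TE q : q < n -> DX h.+1 v q = cmin ((0 < q, DX h.+1 v q.-1) ::
   [:: (false, Some 0%R); (true, wt_add (W v q) (dx h q))]).
  by move=> qn; apply: DXE.
rewrite (running_min l TE); last by rewrite prednK.
split=> [[q qn]|[[|u p] [// [sp] /= /andP[a hp] E le]]].
  have {}qn : q < n by rewrite -(prednK n_gt0) ltnS.
  rewrite ub_cmin /= orbF => /ub_add[l1 [l2 [h1 /(IH (Ordinal qn) _ (ltnW hn))[p [p1 p2 p3 p4]] h3]]].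
  move: h1; rewrite (WE v (Ordinal qn)); case: ifP => // a h1.
  exists (Ordinal qn :: p); rewrite /= p1 a path_length_cons; split=> //.
  by apply: le_trans h3; rewrite lerD.
exists u; first by rewrite -ltnS prednK.
rewrite ub_cmin /= orbF; apply/ub_add; exists (weight G [set v; u]), (path_length G u p).
rewrite WE a /ub /= lexx -path_length_cons; split=> //.
by apply/(IH _ _ (ltnW hn)); exists p.
Qed.

Lemma PTR_spec h (v : 'I_n) x : 0 < h -> h < n -> dx h v = Some x ->
  exists u : 'I_n, [/\ PTR h v n.-1 = u, adj G v u &
    ub (dx h.-1 u) (x - weight G [set v; u])].
Proof.
move=> h0 hn E.
have : ub (dx h v) x by rewrite E /ub /= lexx.
case/(DX_ub _ _ hn) => -[|u0 p [sp /= /andP[a hp] lt le]]; first by case=> h00; rewrite -h00 in h0.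
have c0 : wt_le (wt_add (W v u0) (dx h.-1 u0)) (dx h v).
  rewrite E; apply/ub_add; exists (weight G [set v; u0]), (path_length G u0 p).
  rewrite WE a /ub /= lexx -path_length_cons; split=> //.
  by apply/DX_ub; [apply: leq_ltn_trans hn; apply: leq_pred | exists p; rewrite -sp].
have key q : u0 <= q -> q < n -> PTR h v q < n /\
    wt_le (wt_add (W v (PTR h v q)) (dx h.-1 (PTR h v q))) (dx h v).
  elim: q => [|q IH] uq qn.
    by move: uq; rewrite leqn0 => /eqP u00; rewrite u00 in c0; rewrite PTRE.
  case: (boolP (wt_le (wt_add (W v q.+1) (dx h.-1 q.+1)) (dx h v))) => c; first by rewrite PTRE.
  rewrite PTRS // ; apply: IH; last exact: ltnW.
  by move: uq; rewrite leq_eqVlt => /orP[/eqP E1|//]; rewrite -E1 c0 in c.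
have n1 : n.-1 < n by rewrite prednK.
have u0n : u0 <= n.-1 by rewrite -ltnS prednK.
have [un] := key _ u0n n1.
set u := PTR _ _ _ in un *; rewrite E => /ub_add[l1 [l2]].
rewrite (WE v (Ordinal un)); case: ifP => [a'|_] [//= h1 h2 h3].
exists (Ordinal un); split=> //; apply: ub_le h2 _.
by rewrite lerBrDl; apply: le_trans h3; rewrite lerD2r.
Qed.

Lemma LH_spec h : h < n -> [/\ LH h <= h,
  forall h', h' <= h -> wt_le (dx (LH h) s) (dx h' s) &
  forall h', h' < LH h -> ~~ wt_le (dx h' s) (dx (LH h) s)].
Proof.
elim: h => [|h IH] hn; first by rewrite LH0; split=> // h'; rewrite leqn0 => /eqP->; apply: wt_le_refl.
have [le1 min1 first1] := IH (ltnW hn); rewrite LHS //.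
case: ifP => c; split=> //.
- exact: leqW.
- by move=> h'; rewrite leq_eqVlt => /predU1P[->//|]; apply: min1.
- move=> h'; rewrite leq_eqVlt => /predU1P[->|h'h]; first exact: wt_le_refl.
  have := wt_le_total (dx (LH h) s) (dx h.+1 s); rewrite c /= => c'.
  by apply: wt_le_trans c' (min1 _ _).
- move=> h' h'h; apply/negP => c'; have := wt_le_trans (min1 h' h'h) c'; by rewrite c.
Qed.

Let L := LH n.-1.

Lemma VP_path x m : dx L s = Some x -> m <= L -> exists q y,
  [/\ size q = m, forall i, i <= m -> VP i = nth s (s :: q) i, path (adj G) s q,
     ub (dx (L - m) (last s q)) y & (path_length G s q + y <= x)%R].
Proof.
have n1 : n.-1 < n by rewrite prednK.
have [Ln1 _ _] := LH_spec n1.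
have Ln : L < n by apply: leq_ltn_trans Ln1 n1.
move=> E; elim: m => [|m IH] mL.
  exists [::], x; rewrite subn0 /= E /ub /= lexx path_length_nil add0r; split=> //.
  by case.
have [q [y [q1 q2 q3 q4 q5]]] := IH (ltnW mL).
case E1: (dx (L - m) (last s q)) q4 => [y'|//] q4.
have Lm : 0 < L - m by rewrite subn_gt0.
have Lmn : L - m < n by apply: leq_ltn_trans Ln; apply: leq_subr.
have [u [u1 u2 u3]] := PTR_spec Lm Lmn E1.
exists (rcons q u), (y' - weight G [set last s q; u])%R; split.
- by rewrite size_rcons q1.
- move=> i; rewrite leq_eqVlt => /predU1P[->|im].
    rewrite VPS //; [|by apply: leq_ltn_trans Ln|by rewrite q2].
    have E2 : nth s (s :: q) m = last s q by rewrite -q1 -[size q]/((size (s :: q)).-1) nth_last.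
    by rewrite q2 // E2 -/L u1 /= nth_rcons q1 ltnn eqxx.
  by rewrite q2 // -rcons_cons nth_rcons /= q1 im.
- by rewrite rcons_path q3.
- by rewrite last_rcons subnS.
- rewrite -cats1 path_length_cat path_length_cons path_length_nil addr0 addrACA subrr addr0.
  by apply: le_trans q5; rewrite lerD2l.
Qed.

Lemma traced_path p : unique_shortest_paths G -> shortest_path G s t p ->
  size p = L /\ forall i, i <= L -> VP i = nth s (s :: p) i.
Proof.
move=> uniqG [ip minp].
have n1 : n.-1 < n by rewrite prednK.
have [Ln1 minL firstL] := LH_spec n1; rewrite -/L in Ln1 minL firstL.
have Ln : L < n by apply: leq_ltn_trans Ln1 n1.
have sp := is_path_size ip.
have : ub (dx L s) (path_length G s p).
  apply: wt_le_trans (minL (size p) _) _; first by rewrite -ltnS prednK.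
  apply/(DX_ub _ _ sp); case/and3P: ip => h1 /eqP h2 _; by exists p.
case E: (dx L s) => [x|//] lex.
have [q [y [q1 q2 q3 q4 q5]]] := VP_path E (leqnn _).
move: q4; rewrite subnn => /(DX_ub _ _ n_gt0) [[|u0 p0] [// _ _ /= qt y0]].
rewrite path_length_nil in y0.
have qx : (path_length G s q <= x)%R by apply: le_trans q5; rewrite lerDl.
have [q' [i1 i2 i3 i4 i5]] := simple_path q3.
have uq : uniq (s :: q).
  apply/negPn/negP => /i4; rewrite q1 => lt; have /negP := firstL _ lt; apply.
  rewrite E; apply/(DX_ub _ _ (ltn_trans lt Ln)); exists q'.
  case/and3P: i1 => h1 /eqP h2 _; rewrite h2 qt; split=> //.
  exact: le_trans i2 qx.
have iq : is_path G s t q by rewrite /is_path q3 qt eqxx uq.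
have adj0 u v : adj (del G set0) u v = adj G u v by rewrite adj_del inE.
have path0 r : is_path (del G set0) s t r = is_path G s t r.
  by rewrite /is_path (eq_path adj0).
have short0 r : shortest_path G s t r -> shortest_path (del G set0) s t r.
  by case=> h1 h2; split=> [|r']; rewrite path0 //; apply: h2.
have sq : shortest_path G s t q.
  split=> // r /minp; apply: le_trans; exact: le_trans qx lex.
have -> : p = q by apply: (uniqG set0 s t); apply: short0.
by rewrite q1.
Qed.

End Tracing.

Section PathGeometry.
Variables (R : realDomainType) (n : nat) (G : wgraph R n) (s t : 'I_n) (p : seq 'I_n).
Hypothesis short_p : shortest_path G s t p.

Local Notation L := (size p).
Definition vertex i := nth s (s :: p) i.
Definition path_edge i := [set vertex i; vertex i.+1].
Definition off_path := del G [set e in path_edges s p].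
Definition prefix_length m := path_length G s (take m p).
Local Notation sig := prefix_length.

Let ip : is_path G s t p. Proof. by case: short_p. Qed.
Let pp : path (adj G) s p. Proof. by case/and3P: ip. Qed.
Let lp : last s p = t. Proof. by case/and3P: ip => _ /eqP. Qed.
Let up : uniq (s :: p). Proof. by case/and3P: ip. Qed.

Lemma vertex_inj i j : i <= L -> j <= L -> vertex i = vertex j -> i = j.
Proof. by move=> iL jL /eqP; rewrite nth_uniq // => /eqP. Qed.

Lemma vertex_last : vertex L = t.
Proof. by rewrite /vertex -lp -[L]/((size (s :: p)).-1) nth_last. Qed.

Lemma path_edge_inj i j : i < L -> j < L -> path_edge i = path_edge j -> i = j.
Proof.
move=> iL jL E.
have : vertex i \in path_edge j by rewrite -E !inE eqxx.
have : vertex i.+1 \in path_edge j by rewrite -E !inE eqxx orbT.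
have [iL' jL'] := (ltnW iL, ltnW jL).
rewrite !inE => /orP[]/eqP/vertex_inj h1 /orP[]/eqP/vertex_inj h2.
- exact: h2.
- by have := h1 iL jL'; have := h2 iL' jL; lia.
- exact: h2.
- by have := h1 iL jL; case.
Qed.

Lemma nth_path_edges i : i < L -> nth set0 (path_edges s p) i = path_edge i.
Proof. by move=> iL; rewrite /path_edges (nth_pairmap s). Qed.

Lemma mem_path_edges e : reflect (exists2 i, i < L & e = path_edge i) (e \in path_edges s p).
Proof.
apply: (iffP (nthP set0)); rewrite size_pairmap => -[i iL].
  by rewrite nth_path_edges // => <-; exists i.
by move=> ->; exists i; rewrite ?nth_path_edges.
Qed.

Lemma adj_vertex i : i < L -> adj G (vertex i) (vertex i.+1).
Proof. by move=> iL; have /(pathP s) := pp; apply. Qed.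

Lemma prefix_lengthS i : i < L -> (sig i.+1 - sig i = weight G (path_edge i))%R.
Proof.
move=> iL; rewrite /sig (take_nth s) // -cats1 path_length_cat addrC addKr.
rewrite path_length_cons path_length_nil addr0; congr (weight G [set _; _]).
case: i iL => [|i] iL; first by rewrite take0.
by rewrite (take_nth s) ?(ltnW iL) // last_rcons.
Qed.

Lemma prefix_length_mono i j : i <= j -> j <= L -> (sig i <= sig j)%R.
Proof.
elim: j => [|j IH]; first by rewrite leqn0 => /eqP->.
rewrite leq_eqVlt => /predU1P[->//|ij] jL; apply: le_trans (IH ij (ltnW jL)) _.
by rewrite -subr_ge0 prefix_lengthS //; exact: weight_ge0 (adj_vertex jL).
Qed.

Lemma prefix_length0 : sig 0 = 0%R.
Proof. by rewrite /sig take0 path_length_nil. Qed.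

Lemma walk_segment (F : {set {set 'I_n}}) a b : a <= b -> b <= L ->
  (forall r, a <= r < b -> path_edge r \notin F) ->
  walk (del G F) (vertex a) (vertex b) (sig b - sig a)%R.
Proof.
elim: b => [|b IH].
  by rewrite leqn0 => /eqP-> _ _; rewrite subrr; apply: walk_refl.
rewrite leq_eqVlt => /predU1P[->|ab] bL h; first by rewrite subrr; apply: walk_refl.
have -> : (sig b.+1 - sig a = (sig b - sig a) + (sig b.+1 - sig b))%R by ring.
apply: walk_trans.
  by apply: IH => //; [exact: ltnW | move=> r /andP[h1 h2]; apply: h; rewrite h1 ltnW].
rewrite prefix_lengthS //; apply: (@walk_edge _ _ (del G F)).
by rewrite adj_del adj_vertex // andbT; apply: h; rewrite ltnSn -ltnS ab.
Qed.

Lemma shortest_walk l : walk G s t l -> (sig L <= l)%R.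
Proof.
case/simple_walk=> q iq le; apply: le_trans le; rewrite /sig take_size.
by case: short_p => _; apply.
Qed.

Lemma walk_gap a b l : a <= L -> b <= L -> walk G (vertex a) (vertex b) l ->
  (`|sig a - sig b| <= l)%R.
Proof.
wlog ab : a b / a <= b => [th|].
  case: (leqP a b) => [|/ltnW] h aL bL hw; first exact: th.
  by rewrite distrC; apply: th => //; apply: walk_sym.
move=> aL bL hw; rewrite absR_le ?prefix_length_mono //.
have nF r : path_edge r \notin (set0 : {set {set 'I_n}}) by rewrite inE.
have w1 := walk_del_sub (walk_segment (F := set0) (leq0n a) aL (fun r _ => nF r)).
have w2 := walk_del_sub (walk_segment (F := set0) bL (leqnn _) (fun r _ => nF r)).
have := walk_trans (walk_trans w1 hw) w2; rewrite vertex_last => /shortest_walk.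
by rewrite prefix_length0; move: (sig a) (sig b) (sig L) => x y z; lra.
Qed.

Section Failures.
Variables (H : nat -> nat -> option R) (f g : nat -> nat -> option R) (i j k : nat).
Hypothesis HE : forall a b l, a <= L -> b <= L ->
  ub (H a b) l <-> walk off_path (vertex a) (vertex b) l.
Hypotheses (ij : i <= j) (jk : j <= k) (kL : k < L).

Lemma H_sym a b l : a <= L -> b <= L -> ub (H a b) l -> ub (H b a) l.
Proof. by move=> aL bL /(HE _ aL bL) h; apply/(HE _ bL aL)/walk_sym. Qed.

Lemma H_gap a b l : a <= L -> b <= L -> ub (H a b) l -> (`|sig a - sig b| <= l)%R.
Proof. by move=> aL bL /(HE _ aL bL) /walk_del_sub; apply: walk_gap. Qed.

Hypothesis f_ub : forall i v l, i < L -> v <= L -> ub (f i v) l <->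
  exists x h, [/\ x <= i, ub (H x v) h & (sig x - sig 0 + h <= l)%R].
Hypothesis g_ub : forall k v l, k < L -> v <= L -> ub (g k v) l <->
  exists z h, [/\ k < z <= L, ub (H v z) h & (h + (sig L - sig z) <= l)%R].

Let F := [set path_edge i; path_edge j; path_edge k].

Lemma failures_sub : F \subset [set e in path_edges s p].
Proof.
apply/subsetP => e; rewrite !inE => he; apply/mem_path_edges.
by case/orP: he => [/orP[]|] /eqP->; [exists i | exists j | exists k] => //; lia.
Qed.

Lemma intact_edge r : r < L -> (path_edge r \notin F) = intact i j k r.
Proof.
move=> rL; have inj m : m < L -> (path_edge r == path_edge m) = (r == m).
  by move=> mL; apply/eqP/eqP => [/path_edge_inj|->//]; apply.
by rewrite !inE !inj ?negb_or ?andbA //; lia.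
Qed.

Lemma reach_walk a b l : reach L sig H (intact i j k) a b l ->
  walk (del G F) (vertex a) (vertex b) l.
Proof.
elim=> {a b l} [a b l ab bL h|a b l aL bL|a b l _|a b c l1 l2 l _ h1 _ h2].
- apply: walk_le; apply: walk_segment => // r /[dup] /h hr /andP[_ rb].
  by rewrite intact_edge // (leq_trans rb).
- by move/(HE _ aL bL)/(walk_del failures_sub).
- exact: walk_sym.
- exact: walk_le (walk_trans h1 h2).
Qed.

Lemma walk_prefix_cost u q : path (adj (del G F)) s q -> last s q = u ->
  exists a l1 l2, [/\ a <= L, prefix_cost L sig H f g i j k a l1, walk off_path (vertex a) u l2 &
    (l1 + l2 <= path_length G s q)%R].
Proof.
elim/last_ind: q u => [|q x IH] u.
  move=> _ <-; exists 0, 0%R, 0%R; split=> //; first exact: prefix_cost0.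
    exact: walk_refl.
  by rewrite path_length_nil addr0.
rewrite rcons_path last_rcons => /andP[hq a] <-.
have [b [l1 [l2 [bL pc hw le]]]] := IH _ hq erefl.
rewrite -cats1 path_length_cat path_length_cons path_length_nil addr0.
move: a; rewrite adj_del => /andP[aF aG].
case: (boolP ([set last s q; x] \in path_edges s p)) => [/mem_path_edges[r rL E]|ne]; last first.
  exists b, l1, (l2 + weight G [set last s q; x])%R; split=> //; last by rewrite addrA lerD2r.
  by apply: walk_trans hw _; apply: (@walk_edge _ _ off_path); rewrite adj_del inE ne.
have ir : intact i j k r by rewrite -intact_edge // -E.
have [c [d [cd cL dL [cE dE]]]] : exists c d, [/\ (c = r /\ d = r.+1) \/ (c = r.+1 /\ d = r),
    c <= L, d <= L & vertex c = last s q /\ vertex d = x].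
  have h1 : last s q \in path_edge r by rewrite -E !inE eqxx.
  have h2 : x \in path_edge r by rewrite -E !inE eqxx orbT.
  have ne : last s q != x.
    by apply/negP => /eqP h; have := edge_card aG; rewrite h setUid cards1.
  move: h1 h2 ne; rewrite !inE => /orP[]/eqP-> /orP[]/eqP->; rewrite ?eqxx // => _.
    by exists r, r.+1; split=> //; [left | exact: ltnW].
  by exists r.+1, r; split=> //; [right | exact: ltnW].
exists d, (l1 + l2 + (sig r.+1 - sig r))%R, 0%R; split=> //.
- apply: (prefix_cost_edge prefix_length_mono _ _ _ rL ir cd) => //.
  apply: (prefix_cost_jump prefix_length_mono H_gap f_ub g_ub _ _ _ bL cL) => //.
  by apply/(HE _ bL cL); rewrite cE.
- by rewrite dE; apply: walk_refl.
- by rewrite addr0 prefix_lengthS // -E lerD2r.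
Qed.

Lemma pattern_walk l : pattern L sig H f g i j k l <-> walk (del G F) s t l.
Proof.
split=> [h|].
  rewrite -vertex_last -[s]/(vertex 0); apply: reach_walk.
  exact: (pattern_reach prefix_length_mono f_ub g_ub ij jk kL h).
case=> q [q1 q2 q3]; apply: pattern_le q3 _.
have [a [l1 [l2 [aL pc hw le]]]] := walk_prefix_cost q1 q2.
apply: pattern_le le _; apply: prefix_cost_end => //.
apply: (prefix_cost_jump prefix_length_mono H_gap f_ub g_ub _ _ _ aL (leqnn _)) pc => //.
by apply/(HE _ aL (leqnn _)); rewrite vertex_last.
Qed.

End Failures.
End PathGeometry.

(** * The algorithm *)

Notation w0 := (WConst 0).
Definition wlt a b := BNot (BLeW b a).
Definition btrue := BLeW w0 w0.
Definition idx2 x y := x *w nn +w y.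
Definition idx3 x y z := (x *w nn +w y) *w nn +w z.
Definition idx4 x y z u := ((x *w nn +w y) *w nn +w z) *w nn +w u.

Definition x2 := lv /w nn.
Definition y2 := lv %w nn.
Definition x3 := lv /w nn /w nn.
Definition y3 := (lv /w nn) %w nn.
Definition z3 := lv %w nn.
Definition x4 := lv /w nn /w nn /w nn.
Definition y4 := (lv /w nn /w nn) %w nn.
Definition z4 := (lv /w nn) %w nn.
Definition u4 := lv %w nn.

Definition n1 := nn -w wone.
Definition prev := lv -w wone.
Definition source := WLoad 0 (WConst 1).
Definition target := WLoad 0 (WConst 2).
Definition edge_weight u v := VLoad 0 (idx2 u v).

Definition levels := WLoad 2 nn.
Definition pow2 x := WLoad 3 x.
Definition last_pos := WLoad 5 n1.

Definition p_levels := PW 2 (nn +w wone) (BLeW wone lv) (WLoad 2 (lv /w WConst 2) +w wone) w0.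
Definition p_pow2 := PW 3 (nn +w wone) (BLeW wone lv) (WLoad 3 prev *w WConst 2) wone.

(* The least weight of a walk of h edges from v to the target, the first step
   being restricted to vertices up to u. *)
Definition v_hops h v u := VLoad 3 (idx3 h v u).
Definition p_hops := PV 3 (nn *w nn *w nn)
  [:: (wlt w0 z3, VLoad 3 prev); (BAnd (BEqW x3 w0) (BEqW y3 target), VZero);
      (wlt w0 x3, VAdd (edge_weight y3 z3) (v_hops (x3 -w wone) z3 n1))].
Definition p_next := PW 4 (nn *w nn *w nn)
  (BLeV (VAdd (edge_weight y3 z3) (v_hops (x3 -w wone) z3 n1)) (v_hops x3 y3 n1)) z3 (WLoad 4 prev).
Definition p_last := PW 5 nn
  (BLeV (v_hops (WLoad 5 prev) source n1) (v_hops lv source n1)) (WLoad 5 prev) lv.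
Definition p_path := PW 6 nn (BLeW wone lv)
  (WLoad 4 (idx3 (last_pos -w prev) (WLoad 6 prev) n1)) source.
Definition p_rev_path := PW 7 nn btrue (WLoad 6 (last_pos -w lv)) w0.

Definition p_mark := PW 8 (nn *w nn *w nn)
  (BAnd (wlt z3 last_pos) (BAnd (BEqW (WLoad 6 z3) x3) (BEqW (WLoad 6 (z3 +w wone)) y3)))
  wone (WLoad 8 prev *w (wone -w (wone -w z3))).
Definition w_mark u v := WLoad 8 (idx3 u v n1).
Definition v_detour k u v := VLoad 4 (idx3 k u v).
Definition p_detour := PV 4 (nn *w nn *w nn +w nn *w nn)
  [:: (BAnd (BEqW x3 w0) (BEqW y3 z3), VZero);
      (BAnd (BEqW x3 w0) (BEqW (w_mark y3 z3 +w w_mark z3 y3) w0), edge_weight y3 z3);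
      (wlt w0 x3, v_detour (x3 -w wone) y3 z3);
      (wlt w0 x3, VAdd (v_detour (x3 -w wone) y3 (x3 -w wone))
                       (v_detour (x3 -w wone) (x3 -w wone) z3))].

(* In what follows, o tells whether the path is read backwards; sw exchanges the
   costs f and g of reaching a vertex from the source and from the target. *)
Definition pos (o : bool) x := WLoad (if o then 7 else 6) x.
Definition v_det o x y := VLoad 4 (idx3 nn (pos o x) (pos o y)).
Definition offset (o : bool) := if o then pow2 levels -w wone -w last_pos else w0.
Definition w_end o lam y :=
  ((y +w offset o) /w pow2 lam +w wone) *w pow2 lam -w offset o.

Definition v_dist (o : bool) x y := VLoad (if o then 6 else 5) (idx2 x y).
Definition p_dist (o : bool) := PV (if o then 6 else 5) (nn *w nn)
  [:: (BEqW x2 y2, VZero);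
      (wlt x2 y2, VAdd (v_dist o x2 (y2 -w wone))
                       (edge_weight (pos o (y2 -w wone)) (pos o y2)))].

Definition v_from (o : bool) i v := VLoad (if o then 8 else 7) (idx2 i v).
Definition p_from (o : bool) := PV (if o then 8 else 7) (nn *w nn)
  [:: (wlt w0 x2, v_from o (x2 -w wone) y2);
      (btrue, VAdd (v_dist o w0 x2) (v_det o x2 y2))].

Definition v_cost (o sw : bool) c v :=
  if sw then v_from (~~ o) (last_pos -w wone -w c) (last_pos -w v) else v_from o c v.

(* Cell (y, u, r) is the minimum of H(y, w) + |w - u| over n - 1 - r <= w <= u. *)
Definition a_detwin (o : bool) := if o then 10 else 9.
Definition p_detwin o := PV (a_detwin o) (nn *w nn *w nn)
  [:: (wlt w0 z3, VLoad (a_detwin o) prev);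
      (BLeW (n1 -w z3) y3, VAdd (v_det o x3 (n1 -w z3)) (v_dist o (n1 -w z3) y3))].

(* Cell (c, u, r) is the minimum of cost(c, w) + |w - u| over n - 1 - r <= w <= u. *)
Definition a_costwin (o sw : bool) := if o then if sw then 18 else 16 else if sw then 17 else 15.
Definition p_costwin o sw := PV (a_costwin o sw) (nn *w nn *w nn)
  [:: (wlt w0 z3, VLoad (a_costwin o sw) prev);
      (BLeW (n1 -w z3) y3, VAdd (v_cost o sw x3 (n1 -w z3)) (v_dist o (n1 -w z3) y3))].
Definition v_costwin o sw c u e := VLoad (a_costwin o sw) (idx3 c u (n1 -w e)).

(* Cell (lam, y, k) is the minimum of |e - w| + H(y, w) over e <= w <= k, where e is
   the end of the block of y. *)
Definition a_pivot (o : bool) := if o then 12 else 11.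
Definition p_pivot o := PV (a_pivot o) (levels *w nn *w nn)
  [:: (wlt w0 z3, VLoad (a_pivot o) prev);
      (BLeW (w_end o x3 y3) z3, VAdd (v_dist o (w_end o x3 y3) z3) (v_det o y3 z3))].

Definition a_one (o : bool) := if o then 14 else 13.
Definition p_one o := PV (a_one o) (nn *w nn *w nn)
  [:: (wlt w0 z3, VLoad (a_one o) prev);
      (wlt x3 z3, VAdd (v_costwin o false x3 z3 (x3 +w wone)) (v_cost o true y3 z3));
      (wlt x3 z3, VAdd (v_cost o false x3 z3) (v_costwin o true y3 z3 (x3 +w wone)))].

Definition p_direct := PV 19 (nn *w nn)
  [:: (wlt w0 y2, VLoad 19 prev);
      (BLeW (n1 -w y2) last_pos,
       VAdd (v_from false x2 (n1 -w y2)) (v_dist false (n1 -w y2) last_pos))].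

Definition quad (o sw : bool) a :=
  if o then if sw then a.+3 else a.+2 else if sw then a.+1 else a.
Definition size4 := levels *w nn *w nn *w nn.

(* Cell (lam, c, y, u) is the minimum of H(y, w) + |w - w'| + cost(c, w') over w and
   w' in [e, u], where e is the end of the block of y. *)
Definition a_hook o sw := quad o sw 20.
Definition p_hook o sw := PV (a_hook o sw) size4
  [:: (wlt w0 u4, VLoad (a_hook o sw) prev);
      (BLeW (w_end o x4 z4) u4,
       VAdd (v_costwin o (~~ sw) y4 u4 (w_end o x4 z4)) (v_det o z4 u4));
      (BLeW (w_end o x4 z4) u4,
       VAdd (VLoad (a_detwin o) (idx3 z4 u4 (n1 -w w_end o x4 z4))) (v_cost o (~~ sw) y4 u4))].

Definition in_block o :=
  BAnd (wlt y4 u4) (BNot (BEqW ((u4 +w offset o) %w pow2 x4) w0)).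

(* The first interval is reached at the cost indexed by own sw, the second one
   at the cost indexed by own (~~ sw). *)
Definition own (sw : bool) := if sw then z4 else y4.

Definition v_hook o sw := VLoad (a_hook o sw) (idx4 x4 (own (~~ sw)) u4 z4).
Definition v_pivot o := VLoad (a_pivot o) (idx3 x4 u4 z4).
(* At cell (lam, i, k, j), leak_cands yields the minimum of |y' - j| + K(y') over the
   y' > i in the part up to j of the block of j, and enter_cands the minimum of
   cost(y) + |y - y'| + K(y') over such y' and over i < y <= j. *)
Definition leak_cands a o K :=
  [:: (in_block o, VAdd (VLoad a prev) (v_dist o (u4 -w wone) u4)); (wlt y4 u4, K)].
Definition enter_cands a o sw K X :=
  [:: (in_block o, VLoad a prev);
      (wlt y4 u4, VAdd (v_costwin o sw (own sw) u4 (y4 +w wone)) K);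
      (wlt y4 u4, VAdd (v_cost o sw (own sw) u4) (VLoad X lv))].

Definition p_hook_leak o sw := PV (quad o sw 24) size4 (leak_cands (quad o sw 24) o (v_hook o sw)).
Definition p_pivot_leak o sw := PV (quad o sw 28) size4 (leak_cands (quad o sw 28) o (v_pivot o)).
Definition p_hook_enter o sw :=
  PV (quad o sw 32) size4 (enter_cands (quad o sw 32) o sw (v_hook o sw) (quad o sw 24)).
Definition p_pivot_enter o sw :=
  PV (quad o sw 36) size4 (enter_cands (quad o sw 36) o sw (v_pivot o) (quad o sw 28)).
Definition a_cross o sw := quad o sw 40.
Definition p_cross o sw := PV (a_cross o sw) size4
  [:: (wlt w0 x4, VLoad (a_cross o sw) (idx4 (x4 -w wone) y4 z4 u4));
      (btrue, VLoad (quad o sw 32) lv);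
      (BLeW (w_end o x4 u4) z4,
       VAdd (VLoad (quad o sw 36) lv)
            (v_costwin o (~~ sw) (own (~~ sw)) (w_end o x4 u4) (u4 +w wone)))].

(* Subtraction of words is truncated. *)
Definition wmin a b := a -w (a -w b).
Definition wmax a b := a +w (b -w a).
Definition e_i := wmin (wmin x3 y3) z3.
Definition e_k := wmax (wmax x3 y3) z3.
Definition e_j := x3 +w y3 +w z3 -w e_i -w e_k.
Definition mir x := last_pos -w wone -w x.
Definition p_answer := PV 1 (nn *w nn *w nn)
  [:: (btrue, VLoad 19 (idx2 e_i (n1 -w (e_k +w wone))));
      (btrue, VLoad (a_one false) (idx3 e_i e_k e_j));
      (btrue, VLoad (a_one true) (idx3 (mir e_k) (mir e_i) (mir e_j)));
      (btrue, VLoad (a_cross false false) (idx4 (levels -w wone) e_i e_k e_j));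
      (btrue, VLoad (a_cross false true) (idx4 (levels -w wone) e_i e_k e_j));
      (btrue, VLoad (a_cross true false) (idx4 (levels -w wone) (mir e_k) (mir e_i) (mir e_j)));
      (btrue, VLoad (a_cross true true) (idx4 (levels -w wone) (mir e_k) (mir e_i) (mir e_j)))].

Definition cross_phases o sw :=
  [:: p_hook o sw; p_hook_leak o sw; p_pivot_leak o sw; p_hook_enter o sw;
      p_pivot_enter o sw; p_cross o sw].
Definition side_phases o :=
  [:: p_detwin o; p_costwin o false; p_costwin o true; p_pivot o; p_one o].

Definition phases :=
  [:: p_levels; p_pow2; p_hops; p_next; p_last; p_path; p_rev_path; p_mark; p_detour;
      p_dist false; p_dist true; p_from false; p_from true] ++
  side_phases false ++ side_phases true ++
  cross_phases false false ++ cross_phases false true ++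
  cross_phases true false ++ cross_phases true true ++ [:: p_direct; p_answer].

Definition word_const := 60.

Lemma phases_wellformed : phases_wf word_const [:: 0] [:: 0] phases.
Proof. by vm_compute. Qed.

Lemma coord_div X n z : z < n -> (X * n + z) %/ n = X.
Proof. by move=> zn; rewrite divnMDl ?(leq_ltn_trans _ zn) // divn_small ?addn0. Qed.

Lemma coord_mod X n z : z < n -> (X * n + z) %% n = z.
Proof. by move=> zn; rewrite modnMDl modn_small. Qed.

Lemma code2_lt A n x y : x < A -> y < n -> x * n + y < A * n.
Proof. by move=> xA yn; have := leq_mul2r n x.+1 A; rewrite xA orbT mulSn; lia. Qed.

Section SameCands.
Variable R : realDomainType.
Implicit Types cs : seq (bool * option R).

Definition same_cands cs cs' := forall x,
  foldl (fun acc c => if c.1 then tmin acc c.2 else acc) x cs =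
  foldl (fun acc c => if c.1 then tmin acc c.2 else acc) x cs'.

Lemma cmin_same cs cs' : same_cands cs cs' -> cmin cs = cmin cs'.
Proof. exact. Qed.

Lemma same_nil : same_cands [::] [::].
Proof. by []. Qed.

Lemma same_cons (b b' : bool) (x x' : option R) cs cs' : b = b' -> (b' -> x = x') -> same_cands cs cs' ->
  same_cands ((b, x) :: cs) ((b', x') :: cs').
Proof. by move=> -> h same y /=; case: b' h => [->|]. Qed.

End SameCands.

Lemma phases_eqn_mem (R : realDomainType) wm (vm : nat -> nat -> option R) phs ph :
  phases_eqn phs wm vm -> List.In ph phs -> phase_eqn ph wm vm.
Proof. by elim: phs => //= ph' phs IH [h hs] [<-|/IH]; last exact. Qed.

Section Equations.
Variables (R : realDomainType) (wm : nat -> nat -> nat) (vm : nat -> nat -> option R) (n : nat).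
Hypothesis n0 : wm 0 0 = n.
Hypothesis E : phases_eqn phases wm vm.

Definition cell2 a x y := vm a (x * n + y).
Definition cell3 a x y z := vm a ((x * n + y) * n + z).
Definition cell4 a x y z u := vm a (((x * n + y) * n + z) * n + u).


Ltac cells := rewrite /mask /with_lv /= ?n0;
  do ?[rewrite coord_div // | rewrite coord_mod //]; rewrite ?subn1 ?addn1 -?ltnNge ?leqn0 -?lt0n.

Ltac phase_eq ph q :=
  let e := fresh "e" in
  have e : phase_eqn ph wm vm by
    [apply: phases_eqn_mem E _; rewrite /phases /=; repeat (first [left; reflexivity | right])];
  rewrite /cell2 /cell3 /cell4; have := e q; rewrite cval_cmin /= n0; move=> ->;
  [apply: cmin_same; do ![apply: same_cons; [| move=> ? |]]; try exact: same_nil; cells; try by []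
  | ].

Lemma own_prev (T : Type) X u (x y : T) : 0 < u ->
  (if X + u <= (X + u).-1 then x else y) = y.
Proof. by move=> u0; case: leqP => //; lia. Qed.

Lemma own_lt (T : Type) m m' (x y : T) : m' < m -> (if m <= m' then x else y) = y.
Proof. by rewrite ltnNge => /negPf->. Qed.

Lemma addn_pred X u : 0 < u -> (X + u).-1 = X + u.-1.
Proof. by case: u => // u _; rewrite addnS. Qed.

Lemma code3_lt A x y z : x < A -> y < n -> z < n -> (x * n + y) * n + z < A * n * n.
Proof. by move=> *; rewrite !code2_lt. Qed.

Hypothesis n_gt0 : 0 < n.

Lemma pred_lt x : 0 < x -> x.-1 < x.
Proof. by move=> ?; rewrite prednK. Qed.

Lemma code_lt2 x x' y y' : x' < x -> y' < n -> x' * n + y' < x * n + y.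
Proof. by move=> h1 h2; apply: leq_trans (code2_lt h1 h2) _; apply: leq_addr. Qed.

Lemma hops_eq h v u : h < n -> v < n -> u < n ->
  cell3 3 h v u = cmin [:: (0 < u, cell3 3 h v u.-1);
    ((h == 0) && (v == wm 0 2), Some 0%R);
    (0 < h, wt_add (cell2 0 v u) (cell3 3 h.-1 u n.-1))].
Proof.
move=> hn vn un; phase_eq p_hops ((h * n + v) * n + u); last by rewrite !code2_lt.
- by rewrite own_prev // addn_pred.
- by rewrite own_lt // !code_lt2 // pred_lt.
Qed.

Lemma detour_eq k u v : k <= n -> u < n -> v < n ->
  cell3 4 k u v = cmin [:: ((k == 0) && (u == v), Some 0%R);
    ((k == 0) && (wm 8 ((u * n + v) * n + n.-1) + wm 8 ((v * n + u) * n + n.-1) == 0), cell2 0 u v);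
    (0 < k, cell3 4 k.-1 u v);
    (0 < k, wt_add (cell3 4 k.-1 u k.-1) (cell3 4 k.-1 k.-1 v))].
Proof.
move=> kn un vn; phase_eq p_detour ((k * n + u) * n + v).
- by rewrite own_lt // !code_lt2 // pred_lt.
- have k1 : k.-1 < n by lia.
  by rewrite !own_lt // !code_lt2 // pred_lt.
- by apply: leq_trans (code3_lt (A := n.+1) _ un vn) _ => //; rewrite mulSn mulnDl addnC.
Qed.


Ltac word_eq ph q :=
  let e := fresh "e" in
  have e : phase_eqn ph wm vm by
    [apply: phases_eqn_mem E _; rewrite /phases /=; repeat (first [left; reflexivity | right])];
  rewrite (e q) /= ?n0; [rewrite ?(fun_if (neval _)); cells | ].

Lemma clip_small x : x <= n.*2.+1 -> x %% (2 * n + 2) = x.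
Proof. by move=> h; rewrite modn_small // mul2n addn2 ltnS. Qed.

Lemma levels_eq q : q <= n -> wm 2 q = (if 0 < q then (wm 2 (q %/ 2)).+1 else 0) %% (2 * n + 2).
Proof.
move=> qn; word_eq p_levels q; last by rewrite addn1 ltnS.
by case: ifP => // q0; rewrite own_lt // ltn_Pdiv.
Qed.

Lemma levels_spec q : 0 < q -> q <= n -> wm 2 q = (trunc_log 2 q).+1.
Proof.
elim/ltn_ind: q => q IH q0 qn; rewrite levels_eq // q0.
have le : (trunc_log 2 q).+1 <= n.*2.+1.
  rewrite ltnS -addnn; apply: leq_trans (leq_addr _ _); apply: leq_trans qn.
  by apply: leq_trans (trunc_logP (isT : 1 < 2) q0); apply: ltnW; apply: ltn_expl.
case: (ltnP 1 q) => q1; last first.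
  have -> : q = 1 by lia.
  by rewrite levels_eq // mod0n trunc_log1 modn_small // addn2.
rewrite IH ?ltn_Pdiv ?divn_gt0 //; last by apply: leq_trans (leq_div _ _) qn.
by rewrite divn2 -trunc_log2S // clip_small.
Qed.

Lemma pow2_eq q : q <= n -> wm 3 q = (if 0 < q then wm 3 q.-1 * 2 else 1) %% (2 * n + 2).
Proof.
move=> qn; word_eq p_pow2 q; last by rewrite addn1 ltnS.
by case: ifP => // q0; rewrite own_lt // pred_lt.
Qed.

Lemma pow2_spec q : 2 ^ q <= n.*2 -> wm 3 q = 2 ^ q.
Proof.
elim: q => [|q IH] le; first by rewrite pow2_eq // expn0 clip_small.
have le' : 2 ^ q <= n by rewrite -leq_double -mul2n -expnS.
have qn : q < n by apply: leq_trans le'; apply: ltn_expl.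
rewrite pow2_eq // IH; first by rewrite mulnC -expnS clip_small // ltnW.
by rewrite -addnn; apply: leq_trans le' (leq_addr _ _).
Qed.

Lemma next_eq h v u : h < n -> v < n -> u < n -> 0 < h ->
  wm 4 ((h * n + v) * n + u) =
    if wt_le (wt_add (cell2 0 v u) (cell3 3 h.-1 u n.-1)) (cell3 3 h v n.-1) then u
    else (if 0 < (h * n + v) * n + u then wm 4 ((h * n + v) * n + u).-1 else 0) %% (2 * n + 2).
Proof.
move=> hn vn un h0; rewrite /cell2 /cell3; word_eq p_next ((h * n + v) * n + u); last by rewrite !code2_lt.
have q0 : 0 < (h * n + v) * n + u by rewrite addn_gt0 muln_gt0 addn_gt0 muln_gt0 h0 n_gt0.
case: ifP => _; first by rewrite clip_small // ltnW // ltnS -addnn (leq_trans (ltnW un)) // leq_addr.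
by rewrite q0 own_lt // pred_lt.
Qed.

Lemma last_eq h : h < n ->
  wm 5 h = if wt_le (cell3 3 (if 0 < h then wm 5 h.-1 else 0) (wm 0 1) n.-1) (cell3 3 h (wm 0 1) n.-1)
    then (if 0 < h then wm 5 h.-1 else 0) %% (2 * n + 2) else h.
Proof.
move=> hn; rewrite /cell3; word_eq p_last h; last by [].
have -> : (if h <= h.-1 then 0 else wm 5 h.-1) = (if 0 < h then wm 5 h.-1 else 0).
  by case: h hn => //= h _; rewrite ltnn.
by case: ifP => // _; rewrite clip_small // ltnW // ltnS -addnn (leq_trans (ltnW hn)) // leq_addr.
Qed.

Lemma path_eq p : p < n -> wm 6 p =
  (if 0 < p then wm 4 (((wm 5 n.-1 - p.-1) * n + wm 6 p.-1) * n + n.-1) else wm 0 1) %% (2 * n + 2).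
Proof.
move=> pn; word_eq p_path p; last by [].
by case: ifP => // p0; rewrite own_lt // pred_lt.
Qed.

Lemma rev_path_eq p : p < n -> wm 7 p = wm 6 (wm 5 n.-1 - p) %% (2 * n + 2).
Proof. by move=> pn; word_eq p_rev_path p. Qed.

Lemma mark_eq u v p : u < n -> v < n -> p < n ->
  wm 8 ((u * n + v) * n + p) =
    if [&& p < wm 5 n.-1, wm 6 p == u & wm 6 p.+1 == v] then 1
    else (if 0 < p then wm 8 ((u * n + v) * n + p.-1) else 0) %% (2 * n + 2).
Proof.
move=> un vn pn; word_eq p_mark ((u * n + v) * n + p); last by rewrite !code2_lt.
case: ifP => _; first by rewrite clip_small.
case: p pn => [|p] pn; first by rewrite (_ : 1 - (1 - 0) = 0) ?muln0.
by rewrite own_prev // addn_pred //= !subSS sub0n subn0 muln1.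
Qed.

Section Sides.
Variable o : bool.
Let P x := wm (if o then 7 else 6) x.
Let L := wm 5 n.-1.
Let N := wm 2 n.
Definition shift := if o then wm 3 N - 1 - L else 0.
Definition cell_end lam y := ((y + shift) %/ wm 3 lam).+1 * wm 3 lam - shift.
Definition detour_at x y := cell3 4 n (P x) (P y).
Local Notation DD := (cell2 (if o then 6 else 5)).
Local Notation FF := (cell2 (if o then 8 else 7)).

Lemma dist_eq x y : x < n -> y < n ->
  DD x y = cmin [:: (x == y, Some 0%R);
     (x < y, wt_add (DD x y.-1) (cell2 0 (P y.-1) (P y)))].
Proof.
by move=> xn yn; rewrite /P; case: o; [phase_eq (p_dist true) (x * n + y) | phase_eq (p_dist false) (x * n + y)];
  rewrite ?code2_lt // own_lt // ltn_add2l pred_lt // (leq_ltn_trans (leq0n x)).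
Qed.

Lemma from_eq i v : i < n -> v < n ->
  FF i v = cmin [:: (0 < i, FF i.-1 v); (true, wt_add (DD 0 i) (detour_at i v))].
Proof.
by move=> xn yn; rewrite /detour_at /P; case: o; [phase_eq (p_from true) (i * n + v) | phase_eq (p_from false) (i * n + v)];
  rewrite ?code2_lt // own_lt // code_lt2 // pred_lt.
Qed.

Lemma detwin_eq y u r : y < n -> u < n -> r < n ->
  cell3 (a_detwin o) y u r = cmin [:: (0 < r, cell3 (a_detwin o) y u r.-1);
   (n.-1 - r <= u, wt_add (detour_at y (n.-1 - r)) (DD (n.-1 - r) u))].
Proof.
by move=> yn un rn; rewrite /detour_at /P; case: o;
  [phase_eq (p_detwin true) ((y * n + u) * n + r) | phase_eq (p_detwin false) ((y * n + u) * n + r)];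
  rewrite ?code2_lt // own_prev // addn_pred.
Qed.

Definition cost (sw : bool) c v :=
  if sw then cell2 (if o then 7 else 8) (L - 1 - c) (L - v) else FF c v.

Lemma costwin_eq sw c u r : c < n -> u < n -> r < n ->
  cell3 (a_costwin o sw) c u r = cmin [:: (0 < r, cell3 (a_costwin o sw) c u r.-1);
   (n.-1 - r <= u, wt_add (cost sw c (n.-1 - r)) (DD (n.-1 - r) u))].
Proof.
by move=> cn un rn; rewrite /cost /L; case: o; case: sw;
 [ phase_eq (p_costwin true true) ((c * n + u) * n + r)
 | phase_eq (p_costwin true false) ((c * n + u) * n + r)
 | phase_eq (p_costwin false true) ((c * n + u) * n + r)
 | phase_eq (p_costwin false false) ((c * n + u) * n + r)];
  rewrite ?code2_lt // own_prev // addn_pred.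
Qed.

Lemma pivot_eq lam y k : lam < N -> y < n -> k < n ->
  cell3 (a_pivot o) lam y k = cmin [:: (0 < k, cell3 (a_pivot o) lam y k.-1);
   (cell_end lam y <= k, wt_add (DD (cell_end lam y) k) (detour_at y k))].
Proof.
by move=> lamN yn kn; rewrite /cell_end /shift /detour_at /P /L /N; case: o;
  [phase_eq (p_pivot true) ((lam * n + y) * n + k) | phase_eq (p_pivot false) ((lam * n + y) * n + k)];
  rewrite ?code2_lt // own_prev // addn_pred.
Qed.

Lemma one_eq i k j : i < n -> k < n -> j < n ->
  cell3 (a_one o) i k j = cmin [:: (0 < j, cell3 (a_one o) i k j.-1);
   (i < j, wt_add (cell3 (a_costwin o false) i j (n.-1 - i.+1)) (cost true k j));
   (i < j, wt_add (cost false i j) (cell3 (a_costwin o true) k j (n.-1 - i.+1)))].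
Proof.
by move=> lamN yn kn; rewrite /cost /L; case: o;
  [phase_eq (p_one true) ((i * n + k) * n + j) | phase_eq (p_one false) ((i * n + k) * n + j)];
  rewrite ?code2_lt // own_prev // addn_pred.
Qed.

Ltac quad_eq o sw p q :=
  case: o; case: sw; [phase_eq (p true true) q | phase_eq (p true false) q
                     | phase_eq (p false true) q | phase_eq (p false false) q].

Lemma hook_eq sw lam c y u : lam < N -> c < n -> y < n -> u < n ->
  cell4 (a_hook o sw) lam c y u = cmin [:: (0 < u, cell4 (a_hook o sw) lam c y u.-1);
    (cell_end lam y <= u,
       wt_add (cell3 (a_costwin o (~~ sw)) c u (n.-1 - cell_end lam y)) (detour_at y u));
    (cell_end lam y <= u,
       wt_add (cell3 (a_detwin o) y u (n.-1 - cell_end lam y)) (cost (~~ sw) c u))].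
Proof.
move=> lamN cn yn un; rewrite /cost /cell_end /shift /detour_at /P /L /N.
by quad_eq o sw p_hook (((lam * n + c) * n + y) * n + u);
  rewrite ?code2_lt // own_prev // addn_pred.
Qed.

Definition own_index sw (i k : nat) := if sw then k else i.


Definition in_cell lam i j := (i < j) && ((j + shift) %% wm 3 lam != 0).

Lemma hook_leak_eq sw lam i k j : lam < N -> i < n -> k < n -> j < n ->
  cell4 (quad o sw 24) lam i k j = cmin [:: (in_cell lam i j,
        wt_add (cell4 (quad o sw 24) lam i k j.-1) (DD j.-1 j));
     (i < j, cell4 (a_hook o sw) lam (own_index (~~ sw) i k) j k)].
Proof.
move=> lamN cn yn un; rewrite /in_cell /own_index /shift /L /N.
by quad_eq o sw p_hook_leak (((lam * n + i) * n + k) * n + j);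
  rewrite ?code2_lt //; (have j0 : 0 < j by lia); rewrite own_prev // addn_pred.
Qed.

Lemma pivot_leak_eq sw lam i k j : lam < N -> i < n -> k < n -> j < n ->
  cell4 (quad o sw 28) lam i k j = cmin [:: (in_cell lam i j,
        wt_add (cell4 (quad o sw 28) lam i k j.-1) (DD j.-1 j));
     (i < j, cell3 (a_pivot o) lam j k)].
Proof.
move=> lamN cn yn un; rewrite /in_cell /own_index /shift /L /N.
by quad_eq o sw p_pivot_leak (((lam * n + i) * n + k) * n + j);
  rewrite ?code2_lt //; (have j0 : 0 < j by lia); rewrite own_prev // addn_pred.
Qed.

Lemma hook_enter_eq sw lam i k j : lam < N -> i < n -> k < n -> j < n ->
  cell4 (quad o sw 32) lam i k j = cmin [:: (in_cell lam i j, cell4 (quad o sw 32) lam i k j.-1);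
     (i < j, wt_add (cell3 (a_costwin o sw) (own_index sw i k) j (n.-1 - i.+1))
                    (cell4 (a_hook o sw) lam (own_index (~~ sw) i k) j k));
     (i < j, wt_add (cost sw (own_index sw i k) j) (cell4 (quad o sw 24) lam i k j))].
Proof.
move=> lamN cn yn un; rewrite /in_cell /own_index /cost /shift /L /N.
by quad_eq o sw p_hook_enter (((lam * n + i) * n + k) * n + j);
  rewrite ?code2_lt //; (have j0 : 0 < j by lia); rewrite own_prev // addn_pred.
Qed.

Lemma pivot_enter_eq sw lam i k j : lam < N -> i < n -> k < n -> j < n ->
  cell4 (quad o sw 36) lam i k j = cmin [:: (in_cell lam i j, cell4 (quad o sw 36) lam i k j.-1);
     (i < j, wt_add (cell3 (a_costwin o sw) (own_index sw i k) j (n.-1 - i.+1))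
                    (cell3 (a_pivot o) lam j k));
     (i < j, wt_add (cost sw (own_index sw i k) j) (cell4 (quad o sw 28) lam i k j))].
Proof.
move=> lamN cn yn un; rewrite /in_cell /own_index /cost /shift /L /N.
by quad_eq o sw p_pivot_enter (((lam * n + i) * n + k) * n + j);
  rewrite ?code2_lt //; (have j0 : 0 < j by lia); rewrite own_prev // addn_pred.
Qed.

Lemma cross_eq sw lam i k j : lam < N -> i < n -> k < n -> j < n ->
  cell4 (a_cross o sw) lam i k j = cmin [:: (0 < lam, cell4 (a_cross o sw) lam.-1 i k j);
     (true, cell4 (quad o sw 32) lam i k j);
     (cell_end lam j <= k, wt_add (cell4 (quad o sw 36) lam i k j)
        (cell3 (a_costwin o (~~ sw)) (own_index (~~ sw) i k) (cell_end lam j) (n.-1 - j.+1)))].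
Proof.
move=> lamN cn yn un; rewrite /cell_end /own_index /shift /L /N.
by quad_eq o sw p_cross (((lam * n + i) * n + k) * n + j);
  rewrite ?code2_lt // own_lt // !code_lt2 // pred_lt.
Qed.

End Sides.

Lemma direct_eq i r : i < n -> r < n ->
  cell2 19 i r = cmin [:: (0 < r, cell2 19 i r.-1);
    (n.-1 - r <= wm 5 n.-1, wt_add (cell2 7 i (n.-1 - r)) (cell2 5 (n.-1 - r) (wm 5 n.-1)))].
Proof.
by move=> un rn; phase_eq p_direct (i * n + r);
  rewrite ?code2_lt // own_prev // addn_pred.
Qed.

Lemma answer_eq a b c : a < n -> b < n -> c < n ->
  let i := minn (minn a b) c in let k := maxn (maxn a b) c in let j := a + b + c - i - k in
  let L := wm 5 n.-1 in let N := wm 2 n in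
  cell3 1 a b c = cmin
    [:: (true, cell2 19 i (n.-1 - k.+1)); (true, cell3 (a_one false) i k j);
        (true, cell3 (a_one true) (L - 1 - k) (L - 1 - i) (L - 1 - j));
        (true, cell4 (a_cross false false) (N - 1) i k j);
        (true, cell4 (a_cross false true) (N - 1) i k j);
        (true, cell4 (a_cross true false) (N - 1) (L - 1 - k) (L - 1 - i) (L - 1 - j));
        (true, cell4 (a_cross true true) (N - 1) (L - 1 - k) (L - 1 - i) (L - 1 - j))].
Proof.
move=> an bn cn i k j L N.
have minE x y : x - (x - y) = minn x y by lia.
have maxE x y : x + (y - x) = maxn x y by lia.
rewrite /i /j /k /L /N; phase_eq p_answer ((a * n + b) * n + c); last by rewrite !code2_lt.
all: by rewrite ?subn1 ?minE ?maxE.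
Qed.

End Equations.

Lemma sort3 a b c :
  let i := minn (minn a b) c in let k := maxn (maxn a b) c in let j := a + b + c - i - k in
  [/\ i <= j, j <= k & perm_eq [:: a; b; c] [:: i; j; k]].
Proof.
move=> i k j.
have ijk x y z : x <= y -> y <= z -> i = x -> k = z -> a + b + c = x + y + z ->
    perm_eq [:: a; b; c] [:: x; y; z] -> [/\ i <= j, j <= k & perm_eq [:: a; b; c] [:: i; j; k]].
  move=> xy yz ix kz e; have -> : j = y by rewrite /j ix kz e; lia.
  by rewrite ix kz.
rewrite /j /k /i in ijk *; clear j k i.
case: (boolP (a <= b)) => ab; case: (boolP (b <= c)) => bc; case: (boolP (a <= c)) => ac; try (exfalso; lia).
- by apply: (ijk a b c); rewrite // ; lia.
- by apply: (ijk a c b); rewrite //; try lia; apply/permP => Q /=; lia.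
- by apply: (ijk c a b); rewrite //; try lia; apply/permP => Q /=; lia.
- by apply: (ijk b a c); rewrite //; try lia; apply/permP => Q /=; lia.
- by apply: (ijk b c a); rewrite //; try lia; apply/permP => Q /=; lia.
- by apply: (ijk c b a); rewrite //; try lia; apply/permP => Q /=; lia.
Qed.

(** * Correctness and running time *)

Section FinalMemory.
Variables (R : realDomainType) (n : nat) (G : wgraph R n) (s t : 'I_n).
Variables (wm : nat -> nat -> nat) (vm : nat -> nat -> option R).
Hypotheses (n0 : wm 0 0 = n) (s0 : wm 0 1 = s) (t0 : wm 0 2 = t).
Hypothesis v0 : forall i, vm 0 i = input_weight G i.
Hypothesis E : phases_eqn phases wm vm.
Hypothesis uniqG : unique_shortest_paths G.

Local Notation t2 := (cell2 vm n).
Local Notation t3 := (cell3 vm n).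
Local Notation t4 := (cell4 vm n).
Local Notation L := (wm 5 n.-1).
Local Notation N := (wm 2 n).

Let n_gt0 : 0 < n. Proof. exact: leq_ltn_trans (ltn_ord s). Qed.

Lemma edge_weightE (u v : 'I_n) : t2 0 u v = if adj G u v then Some (weight G [set u; v]) else None.
Proof.
rewrite /cell2 v0 /input_weight coord_div // coord_mod //.
have insubE (x : 'I_n) : insub (x : nat) = Some x by rewrite valK.
by rewrite !insubE.
Qed.

Lemma last_le h : h < n -> wm 5 h <= h.
Proof.
elim: h => [|h IH] hn; rewrite (last_eq n0 E) //=.
  by rewrite wt_le_refl mod0n.
by case: ifP => // _; apply: leq_trans (leq_mod _ _) _; apply: leqW; apply: IH; apply: ltnW.
Qed.

Lemma clip_lt_n x : x < n -> x %% (2 * n + 2) = x.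
Proof. by move=> xn; rewrite modn_small //; lia. Qed.

Lemma next_small h v u : 0 < h -> h < n -> v < n -> u < n ->
  wm 4 ((h * n + v) * n + u) < 2 * n + 2.
Proof.
move=> h0 hn vn un; rewrite (next_eq n0 E n_gt0) //; case: ifP => _; first by lia.
by rewrite ltn_mod addn2.
Qed.

Lemma computed_path p : shortest_path G s t p ->
  size p = L /\ forall i, i <= L -> wm 6 i = vertex s p i.
Proof.
move=> sp; apply: (@traced_path _ _ G s t (t2 0) (fun h v u => t3 3 h v u) (wm 5)
   (fun h v u => wm 4 ((h * n + v) * n + u)) (wm 6) _ _ _ _ _ _ _ _ p uniqG sp) => //.
- exact: edge_weightE.
- by move=> h v u hn vn un; rewrite (hops_eq n0 E) // t0.
- by apply/eqP; rewrite -leqn0; apply: last_le.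
- move=> h hn; rewrite (last_eq n0 E) // s0 /=; case: ifP => // _.
  by rewrite clip_lt_n // (leq_ltn_trans (last_le (ltnW hn))) // ltnW.
- by move=> h v u h0 hn vn un c; rewrite (next_eq n0 E n_gt0) // c.
- move=> h v u h0 hn vn un /negPf c; rewrite (next_eq n0 E n_gt0) // c.
  rewrite addnS /= modn_small // next_small //; exact: ltnW.
- by rewrite (path_eq n0 E) //= s0 clip_lt_n.
- move=> m mn mL vn; rewrite (path_eq n0 E) //= modn_small // next_small //.
  + by rewrite subn_gt0.
  + by apply: leq_ltn_trans (leq_subr _ _) _; apply: leq_ltn_trans (last_le _) _; rewrite prednK.
  + by rewrite prednK.
Qed.

Lemma levels_gt : n < 2 ^ N.
Proof. by rewrite (levels_spec n0 E) //; apply: trunc_log_ltn. Qed.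

Lemma levels_gt0 : 0 < N.
Proof. by rewrite (levels_spec n0 E). Qed.

Lemma pow2E lam : lam <= N -> wm 3 lam = 2 ^ lam.
Proof.
move=> lamN; apply: (pow2_spec n0 E); apply: leq_trans (_ : 2 ^ N <= _).
  by rewrite leq_exp2l.
rewrite (levels_spec n0 E) // expnS mul2n leq_double; exact: trunc_logP.
Qed.

Lemma mark_spec u v p : u < n -> v < n -> p < n ->
  wm 8 ((u * n + v) * n + p) =
    has (fun m => [&& m < L, wm 6 m == u & wm 6 m.+1 == v]) (iota 0 p.+1).
Proof.
move=> un vn; elim: p => [|p IH] pn; rewrite (mark_eq n0 E) //.
  by rewrite /= orbF mod0n; case: ifP.
have -> : iota 0 p.+2 = rcons (iota 0 p.+1) p.+1 by rewrite -[p.+2]addn1 iotaD cats1 add0n.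
rewrite has_rcons; case: [&& _, _ & _]; first by [].
rewrite orFb ltn0Sn [p.+1.-1]/= IH ?(ltnW pn) // modn_small //.
by case: has; rewrite // addn2.
Qed.

Section WithPath.
Variable p : seq 'I_n.
Hypothesis short_p : shortest_path G s t p.

Local Notation vtx := (vertex s p).
Local Notation sig := (prefix_length G s p).
Local Notation off := (off_path G s p).

Let sizeL : size p = L. Proof. by case: (computed_path short_p). Qed.
Let vtxE i : i <= L -> wm 6 i = vtx i. Proof. by case: (computed_path short_p) => _; apply. Qed.
Let L_n : L < n. Proof. by apply: leq_ltn_trans (last_le _) _; rewrite prednK. Qed.
Let L_N : L < 2 ^ N. Proof. exact: ltn_trans levels_gt. Qed.

Lemma unmarkedE (u v : 'I_n) :
  (wm 8 ((u * n + v) * n + n.-1) + wm 8 ((v * n + u) * n + n.-1) == 0) =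
  ([set u; v] \notin path_edges s p).
Proof.
have n1 : n.-1 < n by rewrite prednK.
rewrite !mark_spec // addn_eq0 !eqb0 -negb_or; congr (~~ _).
have hasE (a b : 'I_n) : reflect (exists2 m, m < L & a = vtx m /\ b = vtx m.+1)
    (has (fun m => [&& m < L, wm 6 m == a & wm 6 m.+1 == b]) (iota 0 n.-1.+1)).
  apply: (iffP hasP) => [[m _ /and3P[mL /eqP h1 /eqP h2]]|[m mL [-> ->]]]; exists m => //.
  - by split; apply: val_inj; rewrite /= -vtxE // ltnW.
  - by rewrite mem_iota /= add0n prednK // (ltn_trans mL).
  - by rewrite mL !vtxE // ?eqxx // ltnW.
apply/orP/mem_path_edges => [[/hasE|/hasE]|].
- by case=> m mL [-> ->]; exists m; rewrite ?sizeL.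
- by case=> m mL [-> ->]; exists m; rewrite ?sizeL // setUC.
- case=> m; rewrite sizeL => mL Ee.
  have : u \in path_edge s p m by rewrite -Ee !inE eqxx.
  have : v \in path_edge s p m by rewrite -Ee !inE eqxx orbT.
  have : vtx m \in [set u; v] by rewrite Ee !inE eqxx.
  have : vtx m.+1 \in [set u; v] by rewrite Ee !inE eqxx orbT.
  have ne : vtx m <> vtx m.+1.
    by move=> h; have := vertex_inj short_p _ _ h; rewrite sizeL => /(_ (ltnW mL) mL); lia.
  rewrite !inE => /orP[]/eqP h1 /orP[]/eqP h2 _ _; try by rewrite h1 h2 in ne.
  + by right; apply/hasE; exists m.
  + by left; apply/hasE; exists m.
Qed.

Lemma detour_ub (u v : 'I_n) l : ub (t3 4 n u v) l <-> walk off u v l.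
Proof.
pose W1 u v := if wm 8 ((u * n + v) * n + n.-1) + wm 8 ((v * n + u) * n + n.-1) == 0
  then t2 0 u v else None.
apply: (@floyd_warshall _ _ off W1 (fun k u v => t3 4 k u v)).
  move=> x y; rewrite /W1 unmarkedE adj_del inE edge_weightE.
  by case: (_ \notin _).
move=> k x y kn xn yn; rewrite (detour_eq n0 E n_gt0) // /W1.
by case: (k == 0); case: (_ == 0) => //=; rewrite /cmin /= /tmin /=; case: (x == y).
Qed.

Lemma path_weight m : m < L -> t2 0 (wm 6 m) (wm 6 m.+1) = Some (sig m.+1 - sig m)%R.
Proof.
move=> mL; rewrite !vtxE // ?edge_weightE; last exact: ltnW.
by rewrite (adj_vertex short_p) ?sizeL // prefix_lengthS ?sizeL.
Qed.

Section Orientation.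
Variable o : bool.

Definition mirror x := if o then L - x else x.
Definition osig x := (if o then sig L - sig (L - x) else sig x)%R.
Definition oH := detour_at wm vm n o.
Local Notation shift := (shift wm n o).

Lemma oposE x : x <= L -> wm (if o then 7 else 6) x = vtx (mirror x).
Proof.
rewrite /mirror; case: o => xL; last exact: vtxE.
rewrite (rev_path_eq n0 E); last by apply: leq_ltn_trans L_n.
by rewrite vtxE ?leq_subr // clip_lt_n.
Qed.

Lemma oH_ub x y l : x <= L -> y <= L ->
  ub (oH x y) l <-> walk off (vtx (mirror x)) (vtx (mirror y)) l.
Proof. by move=> xL yL; rewrite /oH /detour_at !oposE //; apply: detour_ub. Qed.

Lemma osig_mono x y : x <= y -> y <= L -> (osig x <= osig y)%R.
Proof.
rewrite /osig; case: o => xy yL; last by apply: (prefix_length_mono short_p); rewrite ?sizeL.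
rewrite lerD2l lerN2; apply: (prefix_length_mono short_p); rewrite ?sizeL ?leq_subr //; lia.
Qed.

Lemma odist x y : x <= y -> y <= L -> t2 (if o then 6 else 5) x y = Some (osig y - osig x)%R.
Proof.
elim: y => [|y IH] xy yL.
  move: xy; rewrite leqn0 => /eqP->; rewrite (dist_eq n0 E) // eqxx ltnn subrr.
  by [].
have yn : y.+1 < n by apply: leq_ltn_trans L_n.
rewrite (dist_eq n0 E) //; last by apply: leq_ltn_trans xy yn.
move: xy; rewrite leq_eqVlt => /predU1P[->|xy]; first by rewrite eqxx ltnn subrr.
rewrite xy ltn_eqF // /cmin /= IH ?(ltnW yL) //.
have -> : t2 0 (wm (if o then 7 else 6) y) (wm (if o then 7 else 6) y.+1) =
    Some (osig y.+1 - osig y)%R.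
  rewrite !oposE ?(ltnW yL) // /mirror /osig; case: o.
    have Ey : L - y = (L - y.+1).+1 by rewrite -subSn.
    have := @path_weight (L - y.+1); rewrite -Ey !vtxE ?leq_subr // => h.
    rewrite edge_weightE adjC setUC -edge_weightE h //.
    by congr Some; move: (sig L) (sig (L - y)) (sig (L - y.+1)) => a b c; ring.
  by rewrite -!vtxE ?(ltnW yL) // path_weight.
by rewrite /tmin /=; congr Some; move: (osig y.+1) (osig y) (osig x) => a b c; ring.
Qed.

Lemma ofrom_ub i v l : i <= L -> v <= L -> ub (t2 (if o then 8 else 7) i v) l <->
  exists x h, [/\ x <= i, ub (oH x v) h & (osig x - osig 0 + h <= l)%R].
Proof.
move=> iL vL; have TE q : q < L.+1 -> t2 (if o then 8 else 7) q v =
   cmin ((0 < q, t2 (if o then 8 else 7) q.-1 v) ::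
     [:: (true, wt_add (t2 (if o then 6 else 5) 0 q) (oH q v))]).
  by move=> qL; rewrite (from_eq n0 E) //; lia.
rewrite (running_min l TE) //; split.
- case=> q qi; rewrite ub_cmin /= orbF odist //; last by lia.
  case/ub_add=> l1 [l2 [h1 h2 h3]]; exists q, l2; split=> //.
  by apply: le_trans h3; rewrite lerD2r.
- case=> x [h [xi hx le]]; exists x => //; rewrite ub_cmin /= orbF odist //; last by lia.
  by apply/ub_add; exists (osig x - osig 0)%R, h; rewrite /ub /= lexx.
Qed.

Local Notation ocost := (cost wm vm n o).
Local Notation ogap x y := (`|osig x - osig y|)%R.

Lemma cell_endE lam y : lam < N -> cell_end wm n o lam y = block_end shift lam y.
Proof. by move=> lamN; rewrite /cell_end /block_end pow2E // ltnW. Qed.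

Lemma in_cellE lam i j : lam < N ->
  in_cell wm n o lam i j = (i < j) && ((j + shift) %% 2 ^ lam != 0).
Proof. by move=> lamN; rewrite /in_cell pow2E // ltnW. Qed.

Lemma own_index_lt sw i k : i < n -> k < n -> own_index sw i k < n.
Proof. by case: sw. Qed.

Lemma ocostwin sw c u r : c < n -> u < n -> r < n ->
  t3 (a_costwin o sw) c u r = cmin [:: (0 < r, t3 (a_costwin o sw) c u r.-1);
   (n.-1 - r <= u, wt_add (ocost sw c (n.-1 - r)) (t2 (if o then 6 else 5) (n.-1 - r) u))].
Proof. by move=> *; rewrite (costwin_eq n0 E). Qed.

Lemma one_ub i k j l : i < n -> k < n -> j <= L ->
  ub (t3 (a_one o) i k j) l <-> exists y y' x x', [/\ i < y <= j, i < y' <= j,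
     ub (ocost false i y) x, ub (ocost true k y') x' & (x + ogap y y' + x' <= l)%R].
Proof.
move=> i_n k_n jL; have TE q : q < L.+1 -> t3 (a_one o) i k q =
  cmin ((0 < q, t3 (a_one o) i k q.-1) :: [::
   (i < q, wt_add (t3 (a_costwin o false) i q (n.-1 - i.+1)) (ocost true k q));
   (i < q, wt_add (ocost false i q) (t3 (a_costwin o true) k q (n.-1 - i.+1)))]).
  by move=> qL; rewrite (one_eq n0 E) //; lia.
have win sw c q l' : c < n -> i < q -> q <= L -> ub (t3 (a_costwin o sw) c q (n.-1 - i.+1)) l' <->
  exists w x, [/\ i < w, w <= q, ub (ocost sw c w) x & (x + (osig q - osig w) <= l')%R].
  by move=> cn iq qL; apply: (window_ub L_n odist _ (@ocostwin sw)) => //; lia.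
rewrite (running_min l TE) //; split.
- case=> q qj; rewrite ub_cmin /= orbF -andb_orr => /andP[iq].
  have qL : q <= L by apply: leq_trans jL.
  case/orP=> /ub_add[x [x' [h1 h2 h3]]].
    case/(win _ _ _ _ i_n iq qL): h1 => w [x0 [iw wq hx le]].
    exists w, q, x0, x'; split=> //; [lia | lia |].
    by rewrite absR_le ?osig_mono //; lra.
  case/(win _ _ _ _ k_n iq qL): h2 => w [x0 [iw wq hx le]].
  exists q, w, x, x0; split=> //; [lia | lia |].
  by rewrite absR_ge ?osig_mono //; lra.
- case=> y [y' [x [x' [/andP[iy yj] /andP[iy' yj'] hx hx' le]]]].
  case: (leqP y y') => yy.
    exists y' => //; rewrite ub_cmin /= orbF -andb_orr iy' /=; apply/orP; left.
    have yL : y' <= L by apply: leq_trans jL.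
    apply/ub_add; exists (x + (osig y' - osig y))%R, x'; split=> //.
      by apply/(win _ _ _ _ i_n iy' yL); exists y, x.
    by rewrite absR_le ?osig_mono // in le.
  exists y => //; rewrite ub_cmin /= orbF -andb_orr iy /=; apply/orP; right.
  have yL : y <= L by apply: leq_trans jL.
  apply/ub_add; exists x, (x' + (osig y - osig y'))%R; split=> //.
    by apply/(win _ _ _ _ k_n iy yL); exists y', x'; split=> //; apply: ltnW.
  rewrite absR_ge ?osig_mono // in le; last exact: ltnW.
  by lra.
Qed.

Section Sw.
Variable sw : bool.

Let RHOE lam y k : lam < N -> y < n -> k < n ->
  t3 (a_pivot o) lam y k = cmin [:: (0 < k, t3 (a_pivot o) lam y k.-1);
     (block_end shift lam y <= k,
      wt_add (t2 (if o then 6 else 5) (block_end shift lam y) k) (oH y k))].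
Proof. by move=> *; rewrite (pivot_eq n0 E) // cell_endE. Qed.

Let HXE c u r : c < n -> u < n -> r < n ->
  t3 (a_detwin o) c u r = cmin [:: (0 < r, t3 (a_detwin o) c u r.-1);
     (n.-1 - r <= u, wt_add (oH c (n.-1 - r)) (t2 (if o then 6 else 5) (n.-1 - r) u))].
Proof. by move=> *; rewrite (detwin_eq n0 E). Qed.

Let PHIE lam c y u : lam < N -> c < n -> y < n -> u < n ->
  t4 (a_hook o sw) lam c y u = cmin [:: (0 < u, t4 (a_hook o sw) lam c y u.-1);
    (block_end shift lam y <= u,
       wt_add (t3 (a_costwin o (~~ sw)) c u (n.-1 - block_end shift lam y)) (oH y u));
    (block_end shift lam y <= u,
       wt_add (t3 (a_detwin o) y u (n.-1 - block_end shift lam y)) (ocost (~~ sw) c u))].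
Proof. by move=> *; rewrite (hook_eq n0 E) // cell_endE. Qed.

Let XPE lam i k j : lam < N -> i < n -> k < n -> j < n ->
  t4 (quad o sw 24) lam i k j = cmin [:: ((i < j) && ((j + shift) %% 2 ^ lam != 0),
        wt_add (t4 (quad o sw 24) lam i k j.-1) (t2 (if o then 6 else 5) j.-1 j));
     (i < j, t4 (a_hook o sw) lam (own_index (~~ sw) i k) j k)].
Proof. by move=> *; rewrite (hook_leak_eq n0 E n_gt0) // in_cellE. Qed.

Let XRE lam i k j : lam < N -> i < n -> k < n -> j < n ->
  t4 (quad o sw 28) lam i k j = cmin [:: ((i < j) && ((j + shift) %% 2 ^ lam != 0),
        wt_add (t4 (quad o sw 28) lam i k j.-1) (t2 (if o then 6 else 5) j.-1 j));
     (i < j, t3 (a_pivot o) lam j k)].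
Proof. by move=> *; rewrite (pivot_leak_eq n0 E n_gt0) // in_cellE. Qed.

Let VPE lam i k j : lam < N -> i < n -> k < n -> j < n ->
  t4 (quad o sw 32) lam i k j = cmin [:: ((i < j) && ((j + shift) %% 2 ^ lam != 0),
        t4 (quad o sw 32) lam i k j.-1);
     (i < j, wt_add (t3 (a_costwin o sw) (own_index sw i k) j (n.-1 - i.+1))
                    (t4 (a_hook o sw) lam (own_index (~~ sw) i k) j k));
     (i < j, wt_add (ocost sw (own_index sw i k) j) (t4 (quad o sw 24) lam i k j))].
Proof. by move=> *; rewrite (hook_enter_eq n0 E n_gt0) // in_cellE. Qed.

Let VRE lam i k j : lam < N -> i < n -> k < n -> j < n ->
  t4 (quad o sw 36) lam i k j = cmin [:: ((i < j) && ((j + shift) %% 2 ^ lam != 0),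
        t4 (quad o sw 36) lam i k j.-1);
     (i < j, wt_add (t3 (a_costwin o sw) (own_index sw i k) j (n.-1 - i.+1))
                    (t3 (a_pivot o) lam j k));
     (i < j, wt_add (ocost sw (own_index sw i k) j) (t4 (quad o sw 28) lam i k j))].
Proof. by move=> *; rewrite (pivot_enter_eq n0 E n_gt0) // in_cellE. Qed.

Let RESE lam i k j : lam < N -> i < n -> k < n -> j < n ->
  t4 (a_cross o sw) lam i k j = cmin [:: (0 < lam, t4 (a_cross o sw) lam.-1 i k j);
     (true, t4 (quad o sw 32) lam i k j);
     (block_end shift lam j <= k, wt_add (t4 (quad o sw 36) lam i k j)
        (t3 (a_costwin o (~~ sw)) (own_index (~~ sw) i k) (block_end shift lam j) (n.-1 - j.+1)))].
Proof. by move=> *; rewrite (cross_eq n0 E) // cell_endE. Qed.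

Lemma cross_sound i k j l : i < n -> k <= L -> j <= k ->
  ub (t4 (a_cross o sw) N.-1 i k j) l ->
  crossing osig oH (ocost sw (own_index sw i k)) (ocost (~~ sw) (own_index (~~ sw) i k)) i k j l.
Proof.
apply: (RES_sound L_n osig_mono odist (@ocostwin sw) (@ocostwin (~~ sw)) HXE RHOE PHIE XPE XRE VPE VRE RESE
   (@own_index_lt sw) (@own_index_lt (~~ sw))).
by rewrite prednK // levels_gt0.
Qed.

Lemma cross_complete lam i k j l y y' w w' xa xh xb :
  lam < N -> i < n -> k <= L -> j < k ->
  [/\ i < y <= j, i < y' <= j, j < w <= k & j < w' <= k] ->
  same_block shift lam y' j -> block_end shift lam j <= w ->
  ub (ocost sw (own_index sw i k) y) xa -> ub (oH y' w) xh ->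
  ub (ocost (~~ sw) (own_index (~~ sw) i k) w') xb ->
  (xa + ogap y y' + xh + ogap w w' + xb <= l)%R ->
  ub (t4 (a_cross o sw) N.-1 i k j) l.
Proof.
exact: (RES_complete L_n osig_mono odist (@ocostwin sw) (@ocostwin (~~ sw)) HXE RHOE PHIE XPE XRE VPE VRE RESE
   (@own_index_lt sw) (@own_index_lt (~~ sw))).
Qed.

End Sw.
End Orientation.

Local Notation H := (oH false).
Local Notation f := (t2 7).
Local Notation g := (cost wm vm n false true).
Local Notation gap x y := (`|sig x - sig y|)%R.

Lemma detour_mirror x y l : x <= L -> y <= L ->
  ub (oH true (L - x) (L - y)) l <-> ub (H x y) l.
Proof.
move=> xL yL; rewrite (@oH_ub true) ?leq_subr // (@oH_ub false) //.
by rewrite /mirror !subKn.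
Qed.

Lemma detour_sym x y l : x <= L -> y <= L -> ub (H x y) l -> ub (H y x) l.
Proof.
by move=> xL yL; rewrite !(@oH_ub false) //; apply: walk_sym.
Qed.

Lemma osig_mirror x : x <= L -> osig true (L - x) = (sig L - sig x)%R.
Proof. by move=> xL; rewrite /osig subKn. Qed.

Lemma f_ub i v l : i < L -> v <= L -> ub (f i v) l <->
  exists x h, [/\ x <= i, ub (H x v) h & (sig x - sig 0 + h <= l)%R].
Proof. by move=> iL vL; apply: (@ofrom_ub false) => //; apply: ltnW. Qed.

Lemma g_ub k v l : k < L -> v <= L -> ub (g k v) l <->
  exists z h, [/\ k < z <= L, ub (H v z) h & (h + (sig L - sig z) <= l)%R].
Proof.
move=> kL vL; rewrite /cost (@ofrom_ub true) ?leq_subr //; last by lia.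
split=> [[x [h [xk hx le]]]|[z [h [kz hz le]]]].
- have xL : x <= L by lia.
  exists (L - x), h; split; first by lia.
    apply: detour_sym; rewrite ?leq_subr //; apply/detour_mirror; rewrite ?leq_subr //.
    by rewrite subKn.
  move: le; rewrite /osig subn0; move: (sig L) (sig (L - x)) => a b; lra.
- have zL : z <= L by lia.
  exists (L - z), h; split; first by lia.
    by apply/detour_mirror => //; apply: detour_sym.
  by move: le; rewrite osig_mirror // /osig subn0; move: (sig L) (sig z) => a b; lra.
Qed.

Lemma direct_ub i k l : i < n -> k < L ->
  ub (t2 19 i (n.-1 - k.+1)) l <-> exists z x,
    [/\ k < z <= L, ub (f i z) x & (x + (sig L - sig z) <= l)%R].
Proof.
move=> i_n kL; have TE q : q < n -> t2 19 i q = cmin ((0 < q, t2 19 i q.-1) ::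
    [:: (n.-1 - q <= L, wt_add (f i (n.-1 - q)) (t2 5 (n.-1 - q) L))]).
  by move=> qn; rewrite (direct_eq n0 E).
rewrite (running_min l TE); last by lia.
split.
- case=> q qk; rewrite ub_cmin /= orbF => /andP[qL /ub_add[x [x' [h1 h2 h3]]]].
  exists (n.-1 - q), x; split=> //; first by lia.
  by rewrite (@odist false) // in h2; apply: le_trans h3; rewrite lerD2l.
- case=> z [x [kz hx le]]; exists (n.-1 - z); first by lia.
  have Ez : n.-1 - (n.-1 - z) = z by lia.
  have zL : z <= L by lia.
  rewrite ub_cmin /= orbF Ez zL; apply/ub_add; exists x, (sig L - sig z)%R.
  by rewrite (@odist false) // /ub /= lexx.
Qed.

Section Sorted.
Variables i j k : nat.
Hypotheses (ij : i <= j) (jk : j <= k) (kL : k < L).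

Definition end_cost (sw : bool) v := if sw then g k v else f i v.

Lemma mirror_cost sw v : v <= L ->
  cost wm vm n true sw (own_index sw (L - 1 - k) (L - 1 - i)) (L - v) = end_cost (~~ sw) v.
Proof.
move=> vL; rewrite /end_cost /cost; case: sw => /=; last by [].
have -> : L - 1 - (L - 1 - i) = i by lia.
by rewrite subKn.
Qed.

Lemma crossing_ub sw l :
  crossing sig H (end_cost sw) (end_cost (~~ sw)) i k j l <->
  ub (t4 (a_cross false sw) N.-1 i k j) l \/
  ub (t4 (a_cross true sw) N.-1 (L - 1 - k) (L - 1 - i) (L - 1 - j)) l.
Proof.
have i_n : i < n by lia.
have i_n' : L - 1 - k < n by lia.
have costE sw' v : cost wm vm n false sw' (own_index sw' i k) v = end_cost sw' v by case: sw'.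
split.
- case=> y [y' [w [w' [[hy hy' hw hw'] [xa [xh [xb [ha hh hb le]]]]]]]].
  have [wL w'L y'L yL] : [/\ w <= L, w' <= L, y' <= L & y <= L] by split; lia.
  have [|||lam lamN [[sb be]|[ylt we]]] := @lattice_split N y' j w; try lia.
  + left; apply: (@cross_complete false sw lam i k j l y y' w w' xa xh xb) => //; try lia.
    * by rewrite costE.
    * by rewrite costE.
  + right; have [||||| sb be] := @lattice_split_mirror N L y' j w lam _ _ _ _ _ ylt we; try lia.
    have Ej : L - j.+1 = L - 1 - j by lia.
    have Es : shift wm n true = (2 ^ N).-1 - L by rewrite /shift pow2E // subn1.
    rewrite Ej in sb be.
    apply: (@cross_complete true sw lam _ _ _ l (L - w') (L - w) (L - y') (L - y) xb xh xa) => //; try lia.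
    * by split; lia.
    * by rewrite Es.
    * by rewrite Es.
    * by rewrite mirror_cost.
    * by apply/detour_mirror => //; apply: detour_sym.
    * by rewrite mirror_cost // negbK.
    * rewrite !osig_mirror //; move: le.
      have norm2 (a b c : R) : (`|(c - a) - (c - b)| = `|b - a|)%R.
        by congr (`|_|)%R; ring.
      rewrite !norm2; move: (gap y y') (gap w w') => u v; lra.
- case=> [h|h].
  + have := @cross_sound false sw i k j l i_n (ltnW kL) jk h.
    case=> y [y' [w [w' [hy [xa [xh [xb [ha hh hb le]]]]]]]].
    exists y, y', w, w'; split=> //; exists xa, xh, xb; split=> //.
    * by rewrite -costE.
    * by rewrite -costE.
  + have [||y [y' [w [w' [[hy hy' hw hw'] [xa [xh [xb [ha hh hb le]]]]]]]]] :=
      @cross_sound true sw _ _ _ l i_n' _ _ h; try lia.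
    have [wL w'L y'L yL] : [/\ w <= L, w' <= L, y' <= L & y <= L] by split; lia.
    exists (L - w'), (L - w), (L - y'), (L - y); split; first by split; lia.
    exists xb, xh, xa; split.
    * by rewrite -[sw]negbK -mirror_cost ?leq_subr // subKn.
    * apply: detour_sym; rewrite ?leq_subr //; apply/detour_mirror; rewrite ?leq_subr //.
      by rewrite !subKn.
    * by rewrite -mirror_cost ?leq_subr // subKn.
    * move: le; rewrite /osig.
      have norm2 (a b c : R) : (`|(c - a) - (c - b)| = `|b - a|)%R.
        by congr (`|_|)%R; ring.
      rewrite !norm2; move: (gap _ _) (gap _ _) => u v; lra.
Qed.

Lemma one_interval_ub l :
  (exists b y y' x x', [/\ inner i j k b y, inner i j k b y', ub (f i y) x, ub (g k y') x' &
      (x + gap y y' + x' <= l)%R]) <->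
  ub (t3 (a_one false) i k j) l \/
  ub (t3 (a_one true) (L - 1 - k) (L - 1 - i) (L - 1 - j)) l.
Proof.
have i_n : i < n by lia.
have k_n : k < n by lia.
have i_n' : L - 1 - k < n by lia.
have k_n' : L - 1 - i < n by lia.
have jL : j <= L by lia.
have jL' : L - 1 - j <= L by lia.
rewrite (@one_ub false) // (@one_ub true) //; split.
- case=> -[] [y [y' [x [x' [/= hy hy' hx hx' le]]]]].
    by left; exists y, y', x, x'.
  have [y'L yL] : y' <= L /\ y <= L by lia.
  right; exists (L - y'), (L - y), x', x; split; try lia.
  + by rewrite !subKn //; lia.
  + move: le; rewrite /osig !subKn //.
    have -> : (`|(sig L - sig y') - (sig L - sig y)| = gap y y')%R.
      by congr (`|_|)%R; move: (sig L) (sig y) (sig y') => a b c; ring.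
    by move: (gap y y') => u; lra.
- case=> -[y [y' [x [x' [hy hy' hx hx' le]]]]].
    by exists true, y, y', x, x'.
  have [y'L yL] : y' <= L /\ y <= L by lia.
  exists false, (L - y'), (L - y), x', x; split; rewrite /=; try lia.
  + have E1 : cost wm vm n true true (L - 1 - i) (L - (L - y')) = end_cost false (L - y') :=
      mirror_cost true (leq_subr _ _).
    by rewrite subKn // in E1; rewrite -[f i _]/(end_cost false _) -E1.
  + by rewrite /cost !subKn //.
  + move: le; rewrite /osig.
    have -> : (`|(sig L - sig (L - y)) - (sig L - sig (L - y'))| = gap (L - y') (L - y))%R.
      by congr (`|_|)%R; move: (sig L) (sig (L - y)) (sig (L - y')) => a b c; ring.
    by move: (gap _ _) => u; lra.
Qed.

End Sorted.

Lemma answer_ub a b c l : a < L -> b < L -> c < L ->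
  ub (t3 1 a b c) l <-> walk (del G [set path_edge s p a; path_edge s p b; path_edge s p c]) s t l.
Proof.
move=> aL bL cL; have [a_n b_n c_n] : [/\ a < n, b < n & c < n] by split; lia.
rewrite (answer_eq n0 E n_gt0) // ub_cmin /= orbF [N - 1]subn1.
set i := minn _ c; set k := maxn _ c; set j := a + b + c - i - k.
have [ij jk] : i <= j /\ j <= k by case: (sort3 a b c).
have kL : k < L by rewrite !gtn_max aL bL.
have -> : [set path_edge s p a; path_edge s p b; path_edge s p c] =
          [set path_edge s p i; path_edge s p j; path_edge s p k].
  have perm : perm_eq [:: a; b; c] [:: i; j; k] by case: (sort3 a b c).
  apply/setP => e; rewrite !inE.
  have := @perm_has _ _ _ (fun m => e == path_edge s p m) perm.
  by rewrite /= !orbF !orbA.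
rewrite -(@pattern_walk _ _ G s t p short_p H f g i j k) ?sizeL //.
- rewrite (pattern_crossing _ _ _ detour_sym ij jk kL).
  have k0 := @crossing_ub i j k ij jk kL false l.
  have k1 := @crossing_ub i j k ij jk kL true l.
  have k2 := @one_interval_ub i j k ij jk kL l.
  have k3 := @direct_ub i k l (leq_ltn_trans (leq_trans ij jk) (ltn_trans kL L_n)) kL.
  split.
  + case/or4P => [/k3|h|h|/orP[h|/orP[h|/orP[h|h]]]].
    * by move=> ?; apply: Or41.
    * by apply: Or42; apply/k2; left.
    * by apply: Or42; apply/k2; right.
    * by apply: Or43; apply/k0; left.
    * by apply: Or44; apply/k1; left.
    * by apply: Or43; apply/k0; right.
    * by apply: Or44; apply/k1; right.
  + by case=> [/k3 ->|/k2[]->|/k0[]->|/k1[]->]; rewrite ?orbT.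
- by move=> x y l' xL yL; apply: (@oH_ub false).
- by move=> *; apply: f_ub.
- by move=> *; apply: g_ub.
Qed.

End WithPath.
End FinalMemory.

Definition time_const := \sum_(ph <- phases) (phase_cost ph + 2).
Definition time_bound n := time_const * (n.+1 ^ 3 * (trunc_log 2 n).+1).

Lemma soft_O_time_bound : soft_O time_bound (fun n => n ^ 3).
Proof.
exists (time_const * 16), 1, 2 => n n2; rewrite /time_bound expn1 -mulnA leq_mul2l; apply/orP; right.
have l1 : 1 <= trunc_log 2 n by rewrite trunc_log_gt0.
have : n.+1 ^ 3 <= 8 * n ^ 3.
  by rewrite -[8]/(2 ^ 3) -expnMn leq_exp2r // mul2n -addnn -addn1 leq_add2l ltnW.
move: (n.+1 ^ 3) (n ^ 3) (trunc_log 2 n) l1 => a b c; nia.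
Qed.

Lemma phases_time_bound wm n (b : nat) : wm 0 0 = n -> 0 < n -> wm 2 n = b -> 0 < b ->
  phases_time phases wm <= time_const * (n.+1 ^ 3 * b).
Proof.
move=> n0 n_gt0 wb b_gt0.
have : List.Forall (fun ph => neval wm (phase_size ph) <= n.+1 ^ 3 * b) phases.
  have h1 : wm 0 0 * wm 0 0 * wm 0 0 <= n.+1 ^ 3 * b.
    by rewrite n0 3!expnS expn0 muln1; nia.
  have h2 : wm 0 0 * wm 0 0 * wm 0 0 + wm 0 0 * wm 0 0 <= n.+1 ^ 3 * b.
    by rewrite n0 3!expnS expn0 muln1; nia.
  have h3 : wm 0 0 * wm 0 0 <= n.+1 ^ 3 * b by apply: leq_trans h2; apply: leq_addl.
  have h4 : wm 0 0 <= n.+1 ^ 3 * b by apply: leq_trans h3; rewrite n0 leq_pmulr.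
  have h5 : wm 0 0 + 1 <= n.+1 ^ 3 * b.
    by rewrite n0 addn1 -[n.+1]muln1 leq_mul // 3!expnS expn0 muln1; nia.
  have h6 : wm 2 (wm 0 0) * wm 0 0 * wm 0 0 * wm 0 0 <= n.+1 ^ 3 * b.
    by rewrite n0 wb [leqRHS]mulnC -!mulnA leq_mul2l 3!expnS expn0 muln1; apply/orP; right; nia.
  have h7 : wm 2 (wm 0 0) * wm 0 0 * wm 0 0 <= n.+1 ^ 3 * b.
    by apply: leq_trans h6; rewrite n0 leq_pmulr.
  by rewrite /phases /=; do ![apply: List.Forall_cons; [first
    [exact: h1 | exact: h2 | exact: h3 | exact: h4 | exact: h5 | exact: h6 | exact: h7] | ]];
    apply: List.Forall_nil.
rewrite /phases_time /time_const; set B := n.+1 ^ 3 * b.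
have B_gt0 : 0 < B by rewrite muln_gt0 expn_gt0.
elim: phases => [|ph phs IH] h; first by rewrite !big_nil.
have [h0 h'] : neval wm (phase_size ph) <= B /\ List.Forall (fun ph => neval wm (phase_size ph) <= B) phs.
  by inversion h.
rewrite !big_cons mulnDl leq_add ?IH // mulnDl leq_add ?leq_mul2l ?h0 ?orbT //.
by rewrite leq_pmulr.
Qed.

Lemma input_bounded (R : realDomainType) (n : nat) (G : wgraph R n) (s t : 'I_n) :
  mem_bounded n.+1 (wmem (input_state G s t)).
Proof.
move=> a i /=; rewrite /array_degree; case: (a == 0) => //; rewrite expn1.
case: i => [|[|[|i]]] /=; [exact: leqnSn | exact: leqW (ltnW (ltn_ord s)) |
  exact: leqW (ltnW (ltn_ord t)) | by rewrite nth_nil].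
Qed.

Theorem theorem38 :
  exists (prog : cmd) (c : nat) (T : nat -> nat),
    soft_O T (fun n => n ^ 3) /\
    forall (R : realDomainType) (n : nat) (G : wgraph R n) (s t : 'I_n),
      unique_shortest_paths G ->
      exists (st : state R) (tau : nat),
        [/\ exec (word_size c n) prog (input_state G s t) tau st,
            tau <= T n
          & forall p : seq 'I_n, shortest_path G s t p ->
            forall d1 d2 d3 : {set 'I_n},
              d1 \in path_edges s p ->
              d2 \in path_edges s p ->
              d3 \in path_edges s p ->
              shortest_length (del G [set d1; d2; d3]) s t
                (answer st s p d1 d2 d3)].
Proof.
exists (phases_cmd phases), word_const, time_bound.
split; first exact: soft_O_time_bound.
move=> R n G s t uniqG; have n_gt0 : 0 < n by apply: leq_ltn_trans (ltn_ord s).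
have nw : n.+1 ^ word_const <= 2 ^ word_size word_const n.
  by rewrite /word_size mulnC expnM leq_exp2r // trunc_log_ltn.
have c_gt9 : 9 < word_const by [].
have [||||||st [tau [ex le E [pw _ pv]]]] := @phases_exec R n _ _ n_gt0 nw c_gt9 phases [:: 0] [:: 0]
  (input_state G s t) (input_bounded G s t) _ _ _ _ _ _ phases_wellformed => //.
- by move=> b i; rewrite !inE negb_or => /andP[_ /negPf h] /=; rewrite h.
- by move=> b i; rewrite !inE negb_or => /andP[_ /negPf h] /=; rewrite h.
have n0 : wmem st 0 0 = n by rewrite pw.
have s0 : wmem st 0 1 = s by rewrite pw.
have t0 : wmem st 0 2 = t by rewrite pw.
have v0 i : vmem st 0 i = input_weight G i by rewrite pv.
exists st, tau; split=> //.
  apply: leq_trans le _; apply: phases_time_bound => //.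
  by rewrite (levels_spec n0 E).
move=> p sp d1 d2 d3 h1 h2 h3.
have pos d : d \in path_edges s p -> exists2 a, index d (path_edges s p) = a &
    a < wmem st 5 n.-1 /\ d = path_edge s p a.
  move=> dp; exists (index d (path_edges s p)) => //.
  have [<- _] := computed_path n0 s0 t0 v0 E uniqG sp.
  have lt : index d (path_edges s p) < size p by rewrite -(size_pairmap (fun x y => [set x; y]) s) index_mem.
  by split=> //; rewrite -nth_path_edges // nth_index.
have [a e1 [l1 E1]] := pos _ h1; have [b e2 [l2 E2]] := pos _ h2; have [c e3 [l3 E3]] := pos _ h3.
apply: shortest_length_ub => l; rewrite /answer /triple_index e1 e2 e3 E1 E2 E3.
exact: (answer_ub n0 s0 t0 v0 E uniqG sp l l1 l2 l3).
Qed.
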